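(* Let $K$ be an algebraically closed field of characteristic zero, let $n\ge 1$ and $d\ge 1$, and let $V\subset\mathbb{P}^n$ be a hypersurface of degree $d$ with squarefree defining polynomial $f_V\in K[\boldsymbol{x}]=K[x_0,\dots,x_n]$. Then there is a homogeneous polynomial $\rho_V\in K[\boldsymbol{x}]$ with $$\deg(\rho_V)= d\sum_{k=1}^{n}\frac{n!}{k}-(n+1)!$$ defining the flex locus of $V$, that is, such that the flex locus of $V$ equals $\{p\in V : \rho_V(p)=0\}$. It is uniquely determined modulo $f_V$ by the condition that, for any linear form $\ell\in K[\boldsymbol{x}]$, $$\operatorname{Res}^{\boldsymbol{y}}\big(f_{V,1}(\boldsymbol{x},\boldsymbol{y}),\dots,f_{V,n}(\boldsymbol{x},\boldsymbol{y}),\ell(\boldsymbol{y})\big)\equiv \ell(\boldsymbol{x})^{n!}\,\rho_V(\boldsymbol{x}) \pmod{f_V}.$$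
   Context: $\mathbb{P}^n$ is projective space over $K$. A hypersurface $V$ need not be irreducible; $f_V$ is a homogeneous polynomial of minimal degree whose zero set is $V$ (it is squarefree and unique up to a nonzero scalar), and $d=\deg V=\deg f_V$. Order of contact: for $p\in V$ and a line $L\subset\mathbb{P}^n$ containing $p$, $\operatorname{ord}_p(V,L)=\dim_K(\mathcal{O}_{L,p}/\iota^*\mathcal{I}_V)\in\{1,2,\dots\}\cup\{+\infty\}$, where $\mathcal{O}_{L,p}$ is the local ring of $L$ at $p$, $\mathcal{I}_V$ is the ideal sheaf of $V$ and $\iota:L\hookrightarrow\mathbb{P}^n$ the inclusion. A point $p\in V$ is a flex point if there is a line $L\ni p$ with $\operatorname{ord}_p(V,L)\ge n+1$; the flex locus of $V$ is the set of its flex points. With $\boldsymbol{y}=(y_0,\dots,y_n)$ another set of variables and $t$ a variable, the polynomials $f_{V,k}\in K[\boldsymbol{x},\boldsymbol{y}]$ are determined by $f_V(\boldsymbol{x}+t\boldsymbol{y})=\sum_{k=0}^{d} f_{V,k}(\boldsymbol{x},\boldsymbol{y})\,t^k/k!$, with $f_{V,k}=0$ for $k>d$. $\operatorname{Res}^{\boldsymbol{y}}$ is the multivariate resultant of $n+1$ homogeneous polynomials in the variables $\boldsymbol{y}$, of respective $\boldsymbol{y}$-degrees $1,2,\dots,n,1$. In general, for $(d_0,\dots,d_n)$, let $F_i=\sum_{|\boldsymbol{a}|=d_i}c_{i,\boldsymbol{a}}\boldsymbol{y}^{\boldsymbol{a}}$ be the general homogeneous polynomials of degree $d_i$, $A=\mathbb{Z}[c_{i,\boldsymbol{a}}]$;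 the resultant $\operatorname{Res}_{(d_0,\dots,d_n)}\in A$ is the generator of the principal ideal $\{P\in A: P\cdot(y_0,\dots,y_n)^k\subset(F_0,\dots,F_n)\text{ for some }k\}$ normalized by the value $1$ at $(y_0^{d_0},\dots,y_n^{d_n})$, and it is evaluated at given polynomials by specializing coefficients (a zero polynomial $f_{V,k}$ is treated as a form of degree $k$). The zero polynomial is considered homogeneous of every degree.
   Formalization: Proved for n ≥ 2 instead of n ≥ 1: for n = 1 the congruences would force ∂f/∂x_0 = x_1ρ and ∂f/∂x_1 = −x_0ρ, hence d·f = 0, so no such ρ_V exists for any d (e.g. f = x_0, ℓ = x_1 would give 1 ≡ x_1ρ mod x_0). *)

(* Defs.v *)
(* Plain MathComp, with multinomials for polynomials in several variables.    *)
From HB Require Import structures.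
From mathcomp Require Import all_boot all_order all_algebra.
From mathcomp Require Export mpoly.
From Stdlib Require Import ClassicalEpsilon.

Set Implicit Arguments.
Unset Strict Implicit.
Unset Printing Implicit Defensive.

Import GRing.Theory.
Local Open Scope ring_scope.

Section Polynomials.

Variables (R : comNzRingType) (m : nat).
Implicit Types f p q : {mpoly R[m]}.

Definition mpoly_squarefree f :=
  f != 0 /\ forall g h : {mpoly R[m]}, f = g ^+ 2 * h -> (msize g <= 1)%N.

Definition eq_mod f p q := exists h : {mpoly R[m]}, p - q = h * f.

(* The degree is an integer because the degree of the flex polynomial is a    *)
(* difference, which can be negative; 0 is homogeneous of every degree.       *)
Definition homog_of_degree (D : int) p :=
  forall a : 'X_{1..m}, a \in msupp p -> (mdeg a)%:Z = D.

(* {mpoly {mpoly R[m]}[m]} stands for R[x, y]: the inner variables are x and  *)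
(* the outer ones are y. [expand f] is f(x + t y), a polynomial in t.         *)
Definition expand f : {poly {mpoly {mpoly R[m]}[m]}} :=
  mmap (fun c : R => (c%:MP%:MP)%:P)
       (fun i => (('X_i)%:MP)%:P + ('X_i)%:P * 'X) f.

Definition polar f (k : nat) : {mpoly {mpoly R[m]}[m]} :=
  (expand f)`_k *+ k`!.

(* l(y) in R[x, y], for l(x) in R[x].                                         *)
Definition in_y f : {mpoly {mpoly R[m]}[m]} :=
  map_mpoly (@mpolyC m R) f.

End Polynomials.

(* Resultants of m forms in m variables, the i-th one of degree d i.          *)
Section Resultant.

Variables (m : nat) (d : 'I_m -> nat).

(* The pairs (i, a) with |a| = d i; the type 'X_{1..m < D.+1} of monomials of *)
(* degree at most D, D the maximal degree, is only there to have a finType.   *)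
Definition coef_index : finType :=
  {ia : 'I_m * 'X_{1..m < (\max_(i < m) d i).+1} | mdeg ia.2 == d ia.1}.

Definition coef_ring := {mpoly int[#|coef_index|]}.

Definition general_form (i : 'I_m) : {mpoly coef_ring[m]} :=
  \sum_(c : coef_index | (val c).1 == i)
     ('X_(enum_rank c) : coef_ring) *: 'X_[(val c).2].

(* P (y_0, ..., y_(m-1))^k is contained in (F_0, ..., F_(m-1)) for some k; it *)
(* suffices to ask it for the monomials of degree k, which generate the power.*)
Definition inertia_form (P : coef_ring) :=
  exists k : nat, forall a : 'X_{1..m}, mdeg a = k ->
    exists Q : 'I_m -> {mpoly coef_ring[m]},
      P%:MP * 'X_[a] = \sum_(i < m) Q i * general_form i.

(* Value of P when the i-th general form is specialized to G i; only the      *)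
(* coefficients of G i in degree d i are used.                                *)
Definition specialize (S : comNzRingType) (P : coef_ring)
    (G : 'I_m -> {mpoly S[m]}) : S :=
  mmap (fun z : int => z%:~R : S)
       (fun j => let c := val (enum_val j : coef_index) in (G c.1)@_(c.2)) P.

Definition is_resultant (P : coef_ring) :=
  [/\ inertia_form P,
      forall Q, inertia_form Q -> exists S, Q = S * P
    & specialize P (fun i => 'X_i ^+ d i : {mpoly int[m]}) = 1].

Definition generic_resultant : coef_ring :=
  epsilon (inhabits 0) is_resultant.

Definition resultant (S : comNzRingType) (G : 'I_m -> {mpoly S[m]}) : S :=
  specialize generic_resultant G.

End Resultant.

(* Points of P^n are given by homogeneous coordinates, i.e. by the nonzero    *)
(* elements of 'rV[K]_n.+1.                                                   *)
Section Flexes.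

Variables (K : fieldType) (n : nat).
Implicit Types (f l : {mpoly K[n.+1]}) (p q : 'rV[K]_n.+1).

Definition on_zeros f p := f.@[p ord0] = 0.

(* When p and q span a line L, t |-> p + t q is an affine chart of L sending  *)
(* 0 to p, in which the local ring of L at p is the localization of K[t] at   *)
(* the maximal ideal (t), a subring of K(t).                                  *)
Definition in_local_ring (x : {fraction {poly K}}) :=
  exists a b : {poly K}, b.[0] != 0 /\ x = tofrac a / tofrac b.

Definition restrict_to_line f p q : {poly K} :=
  mmap (@polyC K) (fun i => (p ord0 i)%:P + (q ord0 i)%:P * 'X) f.

(* The restriction to L of the ideal of the hypersurface, at p. On P^n this   *)
(* ideal is generated by f / x_j^(deg f) where x_j is not 0 at p; pulled back *)
(* to L this is [restrict_to_line f p q] up to a unit of the local ring.      *)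
Definition in_contact_ideal f p q (x : {fraction {poly K}}) :=
  exists2 y, in_local_ring y & x = tofrac (restrict_to_line f p q) * y.

(* The order of contact, i.e. the dimension over K of the quotient of the     *)
(* local ring by the contact ideal, is at least r (possibly infinite): there  *)
(* are r elements that are linearly independent in the quotient.              *)
Definition contact_order_ge f p q (r : nat) :=
  exists e : 'I_r -> {fraction {poly K}},
    (forall i, in_local_ring (e i)) /\
    forall c : 'I_r -> K,
      in_contact_ideal f p q (\sum_(i < r) tofrac (c i)%:P * e i) ->
      forall i, c i = 0.

(* The lines through p are those joining p to a point q distinct from p.      *)
Definition is_flex f p :=
  on_zeros f p /\
  exists q, row_free (col_mx p q) /\ contact_order_ge f p q n.+1.

Definition flex_degrees (i : 'I_n.+1) : nat := if (i < n)%N then i.+1 else 1.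

(* f_{V,1}, ..., f_{V,n}, l(y)                                                *)
Definition flex_forms f l (i : 'I_n.+1) : {mpoly {mpoly K[n.+1]}[n.+1]} :=
  if (i < n)%N then polar f i.+1 else in_y l.

Definition flex_resultant f l : {mpoly K[n.+1]} :=
  resultant flex_degrees (flex_forms f l).

Definition flex_condition f rho :=
  forall l, l \is 1.-homog ->
    eq_mod f (flex_resultant f l) (l ^+ n`! * rho).

End Flexes.

(* The quotients n! / k are exact.                                            *)
Definition flex_degree (n d : nat) : int :=
  (d * \sum_(1 <= k < n.+1) n`! %/ k)%:Z - (n.+1`!)%:Z.

(* Main.v *)
(* Let N = n! and R(l) = Res(f_1, ..., f_n, l). At a point x of V, either     *)
(* some line through x has contact of order n + 1, and then R(l)(x) = 0 for   *)
(* all l, or R(l)(x) vanishes exactly when l(x) = 0, and then restricting to  *)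
(* pencils of linear forms gives R(l) l'^N = R(l') l^N at x. To conclude      *)
(* modulo f without the Nullstellensatz, this relation is applied, at every   *)
(* x, to h(x) f - f(x) h with h = l1^d; it is then an identity of             *)
(* polynomials, in which a power of h can be cancelled modulo f. For l1 and   *)
(* l2 forming a regular sequence modulo f, the relation R(l1) l2^N = R(l2)    *)
(* l1^N modulo f yields R(l1) = l1^N rho modulo f, whence R(l) = l^N rho      *)
(* modulo f for every l.                                                      *)
(*                                                                            *)
(* The resultant exists because the inertia forms are a prime ideal of height *)
(* one in a factorial ring; Macaulay's determinants bound its degree in the   *)
(* coefficients of each form by the product of the other degrees, and forms   *)
(* split into linear factors show that this bound is attained.                *)

(* Fix a point x of V. Up to the invertible factor k!, the k-th polar at (x, y) is the coefficient
   of t^k in f(x + t y), so y is a common zero of the first n polars exactly when t^(n+1) divides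
   f(x + t y) ([flex_forms_at_eq0]). The vector y = x is always such a zero. Adding an equation l(y)
   = 0 with l(x) != 0 excludes it and loses no flex line, since a direction y may be changed by a
   multiple of x ([flex_resultant_at_flex]). Thus R(l)(x) vanishes exactly at flexes when l(x) != 0,
   and it vanishes for every x with l(x) = 0. As R(l)(x) is a form of degree N = n! in the
   coefficients of l, at a point that is not a flex it is a constant times l(x)^N; in all cases R(l)
   l'^N = R(l') l^N at x ([flex_resultant_at_exchange]).

   Passing from points of V to congruences modulo f rests on [wronskian_exchange] and
   [wronskian_forms_mod], which give [flex_resultant_exchange]. The regular sequence l1, l2 of
   [regular_linear_forms] then divides R(l1) by l1^N, and cancelling powers of l1 gives both the
   congruence for every l and the uniqueness of rho. A graded component of the quotient has the
   required degree ([flex_polynomial_homog]), and evaluating the congruence for a coordinate that is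
   nonzero at p identifies the flex locus ([flex_condition_flex]).

   The rest is the theory of the resultant. The inertia forms are the kernel of a substitution into
   a field ([inertia_form_elim]), hence a prime ideal; no nonzero one avoids a chosen coefficient
   ([inertia_free_eq0]), and in a factorial ring ([factorial_mpoly]) such an ideal is principal
   ([principal_prime_ideal]). Macaulay's determinant is an inertia form that normalizes the
   generator and bounds its degrees; a pencil of split forms shows that the bounds are attained
   ([generic_resultant_homog]). Maximal minors and the projective Nullstellensatz show that the
   resultant vanishes exactly when there is a common zero ([resultant_eq0P]). *)
Require Import Defs.
From HB Require Import structures.
From mathcomp Require Import all_boot all_order all_algebra.
From mathcomp Require Import perm ring zify.
From Stdlib Require Import Classical ClassicalEpsilon.

Set Implicit Arguments.
Unset Strict Implicit.
Unset Printing Implicit Defensive.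

Import GRing.Theory.
Local Open Scope ring_scope.

(** * Polynomials *)

Lemma eq_mpoly_rmorphism (R S : comNzRingType) n
    (f g : {rmorphism {mpoly R[n]} -> S}) :
  (forall c, f c%:MP = g c%:MP) -> (forall i, f 'X_i = g 'X_i) -> f =1 g.
Proof.
move=> fgC fgX p; rewrite [p]mpolyE !rmorph_sum; apply: eq_bigr => m _.
rewrite -mul_mpolyC !rmorphM /= fgC mpolyXE_id !rmorph_prod; congr (_ * _).
by apply: eq_bigr => i _; rewrite !rmorphXn /= fgX.
Qed.

Lemma eq_poly_rmorphism (R S : comNzRingType) (f g : {rmorphism {poly R} -> S}) :
  (forall c, f c%:P = g c%:P) -> f 'X = g 'X -> f =1 g.
Proof.
move=> fgC fgX p; rewrite -[p]coefK poly_def !rmorph_sum; apply: eq_bigr => i _.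
by rewrite -mul_polyC !rmorphM !rmorphXn /= fgC fgX.
Qed.

Lemma rmorph_mmap (R S T : comNzRingType) n (phi : {rmorphism R -> S})
    (h : 'I_n -> S) (psi : {rmorphism S -> T}) p :
  psi (mmap phi h p) = mmap (psi \o phi) (psi \o h) p.
Proof.
rewrite /mmap rmorph_sum; apply: eq_bigr => m _; rewrite rmorphM /=.
congr (_ * _); rewrite /mmap1 rmorph_prod; apply: eq_bigr => i _.
by rewrite rmorphXn.
Qed.

Lemma eq_mmap (R S : nzRingType) n (f g : R -> S) (h k : 'I_n -> S) p :
  f =1 g -> h =1 k -> mmap f h p = mmap g k p.
Proof.
move=> fg hk; apply: eq_bigr => m _; rewrite fg; congr (_ * _).
exact: mmap1_eq.
Qed.

(** The fraction field is hidden behind an existential: later arguments see only a field and an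
    injective morphism. *)
Lemma fraction_embedding (R : idomainType) :
  exists (L : fieldType) (tau : {rmorphism R -> L}), injective tau.
Proof.
exists {fraction R}, (@tofrac R).
by move=> p q /eqP; rewrite tofrac_eq => /eqP.
Qed.

Lemma mpoly2_fraction_embedding (R : idomainType) n m :
  exists (L : fieldType) (tau : {rmorphism {mpoly {mpoly R[n]}[m]} -> L}), injective tau.
Proof. exact: fraction_embedding. Qed.

Section Weight.

Variables (N : nat) (w : 'I_N -> nat).

(** Declared a [measure], so that homogeneity and the projections [pihomog] are available for any
    grading of the variables. *)
Definition weight (m : 'X_{1..N}) : nat := (\sum_i m i * w i)%N.

Lemma weight0 : weight 0%MM = 0%N.
Proof. by rewrite /weight big1 // => i _; rewrite mnm0E. Qed.

Lemma weightD : {morph weight : m1 m2 / (m1 + m2)%MM >-> (m1 + m2)%N}.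
Proof.
move=> m1 m2; rewrite /weight -big_split; apply: eq_bigr => i _.
by rewrite mnmDE mulnDl.
Qed.

#[hnf] HB.instance Definition _ := isMeasure.Build N weight weight0 weightD.

Lemma weightU i : weight U_(i)%MM = w i.
Proof.
rewrite /weight (bigD1 i) //= big1 ?mnm1E ?eqxx ?mul1n ?addn0 //.
by move=> j ji; rewrite mnm1E eq_sym (negPf ji).
Qed.

End Weight.

(** The coefficient at the degree bound, which may be zero, is multiplicative over any commutative
    ring, unlike the leading coefficient. *)
Lemma size_prod_exp_leq (S : comNzRingType) (I : Type) (r : seq I)
    (h : I -> {poly S}) (w e : I -> nat) :
  (forall i, size (h i) <= (w i).+1)%N ->
  (size (\prod_(i <- r) h i ^+ e i)%R
     <= (\sum_(i <- r) e i * w i).+1)%N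
  /\ (\prod_(i <- r) h i ^+ e i)`_(\sum_(i <- r) e i * w i)
     = \prod_(i <- r) (h i)`_(w i) ^+ e i.
Proof.
have mulP (p q : {poly S}) a b : (size p <= a.+1)%N -> (size q <= b.+1)%N ->
    (size (p * q)%R <= (a + b).+1)%N /\ (p * q)`_(a + b) = p`_a * q`_b.
  move=> sp sq; split.
    apply: leq_trans (size_polyMleq _ _) _; rewrite -ltnS.
    case: (size p + size q)%N (leq_add sp sq) => //= k.
    by rewrite addSn addnS ltnS.
  (* For i < a the second factor is beyond its bound, for i > a the first one is; only i = a
     remains. *)
  rewrite coefM (bigD1 (inord a)) //= inordK ?ltnS ?leq_addr // addKn.
  rewrite big1 ?addr0 // => i; rewrite -val_eqE /= inordK ?ltnS ?leq_addr //.
  move=> ia; case: (ltngtP i a) => [lt|lt|/eqP]; last by rewrite (negPf ia).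
    rewrite [X in _ * X]nth_default ?mulr0 //; apply: leq_trans sq _.
    by rewrite ltn_subRL ltn_add2r.
  by rewrite nth_default ?mul0r //; apply: leq_trans sp _.
move=> hw; elim: r => [|i r [IH1 IH2]].
  by rewrite !big_nil size_poly1 coefC.
rewrite !big_cons.
have [e1 e2] : (size (h i ^+ e i)%R <= (e i * w i).+1)%N /\
    (h i ^+ e i)`_(e i * w i) = (h i)`_(w i) ^+ e i.
  elim: (e i) => [|k [IHk1 IHk2]].
    by rewrite !expr0 mul0n size_poly1 coefC.
  rewrite !exprS mulSn; have [-> ->] := mulP _ _ _ _ (hw i) IHk1.
  by rewrite IHk2.
by have [-> ->] := mulP _ _ _ _ e1 IH1; rewrite e2 IH2.
Qed.

Section TopCoefficient.

Variables (N : nat) (R S : comNzRingType) (phi : {rmorphism R -> S}).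
Variables (h : 'I_N -> {poly S}) (w : 'I_N -> nat).
Hypothesis size_h : forall i, (size (h i) <= (w i).+1)%N.

Lemma size_mmap_weight (P : {mpoly R[N]}) k :
  (forall m, m \in msupp P -> weight w m <= k)%N ->
  (size (mmap (polyC \o phi) h P) <= k.+1)%N.
Proof.
move=> wP; rewrite /mmap big_seq; apply: leq_trans (size_sum _ _ _) _.
apply/bigmax_leqP_seq => m mP _; rewrite mul_polyC.
apply: leq_trans (size_scale_leq _ _) _; rewrite /mmap1.
have [+ _] := size_prod_exp_leq (index_enum 'I_N) m size_h.
by move/leq_trans; apply; rewrite ltnS wP.
Qed.

(** A monomial of weight below k cannot reach degree k, and one of weight k does so only through the
    top coefficients of the substituted polynomials. *)
Lemma coef_mmap_weight (P : {mpoly R[N]}) k :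
  (forall m, m \in msupp P -> weight w m <= k)%N ->
  (mmap (polyC \o phi) h P)`_k =
  mmap phi (fun i => (h i)`_(w i)) (pihomog (weight w) k P).
Proof.
move=> wP; rewrite [in LHS]/mmap coef_sum pihomogE raddf_sum /= [in RHS]big_mkcond /=.
rewrite big_seq [RHS]big_seq; apply: eq_bigr => m mP; rewrite mul_polyC coefZ.
have [s c] := size_prod_exp_leq (index_enum 'I_N) m size_h.
case: eqP => [<-|/eqP wk].
  rewrite mmapZ mmapX; congr (_ * _).
  by rewrite /mmap1 /weight c.
rewrite [(mmap1 h m)`_k]nth_default ?mulr0 //; apply: leq_trans s _.
by rewrite ltn_neqAle wP // andbT.
Qed.

End TopCoefficient.

Section IsolateVariable.

Variables (R : comNzRingType) (n : nat) (j : 'I_n.+1).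

(** With its inverse [unisolate], the isomorphism that lets univariate tools (Gauss's lemma, gcds,
    division by a monic polynomial) act on one variable. *)
Definition isolate : {mpoly R[n.+1]} -> {poly {mpoly R[n]}} :=
  mmap (polyC \o @mpolyC n R)
       (fun i => if unlift j i is Some k then ('X_k)%:P else 'X).

HB.instance Definition _ := GRing.RMorphism.on isolate.

Definition insert_variable : {mpoly R[n]} -> {mpoly R[n.+1]} :=
  mmap (@mpolyC n.+1 R) (fun k => 'X_(lift j k)).

HB.instance Definition _ := GRing.RMorphism.on insert_variable.

Lemma comm_insert : commr_rmorph insert_variable 'X_j.
Proof. by move=> x; apply: mulrC. Qed.

Definition unisolate : {poly {mpoly R[n]}} -> {mpoly R[n.+1]} :=
  horner_morph comm_insert.

HB.instance Definition _ := GRing.RMorphism.on unisolate.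

Lemma isolateX : isolate 'X_j = 'X.
Proof. by rewrite /isolate mmapX mmap1U unlift_none. Qed.

Lemma isolate_lift k : isolate 'X_(lift j k) = ('X_k)%:P.
Proof. by rewrite /isolate mmapX mmap1U liftK. Qed.

Lemma isolateC c : isolate c%:MP = c%:MP%:P.
Proof. by rewrite /isolate mmapC. Qed.

Lemma unisolateX : unisolate 'X = 'X_j.
Proof. exact: horner_morphX. Qed.

Lemma unisolateC p : unisolate p%:P = insert_variable p.
Proof. exact: horner_morphC. Qed.

Lemma insert_variableX k : insert_variable 'X_k = 'X_(lift j k).
Proof. by rewrite /insert_variable mmapX mmap1U. Qed.

Lemma insert_variableC c : insert_variable c%:MP = c%:MP.
Proof. by rewrite /insert_variable mmapC. Qed.

Lemma isolateK : cancel isolate unisolate.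
Proof.
apply: (@eq_mpoly_rmorphism _ _ _ (unisolate \o isolate) idfun) => [c|i] /=.
  by rewrite isolateC unisolateC insert_variableC.
case: (unliftP j i) => [k|] ->.
  by rewrite isolate_lift unisolateC insert_variableX.
by rewrite isolateX unisolateX.
Qed.

Lemma unisolateK : cancel unisolate isolate.
Proof.
apply: (@eq_poly_rmorphism _ _ (isolate \o unisolate) idfun) => [c|] /=.
  rewrite unisolateC.
  apply: (@eq_mpoly_rmorphism _ _ _ (isolate \o insert_variable) polyC) => [a|i] /=.
    by rewrite insert_variableC isolateC.
  by rewrite insert_variableX isolate_lift.
by rewrite unisolateX isolateX.
Qed.

End IsolateVariable.

(** * Factorial domains *)

Section Factorial.

Variable R : idomainType.
Implicit Types (a b p : R) (ps : seq R).

Definition divides a b := exists c, b = c * a.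

Definition prime_element p :=
  [/\ p != 0, p \isn't a GRing.unit
    & forall a b, divides p (a * b) -> divides p a \/ divides p b].

(** Factors are asked to be prime and not only irreducible, which makes uniqueness up to units
    automatic. *)
Definition factorial_domain :=
  forall a, a != 0 -> exists u ps,
    [/\ u \is a GRing.unit, {in ps, forall p, prime_element p}
      & a = u * \prod_(p <- ps) p].

Lemma divides_unit a u : u \is a GRing.unit -> divides a u -> a \is a GRing.unit.
Proof. by move=> uU [x e]; move: uU; rewrite e unitrM => /andP[]. Qed.

Lemma prime_divides_prod p u ps :
  prime_element p -> u \is a GRing.unit -> divides p (u * \prod_(q <- ps) q) ->
  exists2 q, q \in ps & divides p q.
Proof.
move=> [p0 pU pP] uU; elim: ps => [|q ps IH].
  by rewrite big_nil mulr1 => /(divides_unit uU); rewrite (negPf pU).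
rewrite big_cons mulrCA => /pP[pq|/IH[r rps pr]].
  by exists q; rewrite ?mem_head.
by exists r; rewrite // in_cons rps orbT.
Qed.

Lemma prime_divides_sym p q :
  prime_element p -> prime_element q -> divides p q -> divides q p.
Proof.
move=> [p0 pU _] [q0 qU qP] [v e].
have [|[w ew]|//] := qP v p; first by exists 1; rewrite mul1r e.
case/negP: pU; apply/unitrP; exists w.
suff wp : w * p = 1 by rewrite (mulrC p) wp.
by apply: (mulIf q0); rewrite mul1r {2}e ew mulrAC.
Qed.

End Factorial.

(** * Gauss's lemma: polynomials over a factorial domain *)

Section Gauss.

Variable R : idomainType.
Hypothesis factR : factorial_domain R.
Implicit Types f g h : {poly R}.

Lemma dividesC (c : R) f : divides c%:P f <-> forall i, divides c f`_i.
Proof.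
split=> [[g ->] i|cf]; first by exists g`_i; rewrite coefMC.
have [d dP] : exists d : nat -> R, forall i, f`_i = d i * c.
  exists (fun i => projT1 (constructive_indefinite_description _ (cf i))).
  by move=> i; case: constructive_indefinite_description.
exists (\poly_(i < size f) d i); apply/polyP => i; rewrite coefMC coef_poly.
by case: ltnP => // /leq_sizeP -> //; rewrite mul0r.
Qed.

(** If p divides neither f nor g, let f_i and g_j be their first coefficients that p does not
    divide. In the coefficient of degree i + j of f g all other terms are multiples of p, so p
    divides f_i g_j, a contradiction. *)
Lemma prime_element_polyC (p : R) : prime_element p -> prime_element p%:P.
Proof.
move=> [p0 pU pP]; split; first by rewrite polyC_eq0.
  by rewrite poly_unitE size_polyC p0 coefC eqxx (negPf pU).
move=> f g /dividesC pfg.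
apply: NNPP => /not_or_and[/dividesC nf /dividesC ng].
have first_ndiv (h : {poly R}) : ~ (forall i, divides p h`_i) ->
    exists i, ~ divides p h`_i /\ forall j, (j < i)%N -> divides p h`_j.
  move=> /not_all_ex_not[i]; elim/ltn_ind: i => i IH ni.
  case: (classic (forall j, (j < i)%N -> divides p h`_j)) => [|/not_all_ex_not[j]].
    by exists i.
  by move=> nH; have [ji nj] := imply_to_and _ _ nH; apply: (IH j).
have [i [ni Hi]] := first_ndiv f nf; have [j [nj Hj]] := first_ndiv g ng.
have : divides p (f`_i * g`_j); last by case/pP.
have [c] := pfg (i + j)%N.
have ltij : (i < (i + j).+1)%N by rewrite ltnS leq_addr.
rewrite coefM (bigD1 (Ordinal ltij)) //= addKn => ec.
have [y ey] : divides p (\sum_(k < (i + j).+1 | k != Ordinal ltij) f`_k * g`_(i + j - k)).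
  elim/big_rec: _ => [|k x ki [z ->]]; first by exists 0; rewrite mul0r.
  suff [y ->] : divides p (f`_k * g`_(i + j - k)) by exists (y + z); rewrite mulrDl.
  move: ki; rewrite -val_eqE /=; case: (ltngtP k i) => // [ki|ik] _.
    by have [y ->] := Hi k ki; exists (y * g`_(i + j - k)); rewrite mulrAC.
  have [|y ->] := Hj (i + j - k)%N.
    by rewrite ltn_subLR ?ltn_add2r // -ltnS.
  by exists (f`_k * y); rewrite mulrA.
by exists (c - y); rewrite mulrBl -ec ey addrK.
Qed.

Definition primitive f := f != 0 /\ forall p : R, prime_element p -> ~ divides p%:P f.

(** The constant is cancelled one prime at a time: each prime of c divides h f but not the primitive
    f, hence divides h. *)
Lemma primitive_divides (c : R) f g h :
  c != 0 -> primitive f -> c%:P * g = h * f -> divides f g.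
Proof.
move=> c0 [f0 fP]; have [u [ps [uU psP ->]]] := factR c0.
elim: ps psP g h => [|p ps IH] psP g h.
  rewrite big_nil mulr1 => e; exists ((u^-1)%:P * h).
  by rewrite -mulrA -e mulrA -polyCM mulVr // mul1r.
have [|pp psP'] := (psP p _, fun q qs => psP q (mem_behead (s := p :: ps) qs)).
  exact: mem_head.
have [pP0 pPU pPP] := prime_element_polyC pp.
rewrite big_cons => e.
have [|[h' eh]|/(fP p pp) //] := pPP h f.
  by exists ((u * \prod_(q <- ps) q)%:P * g); rewrite -e !polyCM; ring.
apply: (IH psP' g h'); apply: (mulIf pP0).
by rewrite [RHS]mulrAC -eh -e !polyCM; ring.
Qed.

Lemma primitive_part f : f != 0 -> exists c f0, [/\ c != 0, primitive f0 & f = c%:P * f0].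
Proof.
move=> nf; have : lead_coef f != 0 by rewrite lead_coef_eq0.
case/factR => u [ps [uU psP e]].
(* Induction on the number of primes in the leading coefficient: extracting a constant prime factor
   of f removes one. When none of them divides f, no prime does, since it would be associated to one
   of them. *)
have [k] := ubnP (size ps); elim: k => // k IH in f nf ps psP e *; rewrite ltnS => sk.
case: (classic (exists2 p, p \in ps & divides p%:P f)) => [[p pps [g eg]]|np].
  have pp := psP p pps; have [p0 pU _] := pp.
  have ng : g != 0 by apply: contraNneq nf => g0; rewrite eg g0 mul0r.
  have [|||c [f0 [c0 f0P e0]]] := IH g ng (rem p ps).
  - by move=> q /mem_rem; apply: psP.
  - apply: (mulIf p0); rewrite -mulrA [X in _ = _ * X]mulrC.
    by move: e; rewrite (big_rem p pps) /= => <-; rewrite eg lead_coefM lead_coefC.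
  - by rewrite size_rem // -ltnS prednK //; case: (ps) pps sk.
  exists (c * p), f0; split => //; first by rewrite mulf_neq0.
  by rewrite polyCM mulrAC -e0.
exists 1, f; rewrite oner_neq0 mul1r; split=> //; split=> // p pp pf; apply: np.
have [|q qps pq] := prime_divides_prod pp uU (ps := ps).
  by rewrite -e lead_coefE; have /dividesC := pf; apply.
exists q => //; have [x ex] := prime_divides_sym pp (psP q qps) pq.
by case: pf => y ->; exists (y * x%:P); rewrite ex polyCM mulrA.
Qed.

Lemma primitive_dividesl f g : primitive (f * g) -> primitive g.
Proof.
move=> [fg0 fgP]; split; first by apply: contraNneq fg0 => ->; rewrite mulr0.
by move=> p pp [h e]; apply: (fgP p pp); exists (f * h); rewrite e mulrA.
Qed.

Lemma primitive_const f : primitive f -> size f = 1%N -> f \is a GRing.unit.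
Proof.
move=> [f0 fP] /eqP/size_poly1P [c c0 e]; rewrite e.
have [u [[|p ps] [uU psP ec]]] := factR c0.
  by rewrite big_nil mulr1 in ec; rewrite poly_unitE size_polyC c0 coefC eqxx ec uU.
case: (fP p); first by apply: psP; rewrite mem_head.
exists (u * \prod_(q <- ps) q)%:P; rewrite e ec big_cons -polyCM; congr _%:P; ring.
Qed.

(** Let f divide g h. If f and g are coprime over the fraction field, Bezout gives a nonzero
    constant c = a f + b g, so f divides c h and hence h. Otherwise the primitive part d of their
    gcd is a nonconstant divisor of f; by irreducibility f is associated to d, which divides g. *)
Lemma irreducible_primitive_prime f : primitive f -> (1 < size f)%N ->
  (forall g h, f = g * h -> (1 < size g)%N -> size h = 1%N) -> prime_element f.
Proof.
move=> fprim sf firr; have [f0 fP] := fprim; split=> //.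
  by apply: contraTN sf; rewrite poly_unitE => /andP[/eqP->].
move=> g h [k ek]; have [g0|g0] := eqVneq g 0.
  by left; exists 0; rewrite mul0r.
case: (eqVneq (size (gcdp f g)) 1%N) => [/eqP|sd].
  rewrite -coprimep_def => /Bezout_coprimepP[[a b] /= eab]; right.
  have : size (a * f + b * g) == 1%N by rewrite (eqp_size eab) size_poly1.
  case/size_poly1P => c c0 ec; apply: (@primitive_divides c f h (a * h + b * k)) => //.
  by rewrite -ec !mulrDl -[b * g * h]mulrA ek; ring.
left; have d0 : gcdp f g != 0 by rewrite gcdp_eq0 negb_and f0.
have [c [d [c0 dprim ed]]] := primitive_part d0.
have {}sd : (1 < size d)%N.
  rewrite ltn_neqAle eq_sym lt0n size_poly_eq0 (proj1 dprim) andbT.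
  by move: sd; rewrite ed mul_polyC size_scale.
have ddiv (p : {poly R}) : gcdp f g %| p -> divides d p.
  case/Pdiv.Idomain.dvdpP => -[a q] /= a0; rewrite ed -mul_polyC mulrA.
  exact: primitive_divides.
have [x ex] := ddiv f (dvdp_gcdl _ _); have [y ->] := ddiv g (dvdp_gcdr _ _).
rewrite mulrC in ex; have sx := firr d x ex sd.
have /primitive_const/(_ sx)/unitrP[z [zx xz]] : primitive x.
  by apply: (@primitive_dividesl d); rewrite -ex.
by exists (y * z); rewrite ex -mulrA; congr (_ * _); rewrite mulrCA zx mulr1.
Qed.

(** The content is factored in R. A primitive polynomial is a unit, a prime, or a product of two
    primitive polynomials of smaller positive degree. *)
Lemma factorial_poly : factorial_domain {poly R}.
Proof.
move=> f f0; have [c [g [c0 gprim ->]]] := primitive_part f0.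
suff [v [qs [vU qsP ->]]] : exists v qs, [/\ v \is a GRing.unit,
    {in qs, forall p, prime_element p} & g = v * \prod_(q <- qs) q].
  have [u [ps [uU psP ->]]] := factR c0.
  exists (u%:P * v), ([seq p%:P | p <- ps] ++ qs); split.
  - rewrite unitrM vU andbT poly_unitE size_polyC coefC eqxx uU andbT eqb1.
    by apply: contraTneq uU => ->; rewrite unitr0.
  - move=> q; rewrite mem_cat => /orP[/mapP[p /psP pp ->]|/qsP//].
    exact: prime_element_polyC.
  - by rewrite big_cat big_map /= polyCM rmorph_prod; ring.
have [k] := ubnP (size g); elim: k g gprim {f0 c0} => // k IH g gprim; rewrite ltnS => sg.
have g0 := proj1 gprim.
have [sg1|] := leqP (size g) 1.
  exists g, [::]; rewrite big_nil mulr1; split=> //; apply: primitive_const => //.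
  by apply/eqP; rewrite eqn_leq sg1 lt0n size_poly_eq0.
move=> sg1; case: (classic (prime_element g)) => [gp|ngp].
  exists 1, [:: g]; rewrite big_seq1 mul1r unitr1; split=> // q.
  by rewrite inE => /eqP ->.
have [a [b [eab sa sb]]] : exists a b, [/\ g = a * b, (1 < size a)%N & (1 < size b)%N].
  apply: NNPP => nab; apply: ngp; apply: irreducible_primitive_prime => // a b eab sa.
  apply/eqP; move: g0; rewrite eab mulf_eq0 negb_or => /andP[_].
  rewrite -size_poly_eq0 -lt0n => sb; rewrite eqn_leq sb andbT leqNgt.
  by apply/negP => sb'; apply: nab; exists a, b.
have [a0 b0] : a != 0 /\ b != 0 by apply/andP; rewrite -negb_or -mulf_eq0 -eab.
have sab : (size g = (size a + size b).-1)%N by rewrite eab size_mul.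
have [||u [ps [uU psP ea]]] := IH a.
- by apply: (@primitive_dividesl b); rewrite mulrC -eab.
- apply: leq_trans sg; rewrite sab; move: sa sb; rewrite -!subn1; lia.
have [||v [qs [vU qsP eb]]] := IH b.
- by apply: (@primitive_dividesl a); rewrite -eab.
- apply: leq_trans sg; rewrite sab; move: sa sb; rewrite -!subn1; lia.
exists (u * v), (ps ++ qs); split; first by rewrite unitrM uU.
  by move=> q; rewrite mem_cat => /orP[/psP|/qsP].
by rewrite big_cat /= eab ea eb; ring.
Qed.

End Gauss.

Lemma prime_element_iso (R S : idomainType) (f : {rmorphism R -> S})
    (g : {rmorphism S -> R}) p :
  cancel f g -> cancel g f -> prime_element p -> prime_element (f p).
Proof.
move=> fK gK [p0 pU pP]; split.
- by rewrite (can2_eq fK gK) rmorph0.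
- by apply: contraNN pU => /(rmorph_unit g); rewrite fK.
move=> x y [z ez]; have [|[w ew]|[w ew]] := pP (g x) (g y).
- by exists (g z); rewrite -rmorphM ez rmorphM fK.
- by left; exists (f w); rewrite -[x]gK ew rmorphM.
- by right; exists (f w); rewrite -[y]gK ew rmorphM.
Qed.

Lemma factorial_iso (R S : idomainType) (f : {rmorphism R -> S}) (g : {rmorphism S -> R}) :
  cancel f g -> cancel g f -> factorial_domain R -> factorial_domain S.
Proof.
move=> fK gK factR a a0; have [|u [ps [uU psP e]]] := factR (g a).
  by rewrite (can2_eq gK fK) rmorph0.
exists (f u), [seq f p | p <- ps]; split; first exact: rmorph_unit.
  by move=> q /mapP[p /psP pp ->]; apply: prime_element_iso pp.
by rewrite big_map -rmorph_prod -rmorphM -e gK.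
Qed.

Lemma factorial_int : factorial_domain int.
Proof.
move=> a; have [k] := ubnP `|a|%N; elim: k a => // k IH a; rewrite ltnS => ak a0.
have [a1|a1] := eqVneq `|a|%N 1%N.
  by exists a, [::]; rewrite big_nil mulr1; split=> //; rewrite qualifE /=;
    case: a a1 {ak a0} => [[|[|?]]|[|?]].
have pp : prime (pdiv `|a|) by rewrite pdiv_prime // ltn_neqAle eq_sym a1 absz_gt0.
set p := pdiv _ in pp.
have /dvdzP[b eb] : (p%:Z %| a)%Z by rewrite dvdzE pdiv_dvd.
have b0 : b != 0 by apply: contraNneq a0 => b0; rewrite eb b0 mul0r.
have [||u [ps [uU psP e]]] := IH b.
- apply: leq_trans ak; rewrite eb abszM /= -[X in (X < _)%N]muln1 ltn_pmul2l ?absz_gt0 //.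
  exact: prime_gt1.
- by [].
exists u, (p%:Z :: ps); split=> //; last first.
  by rewrite big_cons eb e; ring.
move=> q; rewrite inE => /orP[/eqP ->|/psP //]; split.
- by case: (p) pp.
- by apply/negP; rewrite qualifE /=; case: (p) pp => [|[|?]].
move=> x y [z ez]; have : (p%:Z %| x * y)%Z by apply/dvdzP; exists z.
by rewrite dvdzE abszM Euclid_dvdM // => /orP[] pd; [left|right]; apply/dvdzP; rewrite dvdzE.
Qed.

Lemma factorial_mpoly (R : idomainType) n :
  factorial_domain R -> factorial_domain {mpoly R[n]}.
Proof.
move=> factR; elim: n => [|n IH].
  pose f : {rmorphism R -> {mpoly R[0]}} := @mpolyC 0 R.
  pose g : {rmorphism {mpoly R[0]} -> R} := @mcoeff 0 R 0%MM.
  apply: (@factorial_iso _ _ f g) factR => x /=; first by rewrite mpolyCK.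
  by rewrite /f /g /= -nvar0_mpolyC.
exact: (factorial_iso (@unisolateK R n ord0) (@isolateK R n ord0) (factorial_poly IH)).
Qed.

(** With g the gcd, c f = x g: f cannot divide x, which would make g constant, so f divides g. Then
    f divides c' h for a nonzero constant c', which f cannot divide. *)
Lemma prime_dividesP_gcdp (R : idomainType) (f h : {poly R}) :
  prime_element f -> (1 < size f)%N -> (1 < size (gcdp f h))%N -> divides f h.
Proof.
move=> [f0 fU fP] size_f sg; have [->|h0] := eqVneq h 0.
  by exists 0; rewrite mul0r.
have /Pdiv.Idomain.dvdpP[[c x] /= c0 ex] := dvdp_gcdl f h.
have /Pdiv.Idomain.dvdpP[[c' y] /= c'0 ey] := dvdp_gcdr f h.
set g := gcdp _ _ in sg ex ey.
have [|[z ez]|[z ez]] := fP x g; first by exists c%:P; rewrite mul_polyC.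
  have e : c%:P = z * g by apply: (mulIf f0); rewrite mul_polyC ex ez; ring.
  have z0 : z != 0 by apply: contraNneq c0 => z0; rewrite -polyC_eq0 e z0 mul0r.
  have g0 : g != 0 by rewrite -size_poly_gt0 (ltn_trans _ sg).
  have := congr1 (fun q : {poly _} => size q) e.
  rewrite size_polyC c0 size_mul //; move: sg; rewrite -size_poly_gt0 in z0; lia.
have [||//] := fP c'%:P h.
  by exists (y * z); rewrite mul_polyC ey ez; ring.
move=> [w ew].
have w0 : w != 0 by apply: contraNneq c'0 => w0; rewrite -polyC_eq0 ew w0 mul0r.
have := congr1 (fun q : {poly _} => size q) ew.
rewrite size_polyC c'0 size_mul //; move: size_f; rewrite -size_poly_gt0 in w0; lia.
Qed.

(** The univariate resultant of f and h is a constant lying in I, so it is 0 and the two have a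
    common factor. *)
Lemma gcdp_in_prime_ideal (R : idomainType) (I : {poly R} -> Prop) f h :
  (forall a b, I a -> I b -> I (a + b)) -> (forall a b, I b -> I (a * b)) ->
  (forall c, I c%:P -> c = 0) -> I f -> I h -> f != 0 -> h != 0 ->
  (1 < size f)%N /\ (1 < size (gcdp f h))%N.
Proof.
move=> ID IM IC If Ih f0 h0.
have sz g : g != 0 -> I g -> (1 < size g)%N.
  move=> g0 Ig; rewrite ltnNge; apply/negP => /size1_polyC e; case/negP: g0.
  by rewrite e polyC_eq0 (IC g`_0) // -e.
have [uv _ e] := resultant_in_ideal (sz f f0 If) (sz h h0 Ih).
split; first exact: sz.
rewrite -resultant_eq0; apply/eqP/IC; rewrite e.
by apply: ID; apply: IM.
Qed.

(* A prime ideal without nonzero elements free of one variable has height at  *)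
(* most one, because the resultant of two elements in that variable vanishes. *)
Lemma principal_prime_ideal (R : idomainType) N (j : 'I_N.+1)
    (I : {mpoly R[N.+1]} -> Prop) :
  factorial_domain R ->
  (forall a b, I a -> I b -> I (a + b)) -> (forall a b, I b -> I (a * b)) ->
  (forall a b, I (a * b) -> I a \/ I b) -> ~ I 1 ->
  (exists2 a, a != 0 & I a) -> (forall p, I (insert_variable j p) -> p = 0) ->
  exists P, [/\ I P, P != 0 & forall Q, I Q -> divides P Q].
Proof.
move=> factR ID IM Iprime I1 [a a0 Ia] Ij.
have [u [ps [uU psP ea]]] := factorial_mpoly (n := N.+1) factR a0.
(* A prime factor of [a] lies in the prime ideal; it will be the generator. *)
have [P pP IP] : exists2 P, prime_element P & I P.
  have : I (\prod_(p <- ps) p).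
    by rewrite -[\prod_(p <- ps) p](mulKr uU) -ea; apply: IM.
  elim: ps psP {ea} => [|p ps IH] psP; first by rewrite big_nil.
  rewrite big_cons => /Iprime[Ip|/IH]; first by exists p => //; apply: psP; rewrite mem_head.
  by apply=> q qs; apply: psP; rewrite in_cons qs orbT.
exists P; split=> //; first by case: pP.
move=> Q IQ; have [->|Q0] := eqVneq Q 0; first by exists 0; rewrite mul0r.
pose iso : {rmorphism {mpoly R[N.+1]} -> {poly {mpoly R[N]}}} := isolate j.
pose uniso : {rmorphism {poly {mpoly R[N]}} -> {mpoly R[N.+1]}} := unisolate j.
have isoK : cancel iso uniso := isolateK j.
have unisoK : cancel uniso iso := unisolateK j.
have unisoC c : uniso c%:P = insert_variable j c := unisolateC j c.
move: iso uniso isoK unisoK unisoC => iso uniso isoK unisoK unisoC.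
have iso0 A : A != 0 -> iso A != 0.
  by apply: contraNneq => e; rewrite -(isoK A) e rmorph0.
have [|||||||size_f sg] := @gcdp_in_prime_ideal _ (fun A => I (uniso A)) (iso P) (iso Q).
- by move=> x y Ix Iy; rewrite rmorphD; apply: ID.
- by move=> x y Iy; rewrite rmorphM; apply: IM.
- by move=> c; rewrite unisoC; apply: Ij.
- by rewrite isoK.
- by rewrite isoK.
- by apply: iso0; case: pP.
- exact: iso0.
have [z ez] := prime_dividesP_gcdp (prime_element_iso isoK unisoK pP) size_f sg.
by exists (uniso z); rewrite -(isoK Q) ez rmorphM isoK.
Qed.

Lemma msupp_insert_variable (R : comNzRingType) N (j : 'I_N.+1) (p : {mpoly R[N]}) a :
  a \in msupp (insert_variable j p) -> a j = 0%N.
Proof.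
rewrite /insert_variable /mmap => /msupp_sum_le /flatten_mapP[b _].
rewrite mul_mpolyC => /msuppZ_le; rewrite /mmap1.
have -> : \prod_i 'X_(lift j i) ^+ b i = 'X_[\sum_i U_(lift j i) *+ b i] :> {mpoly R[N.+1]}.
  by rewrite -mprodXE; apply: eq_bigr => i _; rewrite mpolyXn.
rewrite msuppX inE => /eqP ->; rewrite mnm_sumE big1 // => i _.
by rewrite mulmnE mnm1E eq_sym (negPf (neq_lift _ _)).
Qed.

Lemma principal_prime_ideal_free (R : idomainType) N (j : 'I_N)
    (I : {mpoly R[N]} -> Prop) :
  factorial_domain R ->
  (forall a b, I a -> I b -> I (a + b)) -> (forall a b, I b -> I (a * b)) ->
  (forall a b, I (a * b) -> I a \/ I b) -> ~ I 1 ->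
  (exists2 a, a != 0 & I a) ->
  (forall P, I P -> (forall a, a \in msupp P -> a j = 0%N) -> P = 0) ->
  exists P, [/\ I P, P != 0 & forall Q, I Q -> divides P Q].
Proof.
case: N j I => [[]//|N] j I factR ID IM Ip I1 Ia Ij.
apply: (principal_prime_ideal (j := j)) => // p /Ij e.
rewrite -[p](polyCK) -(unisolateK j p%:P) unisolateC e ?rmorph0 ?coef0 //.
exact: msupp_insert_variable.
Qed.

(** * Inertia forms *)

Lemma mpoly_ring_ind (R : comNzRingType) n (Q : {mpoly R[n]} -> Prop) :
  (forall c, Q c%:MP) -> (forall i, Q 'X_i) ->
  (forall p q, Q p -> Q q -> Q (p + q)) -> (forall p q, Q p -> Q q -> Q (p * q)) ->
  forall p, Q p.
Proof.
move=> QC QX QD QM p; have QX' m : Q 'X_[m].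
  rewrite mpolyXE_id; elim/big_rec: _ => [|i q _ Qq]; first by rewrite -mpolyC1.
  by apply: (QM) => //; elim: (m i) => [|k IH]; rewrite ?expr0 ?exprS -?mpolyC1 //; apply: QM.
elim/mpolyind: p => [|c m p _ _ Qp]; first by rewrite -mpolyC0.
by apply: QD => //; rewrite -mul_mpolyC; apply: QM.
Qed.

Lemma mpoly_int_const n (c : int) : c%:MP = c%:~R :> {mpoly int[n]}.
Proof. by rewrite -[c in LHS]intz (rmorph_int (@mpolyC n int)). Qed.

Lemma rmorph_mpoly_int (S : comNzRingType) n (f : {rmorphism {mpoly int[n]} -> S}) p :
  f p = mmap (fun z : int => z%:~R) (fun j => f 'X_j) p.
Proof.
apply: (eq_mpoly_rmorphism (g := mmap _ _)) => [c|i] /=.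
  by rewrite mmapC mpoly_int_const rmorph_int.
by rewrite mmapX mmap1U.
Qed.

Definition generated (R : comNzRingType) r (G : 'I_r -> R) (p : R) :=
  exists Q : 'I_r -> R, p = \sum_i Q i * G i.

Section Generated.

Variables (R : comNzRingType) (r : nat) (G : 'I_r -> R).

Lemma generated0 : generated G 0.
Proof. by exists (fun=> 0); rewrite big1 // => i _; rewrite mul0r. Qed.

Lemma generatedD p q : generated G p -> generated G q -> generated G (p + q).
Proof.
move=> [Q ->] [Q' ->]; exists (fun i => Q i + Q' i).
by rewrite -big_split; apply: eq_bigr => i _; rewrite mulrDl.
Qed.

Lemma generatedM p q : generated G q -> generated G (p * q).
Proof.
move=> [Q ->]; exists (fun i => p * Q i).
by rewrite mulr_sumr; apply: eq_bigr => i _; rewrite mulrA.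
Qed.

Lemma generated_gen i : generated G (G i).
Proof.
exists (fun k => (k == i)%:R); rewrite (bigD1 i) //= eqxx mul1r big1 ?addr0 //.
by move=> k /negPf ->; rewrite mul0r.
Qed.

Lemma generated_sum (I : Type) (s : seq I) (P : pred I) F :
  (forall i, P i -> generated G (F i)) -> generated G (\sum_(i <- s | P i) F i).
Proof.
by move=> FP; elim/big_rec: _ => [|i x Pi Gx]; [exact: generated0 | apply: generatedD; auto].
Qed.

End Generated.

Section Inertia.

Variables (m : nat) (d : 'I_m -> nat).

Local Notation A := (coef_ring d).
Local Notation F := (general_form d).

Definition coef_var (c : coef_index d) : A := 'X_(enum_rank c).
Definition coef_form (c : coef_index d) : 'I_m := (val c).1.
Definition coef_mon (c : coef_index d) : 'X_{1..m} := (val c).2.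

Lemma mdeg_coef_mon c : mdeg (coef_mon c) = d (coef_form c).
Proof. by apply/eqP; case: c. Qed.

Lemma coef_index_subproof i (a : 'X_{1..m}) :
  mdeg a = d i -> (mdeg a < (\max_(i < m) d i).+1)%N.
Proof. by move=> ->; rewrite ltnS leq_bigmax. Qed.

Definition coef_at i (a : 'X_{1..m}) (e : mdeg a = d i) : coef_index d :=
  @Sub _ _ _ (i, BMultinom (coef_index_subproof e)) (introT eqP e).

Lemma coef_form_at i a e : coef_form (@coef_at i a e) = i.
Proof. by rewrite /coef_form SubK. Qed.

Lemma coef_mon_at i a e : coef_mon (@coef_at i a e) = a.
Proof. by rewrite /coef_mon SubK. Qed.

Lemma coef_atP c i a e : (c == @coef_at i a e) = (coef_form c == i) && (coef_mon c == a).
Proof.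
rewrite -val_eqE SubK; case: c => [[j b] bP].
by rewrite /coef_form /coef_mon /= xpair_eqE.
Qed.

Lemma general_formE i : F i = \sum_(c | coef_form c == i) coef_var c *: 'X_[coef_mon c].
Proof. by []. Qed.

Section Eval.

Variables (S : comNzRingType) (v : coef_index d -> S).

Definition coef_eval : A -> S :=
  mmap (fun z : int => z%:~R) (fun j => v (enum_val j)).

HB.instance Definition _ := GRing.RMorphism.on coef_eval.

Lemma coef_evalX c : coef_eval (coef_var c) = v c.
Proof. by rewrite /coef_eval mmapX mmap1U enum_rankK. Qed.

End Eval.

Lemma coef_ring_ext (S : comNzRingType) (f g : {rmorphism A -> S}) :
  (forall c, f (coef_var c) = g (coef_var c)) -> f =1 g.
Proof.
move=> fg; apply: eq_mpoly_rmorphism => [c|i].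
  by rewrite mpoly_int_const !rmorph_int.
by rewrite -[i]enum_valK; apply: fg.
Qed.

(** If P y_j^(k j) is in the ideal for each j, then so is P times any monomial of degree greater
    than the sum of the k j, because such a monomial has some exponent at least k j. *)
Lemma inertia_formP P :
  inertia_form P <-> forall j, exists k, generated F (P%:MP * 'X_j ^+ k).
Proof.
split=> [[k kP] j|kP].
  exists k; have [|Q e] := kP (U_(j) *+ k)%MM; first by rewrite mdegMn mdeg1 mul1n.
  by exists Q; rewrite mpolyXn.
have [k {}kP] : exists k : 'I_m -> nat, forall j, generated F (P%:MP * 'X_j ^+ k j).
  exists (fun j => projT1 (constructive_indefinite_description _ (kP j))).
  by move=> j; case: constructive_indefinite_description.
exists (\sum_j k j).+1 => a da.
have [j kj] : exists j, (k j <= a j)%N.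
  apply/existsP; apply: contraPT da; rewrite negb_exists => /forallP nk.
  apply/eqP; rewrite ltn_eqF // ltnS mdegE; apply: leq_sum => j _.
  by rewrite ltnW // ltnNge nk.
have -> : a = (a - U_(j) *+ k j + U_(j) *+ k j)%MM.
  rewrite submK //; apply/mnm_lepP => i; rewrite mulmnE mnm1E.
  by case: eqP => [<-|_]; rewrite ?mul1n ?mul0n.
rewrite mpolyXD -mpolyXn mulrCA; exact: generatedM.
Qed.

End Inertia.

Lemma eval_general_form m (d : 'I_m -> nat) (S : comNzRingType) (D : comNzRingType)
    (v : coef_index d -> S) (phi : {rmorphism S -> D}) (y : 'I_m -> D) i :
  mmap (phi \o coef_eval v) y (general_form d i) =
  \sum_(c | coef_form c == i) phi (v c) * mmap1 y (coef_mon c).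
Proof.
rewrite general_formE rmorph_sum; apply: eq_bigr => c _.
by rewrite /= mmapZ mmapX /= coef_evalX.
Qed.

Section Prime.

Variables (m : nat) (d : 'I_m -> nat).

Local Notation A := (coef_ring d).
Local Notation Ay := {mpoly A[m]}.
Local Notation F := (general_form d).

Lemma mdeg_pure i j : mdeg (U_(j) *+ d i : 'X_{1..m})%MM = d i.
Proof. by rewrite mdegMn mdeg1 mul1n. Qed.

Definition pure i j : coef_index d := coef_at (mdeg_pure i j).

Section Elim.

Variables (L : fieldType) (tau : {rmorphism Ay -> L}) (j : 'I_m).
Hypothesis tau_inj : injective tau.

(* The inertia forms are the kernel of the substitution that solves F_i = 0   *)
(* for the coefficient of y_j^(d i); hence they form a prime ideal.           *)
Definition elim_num (c : coef_index d) : Ay :=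
  if c == pure (coef_form c) j
  then - \sum_(c' | (coef_form c' == coef_form c) && (c' != c))
          coef_var c' *: 'X_[coef_mon c']
  else (coef_var c)%:MP * 'X_j ^+ d (coef_form c).

Definition elim_val (c : coef_index d) : L :=
  tau (elim_num c) / tau ('X_j ^+ d (coef_form c)).

Definition elim_map : {rmorphism A -> L} := coef_eval elim_val.

Lemma tau_eq0 p : (tau p == 0) = (p == 0).
Proof. by rewrite -(inj_eq tau_inj) rmorph0. Qed.

Lemma tauX_neq0 k : tau ('X_j ^+ k) != 0.
Proof. by rewrite tau_eq0 mpolyXn -msupp_eq0 msuppX. Qed.

Lemma generated_elim_num c :
  generated F ((coef_var c)%:MP * 'X_j ^+ d (coef_form c) - elim_num c).
Proof.
rewrite /elim_num; case: eqP => [ec|_]; last by rewrite subrr; apply: generated0.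
rewrite opprK; set i := coef_form c in ec *.
have -> : (coef_var c)%:MP * 'X_j ^+ d i = coef_var c *: 'X_[coef_mon c].
  by rewrite mul_mpolyC [in coef_mon c]ec coef_mon_at mpolyXn.
have -> : coef_var c *: 'X_[coef_mon c] +
   \sum_(c' | (coef_form c' == i) && (c' != c)) coef_var c' *: 'X_[coef_mon c'] = F i.
  by rewrite general_formE [RHS](bigD1 c) //=.
exact: generated_gen.
Qed.

Lemma elim_form i : mmap elim_map (fun k => tau 'X_k) (F i) = 0.
Proof.
have := eval_general_form elim_val idfun (fun k => tau 'X_k) i.
rewrite (eq_mmap (g := elim_map) (k := fun k => tau 'X_k)) // => ->.
have cE : coef_form (pure i j) = i by rewrite coef_form_at.
have mmap1E (a : 'X_{1..m}) : mmap1 (fun k => tau 'X_k) a = tau 'X_[a].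
  rewrite mpolyXE_id rmorph_prod; apply: eq_bigr => k _; by rewrite rmorphXn.
rewrite (bigD1 (pure i j)) ?cE //= /elim_val /elim_num !cE eqxx coef_mon_at mmap1E.
rewrite -mpolyXn divfK ?tauX_neq0 // rmorphN rmorph_sum /= addrC.
apply/eqP; rewrite subr_eq0; apply/eqP; apply: eq_bigr => c /andP[/eqP ci nc].
rewrite ci (negPf nc) rmorphM /= mulfK ?tauX_neq0 //.
by rewrite mmap1E -mul_mpolyC rmorphM.
Qed.

Lemma elim_generated p :
  generated F p -> mmap elim_map (fun k => tau 'X_k) p = 0.
Proof.
move=> [Q ->]; rewrite rmorph_sum big1 // => i _.
by rewrite rmorphM /= elim_form mulr0.
Qed.

(** Denominators are cleared: modulo the forms F_i, multiplying P by a power of y_j replaces each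
    coefficient by its value under the substitution. *)
Lemma elim_reduce P : exists k H, generated F (P%:MP * 'X_j ^+ k - H) /\
  tau H = tau ('X_j ^+ k) * elim_map P.
Proof.
elim/mpoly_ring_ind: P => [c|i|P Q|P Q].
- exists 0%N, c%:MP%:MP; rewrite expr0 mulr1 subrr; split; first exact: generated0.
  by rewrite mpoly_int_const rmorph1 mul1r (rmorph_int (@mpolyC m A)) !rmorph_int.
- have -> : 'X_i = coef_var (enum_val i) by rewrite /coef_var enum_valK.
  set c := enum_val i; exists (d (coef_form c)), (elim_num c).
  split; first exact: generated_elim_num.
  by rewrite [elim_map _]coef_evalX mulrC divfK ?tauX_neq0.
- move=> [k [H [GH eH]]] [l [H' [GL eL]]].
  exists (k + l)%N, (H * 'X_j ^+ l + H' * 'X_j ^+ k); split.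
    have -> : (P + Q)%:MP * 'X_j ^+ (k + l) - (H * 'X_j ^+ l + H' * 'X_j ^+ k) =
      'X_j ^+ l * (P%:MP * 'X_j ^+ k - H) + 'X_j ^+ k * (Q%:MP * 'X_j ^+ l - H').
      by rewrite mpolyCD exprD; ring.
    by apply: generatedD; apply: generatedM.
  rewrite rmorphD !rmorphM eH eL rmorphD exprD rmorphM /=.
  by move: (elim_map P) (elim_map Q) (tau _) (tau _) => *; ring.
- move=> [k [H [GH eH]]] [l [H' [GL eL]]].
  exists (k + l)%N, (H * H'); split.
    have -> : (P * Q)%:MP * 'X_j ^+ (k + l) - H * H' =
      (Q%:MP * 'X_j ^+ l) * (P%:MP * 'X_j ^+ k - H) + H * (Q%:MP * 'X_j ^+ l - H').
      by rewrite mpolyCM exprD; ring.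
    by apply: generatedD; apply: generatedM.
  by rewrite !rmorphM eH eL exprD rmorphM /=; ring.
Qed.

Lemma elim_mapP P : (exists k, generated F (P%:MP * 'X_j ^+ k)) <-> elim_map P = 0.
Proof.
split=> [[k /elim_generated]|P0].
  rewrite rmorphM rmorphXn /= mmapC mmapX mmap1U => /eqP.
  by rewrite mulf_eq0 -rmorphXn (negPf (tauX_neq0 _)) orbF => /eqP.
have [k [H [GH eH]]] := elim_reduce P; exists k.
suff H0 : H = 0 by rewrite H0 subr0 in GH.
by apply/eqP; rewrite -tau_eq0 eH P0 mulr0.
Qed.

End Elim.

(** One variable suffices: if P y_j^k lies in the ideal, the substitution attached to any y_l sends
    it to 0 without killing y_j, so it kills P. *)
Lemma inertia_form_elim (L : fieldType) (tau : {rmorphism Ay -> L}) (j : 'I_m) P :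
  injective tau -> inertia_form P <-> elim_map tau j P = 0.
Proof.
move=> tauI; split=> [/inertia_formP/(_ j)/(elim_mapP j tauI) //|P0].
apply/inertia_formP => l.
apply/(elim_mapP l tauI); have /(elim_mapP j tauI)[k /(elim_generated l tauI)] := P0.
rewrite rmorphM rmorphXn /= mmapC mmapX mmap1U => /eqP.
rewrite mulf_eq0 => /orP[/eqP //|]; rewrite expf_eq0 => /andP[_].
move/eqP=> h; exfalso.
by have := tau_eq0 tauI 'X_j; rewrite h eqxx -msupp_eq0 msuppX.
Qed.

End Prime.

(** * Inertia forms free of one coefficient *)

Section Height.

Variables (m : nat) (d : 'I_m -> nat) (i0 : 'I_m).
Hypothesis d_gt0 : forall i, (0 < d i)%N.

Local Notation A := (coef_ring d).
Local Notation Ay := {mpoly A[m]}.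
Local Notation F := (general_form d).

Lemma mdeg_slope i :
  mdeg (U_(i0) *+ (d i).-1 + U_(i) : 'X_{1..m})%MM = d i.
Proof. by rewrite mdegD mdegMn !mdeg1 mul1n addn1 prednK. Qed.

Definition slope i : coef_index d := coef_at (mdeg_slope i).

(* Every F_i vanishes when y_(i0) := 1, the coefficients of y_(i0)^(d i - 1)  *)
(* y_i are multiplied by a new variable and F_i = 0 is solved for the         *)
(* coefficient of y_(i0)^(d i). The part of top degree of this substitution   *)
(* is injective on polynomials free of the coefficient of y_(i0)^(d i0).      *)
Definition height_y (k : 'I_m) : {poly Ay} := if k == i0 then 1 else ('X_k)%:P.

Definition height_lin (c : coef_index d) : {poly Ay} :=
  if (c == slope (coef_form c)) && (coef_form c != i0) then (coef_var c)%:MP *: 'X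
  else (coef_var c)%:MP%:P.

Definition height_val (c : coef_index d) : {poly Ay} :=
  if c == pure d (coef_form c) i0
  then - \sum_(c' | (coef_form c' == coef_form c) && (c' != c))
          height_lin c' * mmap1 height_y (coef_mon c')
  else height_lin c.

Lemma height_form i : mmap (coef_eval height_val) height_y (F i) = 0.
Proof.
have := eval_general_form height_val idfun height_y i.
rewrite (eq_mmap (g := coef_eval height_val) (k := height_y)) // => ->.
have cE : coef_form (pure d i i0) = i by rewrite coef_form_at.
rewrite (bigD1 (pure d i i0)) ?cE //= /height_val cE eqxx coef_mon_at.
have -> : mmap1 height_y (U_(i0) *+ d i)%MM = 1.
  rewrite /mmap1 big1 // => k _; rewrite mulmnE mnm1E /height_y.
  by case: (eqVneq k i0) => [_|]; rewrite ?expr1n //; rewrite eq_sym => /negPf ->.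
rewrite mulr1 addrC; apply/eqP; rewrite subr_eq0; apply/eqP.
by apply: eq_bigr => c /andP[/eqP ci nc]; rewrite ci (negPf nc).
Qed.

Lemma inertia_height P : inertia_form P -> coef_eval height_val P = 0.
Proof.
move/inertia_formP/(_ i0) => [k [Q e]].
have := congr1 (mmap (coef_eval height_val) height_y) e.
rewrite rmorph_sum big1 => [|i _]; last by rewrite rmorphM /= height_form mulr0.
rewrite rmorphM rmorphXn /= mmapC mmapX mmap1U /height_y eqxx expr1n mulr1 //.
Qed.

Definition height_weight (c : coef_index d) : nat :=
  (c == pure d (coef_form c) i0) || (c == slope (coef_form c)).

Lemma size_height_val c : (size (height_val c) <= (height_weight c).+1)%N.
Proof.
have size_lin c' : (size (height_lin c') <= 2)%N.
  rewrite /height_lin; case: ifP => _; last by rewrite (leq_trans (size_polyC_leq1 _)).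
  by rewrite (leq_trans (size_scale_leq _ _)) // size_polyX.
have height_yC (a : 'X_{1..m}) : exists q, mmap1 height_y a = q%:P.
  rewrite /mmap1; elim/big_rec: _ => [|k x _ [q ->]]; first by exists 1.
  rewrite /height_y; case: ifP => _; first by exists q; rewrite expr1n mul1r.
  by exists ('X_k ^+ a k * q); rewrite polyCM polyC_exp.
rewrite /height_val /height_weight; case: ifP => /= [_|nc].
  rewrite size_polyN; apply: leq_trans (size_sum _ _ _) _; apply/bigmax_leqP => c' _.
  have [q ->] := height_yC (coef_mon c').
  by rewrite mulrC mul_polyC (leq_trans (size_scale_leq _ _)).
case: (boolP (c == slope _)) => //= ns.
by rewrite /height_lin (negPf ns) size_polyC_leq1.
Qed.

Lemma height_yC (a : 'X_{1..m}) : exists q, mmap1 height_y a = q%:P.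
Proof.
rewrite /mmap1; elim/big_rec: _ => [|k x _ [q ->]]; first by exists 1.
rewrite /height_y; case: ifP => _; first by exists q; rewrite expr1n mul1r.
by exists ('X_k ^+ a k * q); rewrite polyCM polyC_exp.
Qed.

Lemma coef_mon_slope i k : coef_mon (slope i) k = ((i0 == k) * (d i).-1 + (i == k))%N.
Proof. by rewrite coef_mon_at mnmDE mulmnE !mnm1E. Qed.

Lemma coef_mon_pure i j k : coef_mon (pure d i j) k = ((j == k) * d i)%N.
Proof. by rewrite coef_mon_at mulmnE mnm1E. Qed.

Lemma mmap1_height_slope i : i != i0 -> mmap1 height_y (coef_mon (slope i)) = ('X_i)%:P.
Proof.
move=> ii0; rewrite /mmap1 (bigD1 i) //= [X in _ * X]big1 => [|k ki].
  by rewrite coef_mon_slope eqxx [i0 == i]eq_sym (negPf ii0) mul0n expr1 mulr1 /height_y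
             (negPf ii0).
rewrite coef_mon_slope [i == k]eq_sym (negPf ki) addn0 /height_y.
by case: (eqVneq k i0) => [_|]; rewrite ?expr1n ?mul0n ?expr0.
Qed.

Lemma slope_neq_pure i : i != i0 -> slope i != pure d i i0.
Proof.
move=> ii0; apply/eqP => /(congr1 (fun c => coef_mon c i)).
by rewrite coef_mon_slope coef_mon_pure eqxx eq_sym (negPf ii0).
Qed.

Definition height_top (c : coef_index d) : Ay :=
  if c == pure d (coef_form c) i0
  then - ((coef_var (slope (coef_form c)))%:MP * 'X_(coef_form c)) else (coef_var c)%:MP.

Lemma height_val_top c : c != pure d i0 i0 ->
  (height_val c)`_(height_weight c) = height_top c.
Proof.
move=> cT; rewrite /height_weight /height_val /height_top.
case: ifP => /= [/eqP ec|nc].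
  set i := coef_form c in ec *.
  have ii0 : i != i0 by apply: contraNneq cT => ii0; rewrite ec ii0.
  rewrite coefN coef_sum (bigD1 (slope i)) /=; last first.
    by rewrite coef_form_at eqxx ec slope_neq_pure.
  rewrite /height_lin coef_form_at eqxx ii0 mmap1_height_slope // -scalerAl coefZ.
  rewrite coefMC coefX eqxx mul1r [X in _ + X]big1 ?addr0 // => c' /andP[/andP[/eqP -> _] ns].
  rewrite (negPf ns) /=; have [q ->] := height_yC (coef_mon c').
  by rewrite -polyCM coefC.
rewrite /height_lin; case: (boolP (c == slope _)) => [/eqP ec|ns] /=; last by rewrite coefC.
have {ec} [i ec] : exists i, c = slope i by exists (coef_form c).
rewrite {c cT}ec coef_form_at in nc *; rewrite ifT; first by rewrite coefZ coefX eqxx mulr1.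
apply: contraFneq nc => ci; rewrite ci coef_atP coef_form_at eqxx; apply/eqP/mnmP => k.
rewrite coef_mon_slope mulmnE mnm1E.
by case: eqP; rewrite ?mul0n ?addn0 // !mul1n addn1 prednK.
Qed.

(** Sending y_i to minus the quotient of the coefficients [pure d i i0] and [slope i] turns each
    [height_top c] back into the coefficient c, so these top parts are algebraically independent. *)
Lemma height_top_inj (L : fieldType) (tau : {rmorphism A -> L}) :
  injective tau -> exists chi : {rmorphism Ay -> L},
  forall c, chi (height_top c) = tau (coef_var c).
Proof.
move=> tauI.
pose y i := - (tau (coef_var (pure d i i0)) / tau (coef_var (slope i))).
exists (mmap tau y) => c; rewrite /height_top; case: eqP => [ec|_]; last by rewrite /= mmapC.
rewrite rmorphN rmorphM /= mmapC mmapX mmap1U /y mulrN opprK mulrC divfK -?ec //.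
rewrite -(rmorph0 tau) (inj_eq tauI) -msupp_eq0 /coef_var msuppX //.
Qed.

Lemma height_val_free (L : fieldType) (tau : {rmorphism A -> L}) Q :
  injective tau ->
  (forall a, a \in msupp Q -> a (enum_rank (pure d i0 i0)) = 0%N) ->
  mmap (fun z : int => z%:~R)
       (fun j => (height_val (enum_val j))`_(height_weight (enum_val j))) Q = 0 ->
  Q = 0.
Proof.
move=> tauI Pfree Q0; have [chi chiE] := height_top_inj tauI.
apply: tauI; rewrite rmorph0 -(rmorph0 chi) -Q0.
rewrite (rmorph_mpoly_int tau) rmorph_mmap /mmap big_seq [RHS]big_seq.
apply: eq_bigr => a aQ; congr (_ * _); first by rewrite /= rmorph_int.
rewrite /mmap1; apply: eq_bigr => j _ /=.
have [jT|jT] := eqVneq j (enum_rank (pure d i0 i0)).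
  by rewrite jT Pfree // !expr0.
have cT : enum_val j != pure d i0 i0.
  by apply: contraNneq jT => <-; rewrite enum_valK.
by rewrite height_val_top // chiE /coef_var enum_valK.
Qed.

(** Let Q be the part of P of highest weight k. Its value at the top parts is the coefficient of
    degree k of the substituted P, which is 0; independence of the top parts gives Q = 0, against
    the choice of k. *)
Lemma inertia_free_eq0 P : inertia_form P ->
  (forall a, a \in msupp P -> a (enum_rank (pure d i0 i0)) = 0%N) -> P = 0.
Proof.
move=> IP Pfree; apply/eqP; apply: contraT => P0.
pose w (j : 'I_#|coef_index d|) := height_weight (enum_val j).
pose k := (\max_(a <- msupp P) weight w a)%N.
have wk a : a \in msupp P -> (weight w a <= k)%N by move=> aP; apply: leq_bigmax_seq.
have [a0 a0P wa0] : exists2 a, a \in msupp P & weight w a = k.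
  rewrite /k; case: (msupp P) (msupp_eq0 P) => [|b s _]; first by rewrite (negPf P0).
  elim: s b => [|c s IH] b; first by exists b; rewrite ?mem_head // big_seq1.
  have [a as_ wa] := IH c; rewrite big_cons -wa.
  case: (leqP (weight w b) (weight w a)) => [le|lt]; [exists a|exists b] => //.
  - by rewrite inE as_ orbT.
  - by rewrite mem_head.
have := inertia_height IP.
have intP : (fun z : int => z%:~R : {poly Ay}) =1 polyC \o (fun z : int => z%:~R).
  by move=> z /=; rewrite rmorph_int.
rewrite /coef_eval (eq_mmap _ intP (fun=> erefl)) => /(congr1 (fun q : {poly Ay} => q`_k)).
have size_w j : (size (height_val (enum_val j)) <= (w j).+1)%N.
  exact: size_height_val.
rewrite coef0 (coef_mmap_weight _ size_w) //.
set Q := pihomog _ _ _ => Q0.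
have QP a : a \in msupp Q -> a \in msupp P.
  rewrite /Q pihomogE => /msupp_sum_le /flatten_mapP[b]; rewrite mem_filter => /andP[_ bP].
  by move/msuppZ_le; rewrite msuppX inE => /eqP ->.
have : Q@_a0 = 0.
  suff -> : Q = 0 by rewrite mcoeff0.
  have [L [tau tauI]] := fraction_embedding A.
  by apply: (height_val_free tauI _ Q0) => a /QP; apply: Pfree.
rewrite /Q pihomogE raddf_sum /= -big_filter (bigD1_seq a0) ?filter_uniq ?msupp_uniq //=; last first.
  by rewrite mem_filter wa0 eqxx.
rewrite mcoeffZ mcoeffX eqxx mulr1 [X in _ + X]big1 => [|a /negPf aa0]; last first.
  by rewrite mcoeffZ mcoeffX aa0 mulr0.
by rewrite addr0 => /eqP; rewrite mcoeff_eq0 a0P.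
Qed.

End Height.

(** * Macaulay determinants *)

Lemma coef_mmap_grade (N : nat) (R S : comNzRingType) (phi : {rmorphism R -> S})
    (h : 'I_N -> S) (w : 'I_N -> nat) (P : {mpoly R[N]}) k :
  (mmap (polyC \o phi) (fun j => (h j)%:P * 'X^(w j)) P)`_k =
  mmap phi h (pihomog (weight w) k P).
Proof.
rewrite [in LHS]/mmap coef_sum pihomogE raddf_sum /= [in RHS]big_mkcond /=.
apply: eq_bigr => a _; rewrite mul_polyC coefZ.
have -> : mmap1 (fun j => (h j)%:P * 'X^(w j)) a = (mmap1 h a)%:P * 'X^(weight w a).
  rewrite /mmap1 rmorph_prod /weight -prodrXr -big_split /=; apply: eq_bigr => j _.
  by rewrite exprMn rmorphXn -exprM mulnC.
rewrite coefCM coefXn eq_sym; case: eqP => _; last by rewrite !mulr0.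
by rewrite mulr1 mmapZ mmapX.
Qed.

Lemma pihomog_coef (N : nat) (R : comNzRingType) (mf : measure N) k (p : {mpoly R[N]}) a :
  (pihomog mf k p)@_a = if mf a == k then p@_a else 0.
Proof.
rewrite pihomogE raddf_sum /=.
case: (boolP (a \in msupp p)) => [ap|nap]; last first.
  rewrite (memN_msupp_eq0 nap) if_same big_seq_cond big1 // => b /andP[bp _].
  rewrite mcoeffZ mcoeffX; case: eqP => [ba|]; last by rewrite mulr0.
  by rewrite ba (negPf nap) in bp.
rewrite -big_filter; case: ifP => ka.
  rewrite (bigD1_seq a) ?filter_uniq ?msupp_uniq ?mem_filter ?ka ?ap //=.
  rewrite mcoeffZ mcoeffX eqxx mulr1 big1 ?addr0 // => b /negPf ab.
  by rewrite mcoeffZ mcoeffX ab mulr0.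
rewrite big_seq_cond big1 // => b /andP[]; rewrite mem_filter => /andP[kb _] _.
rewrite mcoeffZ mcoeffX; case: eqP => [ba|]; last by rewrite mulr0.
by rewrite -ba kb in ka.
Qed.

Section Monomials.

Variables (m nu : nat).

Definition monomial : finType := {b : 'X_{1..m < nu.+1} | mdeg b == nu}.

Definition monomial_mnm (b : monomial) : 'X_{1..m} := val b.

Lemma mdeg_monomial b : mdeg (monomial_mnm b) = nu.
Proof. by apply/eqP; case: b. Qed.

Lemma monomial_inj : injective monomial_mnm.
Proof. by move=> a b e; apply/val_inj/val_inj. Qed.

Lemma monomial_of (a : 'X_{1..m}) : mdeg a = nu -> exists b, monomial_mnm b = a.
Proof.
move=> ea; have lt : (mdeg a < nu.+1)%N by rewrite ea.
have e : mdeg (BMultinom lt) == nu by rewrite /= ea.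
by exists (exist _ (BMultinom lt) e).
Qed.

Lemma dhomog_monomials (R : comNzRingType) (p : {mpoly R[m]}) :
  p \is nu.-homog -> p = \sum_(b : monomial) p@_(monomial_mnm b) *: 'X_[monomial_mnm b].
Proof.
move=> hp; apply/mpolyP => a; rewrite raddf_sum /=.
have [ea|na] := eqVneq (mdeg a) nu.
  have [b <-] := monomial_of ea.
  rewrite (bigD1 b) //= mcoeffZ mcoeffX eqxx mulr1 big1 ?addr0 // => c cb.
  by rewrite mcoeffZ mcoeffX (inj_eq monomial_inj) (negPf cb) mulr0.
rewrite (dhomog_nemf_coeff hp na) big1 // => b _; rewrite mcoeffZ mcoeffX.
by case: eqP => [e|]; rewrite ?mulr0 //; case/negP: na; rewrite -e mdeg_monomial.
Qed.

End Monomials.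

Lemma dhomog_prodr (N : nat) (R : comNzRingType) (mf : measure N) (I : Type) (s : seq I)
    (p : I -> {mpoly R[N]}) (w : I -> nat) :
  (forall i, p i \is (w i).-homog for mf) ->
  \prod_(i <- s) p i \is (\sum_(i <- s) w i).-homog for mf.
Proof.
move=> hp; elim: s => [|i s IH]; first by rewrite !big_nil dhomog1.
by rewrite !big_cons dhomogM.
Qed.

Section Determinants.

Variables (m : nat) (d : 'I_m -> nat).

Local Notation A := (coef_ring d).
Local Notation F := (general_form d).

Lemma general_form_homog i : F i \is (d i).-homog.
Proof.
rewrite general_formE rpred_sum // => c /eqP ci.
by apply: dhomogZ; rewrite dhomogX /= mdeg_coef_mon ci.
Qed.

Lemma map_general_form (S : comNzRingType) (v : coef_index d -> S) i :
  map_mpoly (coef_eval v) (F i) = \sum_(c | coef_form c == i) v c *: 'X_[coef_mon c].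
Proof.
rewrite general_formE rmorph_sum; apply: eq_bigr => c _.
by rewrite /= map_mpolyZ map_mpolyX /= coef_evalX.
Qed.

Lemma sum_coef_index (S : comNzRingType) (G : {mpoly S[m]}) i : G \is (d i).-homog ->
  \sum_(c : coef_index d | coef_form c == i) G@_(coef_mon c) *: 'X_[coef_mon c] = G.
Proof.
move=> hG; apply/mpolyP => a; rewrite raddf_sum /=.
have [ea|na] := eqVneq (mdeg a) (d i).
  rewrite (bigD1 (coef_at ea)) ?coef_form_at //= coef_mon_at mcoeffZ mcoeffX eqxx mulr1.
  rewrite [X in _ + X]big1 ?addr0 // => c /andP[/eqP ci]; rewrite coef_atP ci eqxx /= => /negPf ca.
  by rewrite mcoeffZ mcoeffX ca mulr0.
rewrite (dhomog_nemf_coeff hG na) [LHS]big1 // => c /eqP ci; rewrite mcoeffZ mcoeffX.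
by case: eqP => [e|]; rewrite ?mulr0 //; case/negP: na; rewrite -e mdeg_coef_mon ci.
Qed.

Lemma specializeE (S : comNzRingType) (P : A) (G : 'I_m -> {mpoly S[m]}) :
  specialize P G = coef_eval (fun c => (G (coef_form c))@_(coef_mon c)) P.
Proof. by []. Qed.

Lemma map_general_form_specialize (S : comNzRingType) (G : 'I_m -> {mpoly S[m]}) i :
  (forall i, G i \is (d i).-homog) ->
  map_mpoly (coef_eval (fun c => (G (coef_form c))@_(coef_mon c))) (F i) = G i.
Proof.
move=> hG; rewrite map_general_form -[RHS](sum_coef_index (hG i)).
by apply: eq_bigr => c /eqP ->.
Qed.

Section Matrix.

Variables (nu : nat) (i : 'I_#|monomial m nu| -> 'I_m).
Variable e : 'I_#|monomial m nu| -> 'X_{1..m}.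
Hypothesis deg_e : forall k, (mdeg (e k) + d (i k))%N = nu.

Definition macaulay_mx : 'M[A]_#|monomial m nu| :=
  \matrix_(k, l) ('X_[e k] * F (i k))@_(monomial_mnm (enum_val l)).

(** Cramer's rule: the adjugate writes the determinant times each monomial of degree nu as a
    combination of the rows, which are multiples of the forms. *)
Lemma inertia_det_macaulay : inertia_form (\det macaulay_mx).
Proof.
exists nu => a /monomial_of[b <-].
suff -> : (\det macaulay_mx)%:MP * 'X_[monomial_mnm b] =
   \sum_k ((\adj macaulay_mx (enum_rank b) k)%:MP * 'X_[e k]) * F (i k).
  by apply: generated_sum => k _; apply: generatedM; apply: generated_gen.
have rowE k : 'X_[e k] * F (i k) =
    \sum_l macaulay_mx k l *: 'X_[monomial_mnm (enum_val l)].
  rewrite [LHS](@dhomog_monomials _ nu); last first.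
    by rewrite -(deg_e k); apply: dhomogM; rewrite ?dhomogX ?general_form_homog.
  rewrite (reindex (@enum_val (monomial m nu) predT)) /=; last first.
    by apply: onW_bij; apply: enum_val_bij.
  by apply: eq_bigr => l _; rewrite mxE.
rewrite [RHS](eq_bigr (fun k => \sum_l (\adj macaulay_mx) (enum_rank b) k *:
    (macaulay_mx k l *: 'X_[monomial_mnm (enum_val l)]))); last first.
  by move=> k _; rewrite -mulrA rowE mul_mpolyC scaler_sumr.
rewrite exchange_big /=.
have adj l : \sum_k (\adj macaulay_mx) (enum_rank b) k * macaulay_mx k l =
    \det macaulay_mx *+ (enum_rank b == l).
  by have /matrixP/(_ (enum_rank b) l) := mul_adj_mx macaulay_mx; rewrite mxE [RHS]mxE.
rewrite [RHS](eq_bigr (fun l => (\det macaulay_mx *+ (enum_rank b == l)) *: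
    'X_[monomial_mnm (enum_val l)])); last first.
  by move=> l _; rewrite -adj scaler_suml; apply: eq_bigr => k _; rewrite scalerA.
rewrite [RHS](bigD1 (enum_rank b)) //= eqxx [X in _ + X]big1 => [|l /negPf lb].
  by rewrite addr0 mulr1n enum_rankK mul_mpolyC.
by rewrite eq_sym lb mulr0n scale0r.
Qed.

Lemma specialize_det_macaulay (S : comNzRingType) (G : 'I_m -> {mpoly S[m]}) :
  (forall i, G i \is (d i).-homog) ->
  specialize (\det macaulay_mx) G =
  \det (\matrix_(k, l) ('X_[e k] * G (i k))@_(monomial_mnm (enum_val l))).
Proof.
move=> hG; rewrite specializeE -det_map_mx; congr (\det _); apply/matrixP => k l.
rewrite !mxE -(mcoeff_map_mpoly (coef_eval _)) rmorphM /= map_mpolyX.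
by rewrite map_general_form_specialize.
Qed.

End Matrix.

End Determinants.

Section Minor.

Variables (m : nat) (d : 'I_m -> nat) (K : fieldType) (G : 'I_m -> {mpoly K[m]}).
Hypothesis G_homog : forall i, G i \is (d i).-homog.

(** The hypothesis says that the multiples 'X_[e] * G i span the forms of degree nu. A nonzero
    maximal minor of their coefficient matrix is the specialization of a determinant of generic
    multiples, which is an inertia form. *)
Lemma inertia_minor nu :
  (forall a : 'X_{1..m}, mdeg a = nu -> generated G 'X_[a]) ->
  exists2 P : coef_ring d, inertia_form P & specialize P G != 0.
Proof.
move=> genG; pose s := #|monomial m nu|.
pose mon (l : 'I_s) := monomial_mnm (enum_val l).
have mon_inj : injective mon by move=> k l /monomial_inj/enum_val_inj.
have [Q QE] : exists Q : 'I_s -> 'I_m -> {mpoly K[m]},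
    forall l, 'X_[mon l] = \sum_i Q l i * G i.
  have H l : exists Q, 'X_[mon l] = \sum_i Q i * G i.
    by apply: genG; rewrite mdeg_monomial.
  exists (fun l => projT1 (constructive_indefinite_description _ (H l))) => l.
  by case: constructive_indefinite_description.
(* A bound on the degrees of all cofactors, which leaves finitely many rows. *)
pose k := (\sum_l \sum_i msize (Q l i))%N.
have le_k l i : (msize (Q l i) <= k)%N.
  by rewrite /k (bigD1 l) //= (bigD1 i) //= -addnA leq_addr.
pose T : finType := ('I_m * 'X_{1..m < k})%type.
pose row_form (r : 'I_#|T|) := (enum_val r).1.
pose row_mon (r : 'I_#|T|) : 'X_{1..m} := (enum_val r).2.
pose B : 'M[K]_(#|T|, s) := \matrix_(r, l) ('X_[row_mon r] * G (row_form r))@_(mon l).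
have B_full : row_full B.
  apply/row_fullP; exists (\matrix_(l, r) (Q l (row_form r))@_(row_mon r)).
  apply/matrixP => l l'; rewrite !mxE.
  have -> : (l == l')%:R = ('X_[mon l])@_(mon l') :> K by rewrite mcoeffX (inj_eq mon_inj).
  rewrite QE raddf_sum /=.
  under eq_bigr => r _ do rewrite !mxE.
  rewrite -(big_enum_val (fun t : T => (Q l t.1)@_t.2 * ('X_[t.2] * G t.1)@_(mon l'))) /=.
  rewrite big_mkcond /=.
  rewrite -(pair_bigA _ (fun i (e : 'X_{1..m < k}) =>
     (Q l i)@_e * ('X_[e] * G i)@_(mon l'))) /=.
  apply: eq_bigr => i _; rewrite {2}[Q l i](mpolywE (le_k l i)) mulr_suml raddf_sum /=.
  by apply: eq_bigr => e _; rewrite -scalerAl mcoeffZ.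
pose f := fullrankfun B_full; have f_unit := fullrowsub_unit B_full.
(* A row of another degree is zero on the monomials of degree nu, so an invertible minor contains
   none. *)
have deg_f l : (mdeg (row_mon (f l)) + d (row_form (f l)))%N = nu.
  apply/eqP; apply: contraT => bad.
  have /matrixP/(_ l l) := mulmxV f_unit; rewrite mxE [RHS]mxE eqxx big1 => [/eqP|l' _].
    by rewrite eq_sym oner_eq0.
  rewrite mxE mxE (@dhomog_nemf_coeff _ _ mdeg (mdeg (row_mon (f l)) + d (row_form (f l)))) ?mul0r //.
    by apply: dhomogM; rewrite ?dhomogX.
  by rewrite /= mdeg_monomial eq_sym.
exists (\det (macaulay_mx d (fun l => row_form (f l)) (fun l => row_mon (f l)))).
  exact: inertia_det_macaulay.
rewrite specialize_det_macaulay //.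
have -> : \matrix_(l, l') ('X_[row_mon (f l)] * G (row_form (f l)))@_(monomial_mnm (enum_val l')) =
    rowsub f B by apply/matrixP => l l'; rewrite !mxE.
by rewrite -unitfE -unitmxE.
Qed.

End Minor.

(** * Grading by the coefficients of one form *)

Section Grading.

Variables (m : nat) (d : 'I_m -> nat).

Local Notation A := (coef_ring d).

Definition form_weight (i : 'I_m) (j : 'I_#|coef_index d|) : nat :=
  coef_form (enum_val j) == i.

Lemma coef_var_homog i c : coef_var c \is (coef_form c == i).-homog for (weight (form_weight i)).
Proof. by rewrite /coef_var dhomogX /= weightU /form_weight enum_rankK. Qed.

Lemma det_macaulay_homog i nu (r : 'I_#|monomial m nu| -> 'I_m) e :
  \det (macaulay_mx d r e) \is (\sum_k (r k == i)).-homog for (weight (form_weight i)).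
Proof.
rewrite /determinant rpred_sum // => s _.
have hp : \prod_k macaulay_mx d r e k (s k)
    \is (\sum_k (r k == i)).-homog for (weight (form_weight i)).
  apply: dhomog_prodr => k; rewrite mxE general_formE mulr_sumr raddf_sum /=.
  apply: rpred_sum => c /eqP ck; rewrite -scalerAr mcoeffZ -mpolyXD mcoeffX.
  case: eqP => _; last by rewrite mulr0 rpred0.
  by rewrite mulr1 -ck coef_var_homog.
by case: (odd_perm s); rewrite ?expr0 ?expr1 ?mul1r ?mulN1r ?dhomogN.
Qed.


Lemma inertia_zero (S : idomainType) (v : coef_index d -> S) (y : 'I_m -> S) P :
  (forall i, \sum_(c | coef_form c == i) v c * mmap1 y (coef_mon c) = 0) ->
  (exists j, y j != 0) -> inertia_form P -> coef_eval v P = 0.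
Proof.
move=> vy [j yj] /inertia_formP/(_ j)[k [Q e]].
have := congr1 (mmap (coef_eval v) y) e.
rewrite rmorphM rmorphXn rmorph_sum /= mmapC mmapX mmap1U [RHS]big1 => [/eqP|i _].
  by rewrite mulf_eq0 => /orP[/eqP //|]; rewrite expf_eq0 (negPf yj) andbF.
rewrite rmorphM /=; have := eval_general_form v idfun y i.
rewrite (eq_mmap (g := coef_eval v) (k := y)) // => ->.
by rewrite (vy i) mulr0.
Qed.


(** Multiplying the coefficients of the i-th form by an indeterminate keeps the nonzero common zero
    given by the elimination. An inertia form then vanishes identically in the indeterminate, and
    its graded parts vanish one by one. *)
Lemma inertia_pihomog_aux (L : fieldType) (tau : {rmorphism {mpoly A[m]} -> L}) i k P :
  injective tau ->
  inertia_form P -> inertia_form (pihomog (weight (form_weight i)) k P).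
Proof.
move=> tauI IP; apply/(inertia_form_elim i _ tauI).
pose v c := (elim_val tau i c)%:P * 'X^(coef_form c == i).
have : coef_eval v P = 0.
  apply: (@inertia_zero _ v (fun l => (tau 'X_l)%:P)) => // [i'|].
    have := elim_form i tauI i'.
    have := eval_general_form (elim_val tau i) idfun (fun k => tau 'X_k) i'.
    rewrite (eq_mmap (g := elim_map tau i) (k := fun k => tau 'X_k)) // => -> /= e.
    transitivity ((\sum_(c | coef_form c == i') elim_val tau i c *
        mmap1 (fun k => tau 'X_k) (coef_mon c))%:P * 'X^(i' == i)); last by rewrite e mul0r.
    rewrite rmorph_sum mulr_suml; apply: eq_bigr => c /eqP ci; rewrite /v ci /= [in RHS]polyCM [RHS]mulrAC.
    congr (_ * _); rewrite /mmap1 rmorph_prod; apply: eq_bigr => l _.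
    by rewrite rmorphXn.
  by exists i; rewrite polyC_eq0; have := tauX_neq0 i tauI 1; rewrite expr1.
move/(congr1 (fun q : {poly L} => q`_k)); rewrite coef0 => e.
have := coef_mmap_grade (intmul (1 : L)) (fun j => elim_val tau i (enum_val j))
  (form_weight i) P k.
move=> h; apply: etrans (esym h) _; rewrite -[RHS]e; congr ((polyseq _)`_k).
pose g : {rmorphism A -> {poly L}} := mmap (polyC \o intmul (1 : L))
  (fun j => (elim_val tau i (enum_val j))%:P * 'X^(form_weight i j)).
suff /(_ P) : g =1 coef_eval v by [].
apply: coef_ring_ext => c.
by rewrite [RHS]coef_evalX /g /= mmapX mmap1U /form_weight enum_rankK.
Qed.

Lemma inertia_pihomog i k P :
  inertia_form P -> inertia_form (pihomog (weight (form_weight i)) k P).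
Proof.
have [L [tau tauI]] := mpoly2_fraction_embedding int #|coef_index d| m.
exact: (inertia_pihomog_aux _ _ tauI).
Qed.

End Grading.

Section Box.

Variables (m : nat) (d : 'I_m -> nat) (i0 : 'I_m).

Local Notation D := (\max_i d i)%N.

(** Used twice: it bounds the number of monomials that Macaulay's matrix must assign to the form i0,
    and it indexes the common zeros of the split forms. *)
Definition box : {pred {ffun 'I_m -> 'I_D.+1}} :=
  family (fun i => [pred j : 'I_D.+1 | if i == i0 then j == ord0 else (j < d i)%N]).

Lemma boxP (g : {ffun 'I_m -> 'I_D.+1}) :
  reflect (g i0 = ord0 /\ forall i, i != i0 -> (g i < d i)%N) (g \in box).
Proof.
apply: (iffP familyP) => [H|[g0 gi] i]; last first.
  by rewrite !inE; case: eqP => [->|/eqP /gi //]; rewrite g0.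
split=> [|i /negPf ii0]; first by have := H i0; rewrite !inE eqxx => /eqP.
by have := H i; rewrite !inE ii0.
Qed.

Lemma card_box : #|box| = (\prod_(i | i != i0) d i)%N.
Proof.
rewrite card_family foldrE big_map big_enum /= (bigD1 i0) //=.
rewrite (_ : #|_| = 1%N); last by apply: (@eq_card1 _ ord0) => j; rewrite !inE eqxx.
rewrite mul1n; apply: eq_big => [i|i /negPf ii0]; first by [].
have di : (d i <= D.+1)%N by rewrite ltnW // ltnS leq_bigmax.
have widen_inj : injective (widen_ord di) by move=> j k /(congr1 val) /= /val_inj.
rewrite -[RHS]card_ord -(card_image widen_inj).
apply: eq_card => j; rewrite -[LHS]topredE /= ii0; apply/idP/imageP => [jd|[k _ ->] //=].
by exists (Ordinal jd); last exact: val_inj.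
Qed.

End Box.

Section Macaulay.

Variables (m : nat) (d : 'I_m -> nat) (i0 : 'I_m).

Local Notation A := (coef_ring d).

(** In this degree every monomial is divisible by y_i^(d i) for some i, by the pigeonhole
    principle. *)
Definition macaulay_degree : nat := (\sum_i (d i).-1).+1.

Local Notation nu := macaulay_degree.
Local Notation mon l := (monomial_mnm (enum_val l)).

(** The form i0 is taken only as a last resort, to keep the degree of the determinant in its
    coefficients low. *)
Definition macaulay_form (l : 'I_#|monomial m nu|) : 'I_m :=
  odflt i0 [pick i | (i != i0) && (d i <= mon l i)%N].

Definition macaulay_cofactor l : 'X_{1..m} :=
  (mon l - U_(macaulay_form l) *+ d (macaulay_form l))%MM.

Lemma macaulay_form_le l : (U_(macaulay_form l) *+ d (macaulay_form l) <= mon l)%MM.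
Proof.
have le i : (d i <= mon l i)%N -> (U_(i) *+ d i <= mon l)%MM.
  move=> h; apply/mnm_lepP => k; rewrite mulmnE mnm1E.
  by case: eqP => [<-|_]; rewrite ?mul1n ?mul0n.
rewrite /macaulay_form; case: pickP => [i /andP[_] /le //|nle]; apply: le => /=.
move: (mdeg_monomial (enum_val l)) nle; move: (mon l) => a.
rewrite mdegE /nu (bigD1 i0) //= (bigD1 (P := xpredT) i0) //= => e nle.
rewrite -(leq_add2r (\sum_(i < m | i != i0) (d i).-1)).
apply: leq_trans (_ : (a i0 + \sum_(i < m | i != i0) a i <= _)%N).
  by rewrite e -addSn leq_add2r; case: (d i0).
rewrite leq_add2l; apply: leq_sum => i ii0.
by have := nle i; rewrite ii0 /= => /negbT; rewrite -ltnNge; case: (d i).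
Qed.

Lemma macaulay_cofactorK l :
  (macaulay_cofactor l + U_(macaulay_form l) *+ d (macaulay_form l))%MM = mon l.
Proof. exact/submK/macaulay_form_le. Qed.

Lemma mdeg_macaulay_cofactor l :
  (mdeg (macaulay_cofactor l) + d (macaulay_form l))%N = nu.
Proof.
rewrite -(mdeg_monomial (enum_val l)) -[in RHS]macaulay_cofactorK mdegD.
by rewrite mdegMn mdeg1 mul1n.
Qed.

Definition macaulay_det : A := \det (macaulay_mx d macaulay_form macaulay_cofactor).

Lemma inertia_macaulay_det : inertia_form macaulay_det.
Proof. exact/inertia_det_macaulay/mdeg_macaulay_cofactor. Qed.

(** For the forms y_i^(d i) each row is the very monomial that labels it, so the matrix is the
    identity. *)
Lemma specialize_macaulay_det (S : comNzRingType) :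
  specialize macaulay_det (fun i => 'X_i ^+ d i : {mpoly S[m]}) = 1.
Proof.
rewrite specialize_det_macaulay => [|i]; last by rewrite mpolyXn dhomogX /= mdeg_pure.
rewrite -[RHS](@det1 S #|monomial m nu|); congr (\det _); apply/matrixP => k l.
rewrite !mxE mpolyXn -mpolyXD macaulay_cofactorK mcoeffX.
by rewrite (inj_eq (@monomial_inj _ _)) (inj_eq enum_val_inj).
Qed.

(** A monomial assigned to i0 has exponents below d i for all i != i0, and its degree determines the
    remaining exponent. *)
Lemma macaulay_count :
  (\sum_l (macaulay_form l == i0) <= \prod_(i | i != i0) d i)%N.
Proof.
rewrite (eq_bigr (fun l => if macaulay_form l == i0 then 1 else 0)%N) => [|l _]; last by case: eqP.
rewrite -big_mkcond sum1dep_card.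
rewrite -(card_box d i0).
pose g (l : 'I_#|monomial m nu|) : {ffun 'I_m -> 'I_(\max_i d i).+1} :=
  [ffun i => if i == i0 then ord0 else inord (mon l i)].
have small l i : macaulay_form l == i0 -> i != i0 -> (mon l i < d i)%N.
  rewrite /macaulay_form; case: pickP => [k /andP[/negPf /= ->] //|nle _ ii0].
  by have := nle i; rewrite ii0 /= => /negbT; rewrite -ltnNge.
have ltD i k : (k < d i)%N -> (k < (\max_i d i).+1)%N.
  by move=> lt; rewrite ltnS (leq_trans (ltnW lt)) // leq_bigmax.
have g_inj : {in [set l | macaulay_form l == i0] &, injective g}.
  move=> k l; rewrite !inE => hk hl /ffunP gkl.
  apply/enum_val_inj/monomial_inj/mnmP.
  have eqi i : i != i0 -> mon k i = mon l i.
    move=> ii0; have := gkl i; rewrite !ffunE (negPf ii0) => /(congr1 val) /=.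
    by rewrite !inordK // (ltD i) // small.
  move=> i; have [->|/eqi //] := eqVneq i i0.
  have := etrans (mdeg_monomial (enum_val k)) (esym (mdeg_monomial (enum_val l))).
  rewrite !mdegE (bigD1 i0) //= [RHS](bigD1 i0) //=.
  by rewrite (eq_bigr (fun i => mon l i)) => [/addIn //|j]; apply: eqi.
rewrite -(card_in_imset g_inj); apply: subset_leq_card.
apply/subsetP => _ /imsetP[l + ->]; rewrite inE => lP; apply/boxP.
split=> [|i ii0]; first by rewrite ffunE eqxx.
by rewrite ffunE (negPf ii0) inordK ?(ltD i) // small.
Qed.

End Macaulay.

(** * Existence of the resultant *)

Section Existence.

Variables (m : nat) (d : 'I_m -> nat) (i0 : 'I_m).
Hypothesis d_gt0 : forall i, (0 < d i)%N.

Local Notation A := (coef_ring d).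

Lemma inertia_formD (P Q : A) : inertia_form P -> inertia_form Q -> inertia_form (P + Q).
Proof.
have [L [tau tauI]] := mpoly2_fraction_embedding int #|coef_index d| m.
move=> /(inertia_form_elim i0 _ tauI) P0 /(inertia_form_elim i0 _ tauI) Q0.
by apply/(inertia_form_elim i0 _ tauI); rewrite rmorphD P0 Q0 addr0.
Qed.

Lemma inertia_formM (P Q : A) : inertia_form Q -> inertia_form (P * Q).
Proof.
have [L [tau tauI]] := mpoly2_fraction_embedding int #|coef_index d| m.
move=> /(inertia_form_elim i0 _ tauI) Q0.
by apply/(inertia_form_elim i0 _ tauI); rewrite rmorphM Q0 mulr0.
Qed.

Lemma inertia_form_prime (P Q : A) :
  inertia_form (P * Q) -> inertia_form P \/ inertia_form Q.
Proof.
have [L [tau tauI]] := mpoly2_fraction_embedding int #|coef_index d| m.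
move=> /(inertia_form_elim i0 _ tauI) /eqP; rewrite rmorphM mulf_eq0.
by case/orP => /eqP /(inertia_form_elim i0 _ tauI); [left | right].
Qed.

Lemma inertia_form1 : ~ inertia_form (1 : A).
Proof.
have [L [tau tauI]] := mpoly2_fraction_embedding int #|coef_index d| m.
by move=> /(inertia_form_elim i0 _ tauI) /eqP; rewrite rmorph1 oner_eq0.
Qed.

(** A generator of the ideal divides Macaulay's determinant, whose value at the y_i^(d i) is 1. The
    value of the generator there is therefore a sign, which is then absorbed. *)
Lemma resultant_exists : exists P, is_resultant (d := d) P.
Proof.
have D1 := specialize_macaulay_det d i0 int.
have ID := inertia_macaulay_det d i0.
set D := macaulay_det d i0 in D1 ID.
have [||||||P [IP P0 PQ]] := @principal_prime_ideal_free int _ (enum_rank (pure d i0 i0))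
  (@inertia_form m d) factorial_int.
- exact: inertia_formD.
- exact: inertia_formM.
- exact: inertia_form_prime.
- exact: inertia_form1.
- exists D => //; apply/eqP => D0; move/eqP: D1.
  by rewrite D0 specializeE rmorph0 eq_sym oner_eq0.
- by move=> P IP; apply: inertia_free_eq0.
have [S eD] := PQ _ ID.
pose G i : {mpoly int[m]} := 'X_i ^+ d i; pose u := specialize P G.
have su : specialize S G * u = 1.
  by rewrite -[RHS]D1 eD /u !specializeE rmorphM.
have uu : u * u = 1.
  have /orP[/eqP-> //|/eqP->//] : (u == 1) || (u == -1).
  have : u \is a GRing.unit by apply/unitrP; exists (specialize S G); split; rewrite // mulrC.
  by rewrite qualifE.
exists (u%:MP * P); split.
- exact: inertia_formM.
- move=> Q /PQ[T ->]; exists (T * u%:MP); rewrite -!mulrA; congr (_ * _).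
  by rewrite mulrA -mpolyCM uu mpolyC1 mul1r.
- by rewrite specializeE rmorphM /= mpoly_int_const rmorph_int intz.
Qed.

Lemma generic_resultantP : is_resultant (generic_resultant d).
Proof. exact: epsilon_spec resultant_exists. Qed.

Lemma generic_resultant_neq0 : generic_resultant d != 0.
Proof.
have [_ _ P1] := generic_resultantP; apply/eqP => P0; move/eqP: P1.
by rewrite P0 specializeE rmorph0 eq_sym oner_eq0.
Qed.

(** Substituting X_j t^(w j) turns the weighted degree into the degree in t, which is additive on
    products. *)
Lemma dhomog_dvd (N : nat) (R : idomainType) (w : 'I_N -> nat) (P Q : {mpoly R[N]}) e1 e2 :
  P != 0 -> Q != 0 -> P \is e1.-homog for (weight w) -> Q \is e2.-homog for (weight w) ->
  (exists S, Q = S * P) -> (e1 <= e2)%N.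
Proof.
move=> P0 Q0 hP hQ [S e].
pose sigma : {rmorphism {mpoly R[N]} -> {poly {mpoly R[N]}}} :=
  mmap (polyC \o @mpolyC N R) (fun j => ('X_j)%:P * 'X^(w j)).
have sE k (T : {mpoly R[N]}) : (sigma T)`_k = pihomog (weight w) k T.
  rewrite /sigma /= (coef_mmap_grade (@mpolyC N R) (fun j => 'X_j) w).
  have := comp_mpoly_id (pihomog (weight w) k T); rewrite /comp_mpoly => {2}<-.
  by apply: eq_mmap => // j; rewrite tnth_map tnth_ord_tuple.
have s_homog k (T : {mpoly R[N]}) : T != 0 -> T \is k.-homog for (weight w) ->
    size (sigma T) = k.+1.
  move=> T0 hT; apply/eqP; rewrite eqn_leq; apply/andP; split.
    apply/leq_sizeP => l kl; rewrite sE; apply/eqP; apply: contraT => nz.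
    by rewrite (pihomog_ne0 _ hT) ?eqxx // in nz; rewrite neq_ltn kl.
  rewrite ltnNge; apply/negP => /leq_sizeP/(_ k (leqnn k)).
  by rewrite sE pihomog_dE // => /eqP; rewrite (negPf T0).
have S0 : S != 0 by apply: contraNneq Q0 => S0; rewrite e S0 mul0r.
clearbody sigma.
have sS0 : sigma S != 0.
  have Sl : mlead S \in msupp S by apply: mlead_supp.
  apply: contraNneq S0 => /(congr1 (fun q : {poly _} => q`_(weight w (mlead S)))).
  rewrite sE coef0 => /(congr1 (mcoeff (mlead S))).
  by rewrite pihomog_coef eqxx mcoeff0 => /eqP; rewrite mcoeff_eq0 Sl.
have eS : sigma Q = sigma S * sigma P by rewrite -rmorphM e.
have sP0 : sigma P != 0 by rewrite -size_poly_eq0 (s_homog e1).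
have := s_homog _ _ Q0 hQ; rewrite eS size_mul // (s_homog _ _ P0 hP) addnS /=.
by move: sS0; rewrite -size_poly_gt0; case: (size _) => // k _ [<-]; apply: leq_addl.
Qed.

(** The graded part of P that contains its leading monomial is again an inertia form, hence a
    multiple of P; its size forces the cofactor to be constant, and the leading coefficient forces
    it to be 1. So P is homogeneous, and its degree is bounded by that of Macaulay's determinant,
    which it divides. *)
Lemma generic_resultant_homog_leq i : exists2 e,
  generic_resultant d \is e.-homog for (weight (form_weight i)) &
  (e <= \prod_(j | j != i) d j)%N.
Proof.
have [IP PQ _] := generic_resultantP; have P0 := generic_resultant_neq0.
set P := generic_resultant d in IP PQ P0 *.
have Pl : mlead P \in msupp P by apply: mlead_supp.
pose e := weight (form_weight i) (mlead P).
have hP : P \is e.-homog for (weight (form_weight i)).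
  have [S eS] := PQ _ (inertia_pihomog i e IP).
  rewrite homog_piE; set Pe := pihomog _ _ _ in eS *.
  have Pel : Pe@_(mlead P) = P@_(mlead P) by rewrite pihomog_coef eqxx.
  have Pe0 : Pe != 0.
    by apply: contraTneq Pl => Pe0; rewrite -mcoeff_eq0 -Pel Pe0 mcoeff0.
  have S0 : S != 0 by apply: contraNneq Pe0 => S0; rewrite eS S0 mul0r.
  have sPe : (msize Pe <= msize P)%N.
    apply/bigmax_leqP_seq => a; rewrite mcoeff_msupp pihomog_coef.
    case: ifP; rewrite ?eqxx // => _; rewrite -mcoeff_msupp => aP _.
    exact: msize_mdeg_lt.
  have /msize1_polyC eSc : (msize S <= 1)%N.
    move: (P0) sPe; rewrite -msize_poly_eq0 eS msizeM // -lt0n.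
    by case: (msize P) => // k _; rewrite addnS /=; move: (msize S) => t; lia.
  rewrite eSc mul_mpolyC in eS.
  have : S@_0 * P@_(mlead P) = 1 * P@_(mlead P) by rewrite mul1r -[RHS]Pel eS mcoeffZ.
  have Pl0 : P@_(mlead P) != 0 by rewrite -mcoeff_msupp.
  by move/(mulIf Pl0) => S1; rewrite eS S1 scale1r.
exists e => //; apply: leq_trans (macaulay_count d i).
have D1 := specialize_macaulay_det d i int.
have hD := det_macaulay_homog d i (@macaulay_form m d i) (@macaulay_cofactor m d i).
apply: dhomog_dvd P0 _ hP hD _; last exact/PQ/inertia_macaulay_det.
rewrite -/(macaulay_det d i); apply/eqP => D0; move/eqP: D1.
by rewrite D0 specializeE rmorph0 eq_sym oner_eq0.
Qed.

Lemma resultant_eq0_common_zero (K : idomainType) (G : 'I_m -> {mpoly K[m]}) (y : 'I_m -> K) :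
  (forall i, G i \is (d i).-homog) -> (forall i, (G i).@[y] = 0) ->
  (exists j, y j != 0) -> Defs.resultant d G = 0.
Proof.
move=> hG Gy ynz; have [IP _ _] := generic_resultantP.
rewrite /Defs.resultant specializeE; apply: (inertia_zero _ ynz IP) => i.
rewrite -[RHS](Gy i) -[G i in RHS](sum_coef_index (hG i)) raddf_sum /=.
by apply: eq_bigr => c /eqP <-; rewrite mevalZ mevalX.
Qed.

Lemma resultant_neq0_generated (K : fieldType) (G : 'I_m -> {mpoly K[m]}) nu :
  (forall i, G i \is (d i).-homog) ->
  (forall a : 'X_{1..m}, mdeg a = nu -> generated G 'X_[a]) ->
  Defs.resultant d G != 0.
Proof.
move=> hG gG; have [D ID] := inertia_minor hG gG.
have [_ /(_ _ ID)[S ->] _] := generic_resultantP.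
rewrite specializeE rmorphM /= -(specializeE (generic_resultant d)) -/(Defs.resultant d G).
by apply: contraNneq => ->; rewrite mulr0.
Qed.

End Existence.

(** * The projective Nullstellensatz *)

Section IsolateHomog.

Variables (R : comNzRingType) (n : nat) (j : 'I_n.+1).

Definition delete_exponent (a : 'X_{1..n.+1}) : 'X_{1..n} := [multinom a (lift j k) | k < n].

Lemma mdeg_delete_exponent a : mdeg a = (a j + mdeg (delete_exponent a))%N.
Proof.
rewrite !mdegE (bigD1_ord j) //=; congr (_ + _)%N.
by apply: eq_bigr => k _; rewrite mnmE.
Qed.

Lemma isolate_monomial (a : 'X_{1..n.+1}) :
  isolate j ('X_[a] : {mpoly R[n.+1]}) = ('X_[delete_exponent a])%:P * 'X^(a j).
Proof.
rewrite mpolyXE_id rmorph_prod (bigD1_ord j) //= rmorphXn /= isolateX mulrC; congr (_ * _).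
rewrite [in RHS]mpolyXE_id rmorph_prod; apply: eq_bigr => k _.
by rewrite !rmorphXn /= isolate_lift mnmE.
Qed.

Lemma coef_isolate (g : {mpoly R[n.+1]}) l :
  (isolate j g)`_l = \sum_(a <- msupp g | a j == l) g@_a *: 'X_[delete_exponent a].
Proof.
rewrite {1}[g]mpolyE rmorph_sum coef_sum [RHS]big_mkcond /=; apply: eq_bigr => a _.
rewrite -mul_mpolyC rmorphM /= isolateC isolate_monomial mulrA -polyCM coefCM coefXn.
by rewrite eq_sym mul_mpolyC; case: eqP; rewrite ?mulr1 ?mulr0.
Qed.

Lemma isolate_homog (g : {mpoly R[n.+1]}) k l :
  g \is k.-homog -> (isolate j g)`_l \is (k - l).-homog.
Proof.
move=> hg; rewrite coef_isolate big_seq_cond rpred_sum // => a /andP[ag /eqP al].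
apply: dhomogZ; rewrite dhomogX /= -(dhomog_mf hg ag) /= (mdeg_delete_exponent a) -al addKn //.
Qed.

(** The coefficient of x_j^k in a form of degree k is its value at the j-th coordinate point; when
    this is 1 the form is monic in x_j. *)
Lemma isolate_top (g : {mpoly R[n.+1]}) k : g \is k.-homog ->
  (size (isolate j g) <= k.+1)%N /\
  (isolate j g)`_k = (g.@[fun i => (i == j)%:R])%:MP.
Proof.
move=> hg; pose h i : {poly {mpoly R[n]}} := if unlift j i is Some k then ('X_k)%:P else 'X.
have w1 (a : 'X_{1..n.+1}) : weight (fun=> 1%N) a = mdeg a.
  by rewrite mdegE; apply: eq_bigr => i _; rewrite muln1.
have sh i : (size (h i) <= 2)%N.
  by rewrite /h; case: unliftP => [l|] _; rewrite ?size_polyX // (leq_trans (size_polyC_leq1 _)).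
have wk a : a \in msupp g -> (weight (fun=> 1%N) a <= k)%N.
  by move=> ag; rewrite w1 (dhomog_mf hg ag).
split; first exact: (size_mmap_weight (@mpolyC n R) sh wk).
rewrite [LHS](coef_mmap_weight (@mpolyC n R) sh wk) pihomog_dE; last first.
  by apply/dhomogP => a ag; rewrite /= w1 (dhomog_mf hg ag).
rewrite [RHS]rmorph_mmap; apply: eq_mmap => // i /=.
rewrite /h; case: unliftP => [l ->|->]; last by rewrite coefX eqxx.
by rewrite coefC /= [lift j l == j]eq_sym (negPf (neq_lift _ _)) mpolyC0.
Qed.

End IsolateHomog.

(** Taking remainders lowers the degree of q until it divides the whole ideal; it is then not a
    nonzero constant, so it has a root. For the zero ideal any point serves. *)
Lemma poly_ideal_root (K : closedFieldType) (I : {poly K} -> Prop) :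
  (forall p q, I p -> I q -> I (p + q)) -> (forall p q, I q -> I (p * q)) ->
  ~ I 1 -> exists b, forall p, I p -> p.[b] = 0.
Proof.
move=> ID IM I1; case: (classic (exists2 q, q != 0 & I q)) => [|noq]; last first.
  exists 0 => p Ip; have [->|p0] := eqVneq p 0; first by rewrite horner0.
  by case: noq; exists p.
move=> [q]; have [k] := ubnP (size q); elim: k q => // k IH q; rewrite ltnS => sq q0 Iq.
case: (classic (forall p, I p -> q %| p)) => [qdvd|].
  have [b /rootP rb] : exists b, root q b.
    apply/closed_rootP/eqP => /eqP/size_poly1P[c c0 qc]; apply: I1.
    have -> : 1 = c^-1%:P * q by rewrite qc -polyCM mulVf.
    exact: IM.
  by exists b => p /qdvd/dvdpP[r ->]; rewrite hornerM rb mulr0.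
move/not_all_ex_not => [p nq]; have [Ip nd] := imply_to_and _ _ nq.
apply: (IH (p %% q)).
- by apply: leq_trans sq; rewrite ltn_modp.
- by apply/negP => /eqP pq; apply: nd; rewrite /dvdp pq.
have -> : p %% q = p + (- (p %/ q)) * q by rewrite {2}(divp_eq p q); ring.
by apply: ID => //; apply: IM.
Qed.

(* The determinant of multiplication by G modulo the monic polynomial f is in *)
(* the ideal (f, G), and is 1 at a point where G specializes to 1.            *)
Lemma monic_elimination (R S : comNzRingType) (phi : {rmorphism R -> S}) (f G : {poly R}) :
  f \is monic -> (1 < size f)%N -> map_poly phi G = 1 ->
  exists r u v, r%:P = u * f + v * G /\ phi r = 1.
Proof.
move=> fm; case sf: (size f) => [|[|k]] // _ G1; have Rm := Pdiv.RingMonic.rdivp_eq fm.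
pose rem (i : 'I_k.+1) := Pdiv.Ring.rmodp ('X^i * G) f.
have s_rem i : (size (rem i) <= k.+1)%N.
  by rewrite -ltnS -sf /rem Pdiv.Ring.ltn_rmodp monic_neq0.
pose M : 'M_k.+1 := \matrix_(i, j) (rem i)`_j.
pose q i := Pdiv.Ring.rdivp ('X^i * G) f.
exists (\det M), (- \sum_i (\adj M ord0 i)%:P * q i), (\sum_i (\adj M ord0 i)%:P * 'X^i).
split.
  rewrite mulNr !mulr_suml addrC -sumrB.
  have remE (i : 'I_k.+1) : 'X^i * G = q i * f + rem i by apply: Rm.
  transitivity (\sum_i (\adj M ord0 i)%:P * rem i); last first.
    apply: eq_bigr => i _; rewrite -[in RHS]mulrA remE; ring.
  apply/polyP => l; rewrite coefC coef_sum.
  have [lk|kl] := ltnP l k.+1; last first.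
    rewrite big1 ?gtn_eqF ?(leq_trans _ kl) // => i _.
    by rewrite coefCM nth_default ?mulr0 // (leq_trans (s_rem i)).
  have /matrixP/(_ ord0 (Ordinal lk)) := mul_adj_mx M; rewrite mxE [RHS]mxE /= => e.
  rewrite [RHS](eq_bigr (fun i => \adj M ord0 i * M i (Ordinal lk))).
    by rewrite e eq_sym -val_eqE /= eq_sym; case: (l == 0%N).
  by move=> i _; rewrite coefCM [M _ _]mxE.
rewrite -det_map_mx -(det1 _ k.+1); congr (\det _); apply/matrixP => i l; rewrite !mxE.
have e : 'X^i - map_poly phi (rem i) = map_poly phi (q i) * map_poly phi f.
  have := congr1 (map_poly phi) (Rm ('X^i * G)).
  by rewrite rmorphM rmorphD /= map_polyXn G1 mulr1 rmorphM => ->; rewrite addrK.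
have q0 : map_poly phi (q i) = 0.
  apply/eqP; apply: contraT => q0.
  have fm' := monic_map phi fm.
  have := congr1 (fun p : {poly S} => size p) e; rewrite size_Mmonic //.
  have -> : size (map_poly phi f) = k.+2.
    by rewrite size_map_poly_id0 // (monicP fm) rmorph1 oner_neq0.
  rewrite addnS /= => se.
  have : (size ('X^i - map_poly phi (rem i))%R <= k.+1)%N.
    rewrite (leq_trans (size_polyD _ _)) // geq_max size_polyXn ltn_ord size_polyN.
    by rewrite (leq_trans (size_poly _ _)) //.
  rewrite se => le; move: q0; rewrite -size_poly_gt0; move: (size _) le => t; lia.
move/eqP: e; rewrite q0 mul0r subr_eq0 => /eqP /(congr1 (fun p : {poly S} => p`_l)).
by rewrite coefXn coef_map /= => <-; rewrite eq_sym -val_eqE.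
Qed.

Lemma insert_variable_monomial (R : comNzRingType) n (j : 'I_n.+1) (a : 'X_{1..n}) :
  exists b, [/\ insert_variable j ('X_[a] : {mpoly R[n]}) = 'X_[b],
     mdeg b = mdeg a & delete_exponent j b = a].
Proof.
exists (\sum_k U_(lift j k) *+ a k)%MM; split.
- rewrite /insert_variable mmapX /mmap1 -mprodXE.
  by apply: eq_bigr => k _; rewrite mpolyXn.
- rewrite mdeg_sum mdegE; apply: eq_bigr => k _.
  by rewrite mdegMn mdeg1 mul1n.
- apply/mnmP => k; rewrite mnmE mnm_sumE (bigD1 k) //= mulmnE mnm1E eqxx mul1n.
  rewrite big1 ?addn0 // => l lk.
  by rewrite mulmnE mnm1E (inj_eq lift_inj) (negPf lk).
Qed.

Lemma insert_variable_pihomog (R : comNzRingType) n (j : 'I_n.+1) k (p : {mpoly R[n]}) :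
  insert_variable j (pihomog mdeg k p) = pihomog mdeg k (insert_variable j p).
Proof.
elim/mpolyind: p => [|c a p _ _ IHp]; first by rewrite pihomog0 !rmorph0 pihomog0.
rewrite pihomogD !rmorphD /= pihomogD IHp; congr (_ + _).
have [b [e db _]] := insert_variable_monomial R j a.
rewrite linearZ /= -mul_mpolyC rmorphM /= insert_variableC mul_mpolyC.
rewrite -[in RHS]mul_mpolyC rmorphM /= insert_variableC mul_mpolyC linearZ /= e.
by rewrite !pihomogX /= db; case: eqP => _; rewrite ?e // rmorph0.
Qed.

Lemma eval_insert (K : comNzRingType) n (j : 'I_n.+1) (y : 'I_n -> K) b (g : {mpoly K[n.+1]}) :
  g.@[fun i => if unlift j i is Some k then y k else b] =
  (map_poly (meval y) (isolate j g)).[b].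
Proof.
pose z i := if unlift j i is Some k then y k else b.
pose ev : {rmorphism {poly {mpoly K[n]}} -> K} := horner_eval b \o map_poly (meval y).
apply: (@eq_mpoly_rmorphism _ _ _ (meval z) (ev \o isolate j)) => [c|i] /=.
  by rewrite mevalC isolateC /ev /= /horner_eval map_polyC hornerC /= mevalC.
rewrite mevalXU /z /ev /= /horner_eval; case: (unliftP j i) => [k ->|->].
  by rewrite isolate_lift map_polyC hornerC /= mevalXU.
by rewrite isolateX map_polyX hornerX.
Qed.

Lemma monic_elimination_mpoly (R : comNzRingType) n (j : 'I_n.+1) (y : 'I_n -> R)
    (g p : {mpoly R[n.+1]}) :
  isolate j g \is monic -> (1 < size (isolate j g))%N ->
  map_poly (meval y) (isolate j p) = 1 ->
  exists r u v, insert_variable j r = u * g + v * p /\ r.@[y] = 1.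
Proof.
move=> gm sg p1.
have [r [u [v [e r1]]]] : exists (r : {mpoly R[n]}) (u v : {poly {mpoly R[n]}}),
    r%:P = u * isolate j g + v * isolate j p /\ r.@[y] = 1.
  exact: monic_elimination gm sg p1.
exists r, (unisolate j u), (unisolate j v); split => //.
rewrite -unisolateC e.
have hD (a b c d : {poly {mpoly R[n]}}) : unisolate j (a * b + c * d) =
    unisolate j a * unisolate j b + unisolate j c * unisolate j d.
  by rewrite rmorphD !rmorphM.
by apply: etrans (hD _ _ _ _) _; congr (_ * _ + _ * _); apply: isolateK.
Qed.

Section Nullstellensatz.

Variable K : closedFieldType.

(** Induction on the number of variables. Unless J vanishes at the coordinate point e_j, it contains
    a form g monic in y_j. The elimination ideal J' of the elements free of y_j inherits the
    hypotheses, hence has a nonzero zero y. The polynomials p(y, y_j) with p in J form a proper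
    ideal by elimination with g, and a common root b of them extends y to a zero of J. *)
Lemma projective_nullstellensatz m (J : {mpoly K[m]} -> Prop) :
  J 0 -> (forall p q, J p -> J q -> J (p + q)) -> (forall p q, J q -> J (p * q)) ->
  (forall p k, J p -> J (pihomog mdeg k p)) ->
  (forall k, exists2 a : 'X_{1..m}, mdeg a = k & ~ J 'X_[a]) ->
  exists y : 'I_m -> K, (exists j, y j != 0) /\ forall p, J p -> p.@[y] = 0.
Proof.
elim: m J => [|n IH] J J0 JD JM Jh Jn.
  by have [a + _] := Jn 1%N; rewrite mdegE big_ord0.
pose j : 'I_n.+1 := ord0; pose ej (i : 'I_n.+1) : K := (i == j)%:R.
have JZ c p : J p -> J (c *: p) by move=> Jp; rewrite -mul_mpolyC; apply: JM.
have Jsum (T : Type) (s : seq T) (P : pred T) (f : T -> {mpoly K[n.+1]}) :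
    (forall i, P i -> J (f i)) -> J (\sum_(i <- s | P i) f i).
  by move=> Jf; elim/big_rec: _ => // i x Pi Jx; apply: JD => //; apply: Jf.
case: (classic (forall p, J p -> p.@[ej] = 0)) => [Jej|].
  by exists ej; split => //; exists j; rewrite /ej eqxx oner_eq0.
move/not_all_ex_not => [g0 ng0]; have [Jg0 g0ej] := imply_to_and _ _ ng0.
have [k [g [Jg hg gej]]] : exists k g, [/\ J g, g \is k.-homog & g.@[ej] = 1].
  have [k gk] : exists k, (pihomog mdeg k g0).@[ej] != 0.
    apply: NNPP => nk; apply: g0ej.
    rewrite (pihomog_partitionE (leqnn (msize g0))) raddf_sum big1 // => i _.
    by apply/eqP; apply: contraT => nz; case: nk; exists i.
  exists k, ((pihomog mdeg k g0).@[ej]^-1 *: pihomog mdeg k g0); split.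
  - by apply/JZ/Jh.
  - by apply: dhomogZ; apply: pihomogP.
  - by rewrite mevalZ mulVf.
pose f := isolate j g; have [sf ef] := isolate_top j hg.
rewrite -/f -/ej gej mpolyC1 in sf ef.
have size_f : size f = k.+1.
  apply/eqP; rewrite eqn_leq sf ltnNge; apply/negP => /leq_sizeP/(_ k (leqnn k)).
  by rewrite ef => /eqP; rewrite oner_eq0.
have f_monic : f \is monic by rewrite monicE lead_coefE size_f ef.
have k_gt0 : (0 < k)%N.
  rewrite lt0n; apply/eqP => k0; have [a _] := Jn 0%N; apply.
  rewrite -[X in J X]mulr1; apply: (JM) => //.
  have : f = 1 by rewrite [f]size1_polyC ?size_f ?k0 // -k0 ef.
  by move/(congr1 (unisolate j)); rewrite /f isolateK rmorph1 => <-.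
pose J' p := J (insert_variable j p).
have [|||||y [ynz y0]] := IH J'.
- by rewrite /J' rmorph0.
- by move=> p q Jp Jq; rewrite /J' rmorphD; apply: JD.
- by move=> p q Jq; rewrite /J' rmorphM; apply: JM.
- by move=> p l Jp; rewrite /J' insert_variable_pihomog; apply: Jh.
(* If J' contained all monomials of degree k0, division by g would put all monomials of degree k0 +
   k into J. *)
- move=> k0; apply: NNPP => noa.
  have J'a (a : 'X_{1..n}) : (k0 <= mdeg a)%N -> J' 'X_[a].
    move=> /subnKC; move: (mdeg a - k0)%N => s; elim: s a => [|s IHs] a.
      rewrite addn0 => da; apply: NNPP => na; apply: noa; exists a => //.
    have [i ai|a0] := pickP (fun i => a i != 0%N); last first.
      by rewrite mdegE big1 ?addnS // => i _; apply/eqP; rewrite -[_ == _]negbK a0.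
    have -> : a = (U_(i) + (a - U_(i)))%MM by rewrite addmC submK ?lep1mP.
    rewrite mdegD mdeg1 addnS => -[da]; rewrite mpolyXD /J' rmorphM.
    by apply: JM; apply: IHs.
  (* For l < k the cofactor has degree at least k0 and lies in J'. Otherwise y_j^l is rewritten with
     g, which lowers l and raises e by the same amount. *)
  have JX l (q : {mpoly K[n]}) e : q \is e.-homog -> (k0 + k <= e + l)%N ->
      J (insert_variable j q * 'X_j ^+ l).
    elim/ltn_ind: l q e => l IHl q e hq le.
    have [lk|kl] := ltnP l k.
      rewrite mulrC; apply: (JM); rewrite [q]mpolyE raddf_sum /= big_seq.
      apply: Jsum => a aq; rewrite -mul_mpolyC rmorphM /=; apply: JM; apply: J'a.
      rewrite (dhomog_mf hq aq); lia.
    have -> : 'X_j ^+ l = unisolate j (f * 'X^(l - k)) -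
        \sum_(i < k) insert_variable j f`_i * 'X_j ^+ (l - k + i).
      set t := (\sum_(i < k) _ : {mpoly K[n.+1]}).
      have tE : unisolate j ((\sum_(i < k) f`_i *: 'X^i) * 'X^(l - k)) = t.
        rewrite mulr_suml rmorph_sum; apply: eq_bigr => i _ /=.
        rewrite -mul_polyC -mulrA -exprD rmorphM rmorphXn /= unisolateC.
        by rewrite unisolateX addnC.
      have fE : f = 'X^k + \sum_(i < k) f`_i *: 'X^i.
        by rewrite -{1}[f]coefK poly_def size_f big_ord_recr /= ef scale1r addrC.
      rewrite {1}fE mulrDl rmorphD /= tE -exprD subnKC // rmorphXn /= unisolateX.
      by rewrite addrK.
    rewrite mulrBr; apply: JD.
      by rewrite rmorphM /= isolateK mulrA mulrC mulrA; apply: JM.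
    rewrite -mulN1r; apply: JM; rewrite mulr_sumr; apply: Jsum => i _.
    have ik := ltn_ord i; rewrite mulrA -rmorphM; apply: (IHl _ _ _ (e + (k - i))%N); first lia.
      by apply: dhomogM => //; apply: isolate_homog.
    lia.
  have [a da] := Jn (k0 + k)%N; apply; rewrite -(isolateK j 'X_[a]) isolate_monomial.
  rewrite rmorphM rmorphXn /= unisolateC unisolateX.
  apply: (JX _ _ (mdeg (delete_exponent j a))); first by rewrite dhomogX.
  by rewrite -da (mdeg_delete_exponent j a) addnC.
have [b b0] : exists b, forall p, J p -> (map_poly (meval y) (isolate j p)).[b] = 0.
  pose I q := exists2 p, J p & map_poly (meval y) (isolate j p) = q.
  have [|||b bP] := @poly_ideal_root K I.
  - move=> _ _ [p Jp <-] [q Jq <-]; exists (p + q); first exact: JD.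
    by rewrite !rmorphD.
  - move=> r _ [p Jp <-]; exists (unisolate j (map_poly (@mpolyC n K) r) * p); first exact: JM.
    rewrite !rmorphM /= unisolateK -map_poly_comp; congr (_ * _).
    by rewrite map_poly_id // => c _ /=; rewrite mevalC.
  (* If some p in J becomes 1 over y, elimination with g yields an element of J' with value 1 at
     y. *)
  - move=> [p Jp p1].
    have [|r [u [v [e r1]]]] := monic_elimination_mpoly f_monic _ p1.
      by rewrite size_f ltnS.
    have /y0 : J (insert_variable j r) by rewrite e; apply: JD; apply: JM.
    by move/eqP; rewrite r1 oner_eq0.
  by exists b => p Jp; apply: bP; exists p.
exists (fun i => if unlift j i is Some k then y k else b); split.
  by have [i yi] := ynz; exists (lift j i); rewrite liftK.
by move=> p Jp; rewrite eval_insert b0.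
Qed.

End Nullstellensatz.

(** * Zeros and degree of the resultant *)

Lemma generated_pihomog (R : comNzRingType) m r (G : 'I_r -> {mpoly R[m]}) (d : 'I_r -> nat) k p :
  (forall i, G i \is (d i).-homog) -> generated G p -> generated G (pihomog mdeg k p).
Proof.
move=> hG [Q ->]; rewrite raddf_sum /=; apply: generated_sum => i _.
elim/mpolyind: (Q i) => [|c a q _ _ IH]; first by rewrite mul0r pihomog0; apply: generated0.
rewrite mulrDl pihomogD; apply: generatedD => //.
have h : c *: 'X_[a] * G i \is (mdeg a + d i).-homog.
  by apply: dhomogM => //; apply: dhomogZ; rewrite dhomogX.
have [e|ne] := eqVneq (mdeg a + d i)%N k.
  by rewrite pihomog_dE -?e //; apply: generatedM; apply: generated_gen.
by rewrite (pihomog_ne0 _ h) //; apply: generated0.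
Qed.

(** Without a nonzero common zero, the Nullstellensatz puts all monomials of some degree into the
    ideal of the forms, and then some inertia form, a multiple of the resultant, is nonzero at G. *)
Lemma resultant_eq0P (K : closedFieldType) m (d : 'I_m -> nat) (i0 : 'I_m)
    (G : 'I_m -> {mpoly K[m]}) :
  (forall i, (0 < d i)%N) -> (forall i, G i \is (d i).-homog) ->
  Defs.resultant d G = 0 <->
  exists y, (exists j, y j != 0) /\ forall i, (G i).@[y] = 0.
Proof.
move=> d0 hG; split=> [r0|[y [ynz Gy]]]; last first.
  exact: (resultant_eq0_common_zero i0 d0 hG Gy).
have [|||||y [ynz Jy]] := @projective_nullstellensatz K m (generated G); last first.
- by exists y; split=> // i; apply/Jy/generated_gen.
- move=> k; apply: NNPP => nk; move/eqP: r0; apply/negP.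
  apply: (resultant_neq0_generated i0 d0 (nu := k)) => // a da.
  by apply: NNPP => na; apply: nk; exists a.
- by move=> p k; apply: generated_pihomog.
- exact: generatedM.
- exact: generatedD.
- exact: generated0.
Qed.

Lemma resultant_map (S T : comNzRingType) (phi : {rmorphism S -> T}) m (d : 'I_m -> nat)
    (G : 'I_m -> {mpoly S[m]}) :
  phi (Defs.resultant d G) = Defs.resultant d (fun i => map_mpoly phi (G i)).
Proof.
rewrite /Defs.resultant !specializeE.
pose v (c : coef_index d) := (G (coef_form c))@_(coef_mon c).
have e : phi \o coef_eval v =1
    coef_eval (fun c : coef_index d => (map_mpoly phi (G (coef_form c)))@_(coef_mon c)).
  by apply: coef_ring_ext => c /=; rewrite !coef_evalX mcoeff_map_mpoly.
exact: e.
Qed.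

Lemma base_expansion_inj B m (a b : 'I_m -> nat) :
  (forall j, (a j < B)%N) -> (forall j, (b j < B)%N) ->
  (\sum_j a j * B ^ j = \sum_j b j * B ^ j)%N -> a =1 b.
Proof.
elim: m a b => [|m IH] a b aB bB; first by move=> _ [].
have recl (c : 'I_m.+1 -> nat) : (\sum_j c j * B ^ j =
    (\sum_(j < m) c (lift ord0 j) * B ^ j) * B + c ord0)%N.
  rewrite big_ord_recl expn0 muln1 addnC big_distrl; congr (_ + _)%N.
  by apply: eq_bigr => j _ /=; rewrite -mulnA -expnSr.
have B0 : (0 < B)%N by apply: leq_trans (aB ord0).
rewrite !recl => e; have e0 : a ord0 = b ord0.
  by have := congr1 (modn^~ B) e; rewrite !modnMDl !modn_small.
have /IH eS : (\sum_(j < m) a (lift ord0 j) * B ^ j = \sum_(j < m) b (lift ord0 j) * B ^ j)%N.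
  by have := congr1 (divn^~ B) e; rewrite !divnMDl // !divn_small ?addn0.
by move=> j; case: (unliftP ord0 j) => [k|] -> //; apply: eS.
Qed.

Lemma natr_inj_pchar0 (K : fieldType) : [pchar K] =i pred0 -> injective (fun k : nat => k%:R : K).
Proof.
move=> /pcharf0P K0 a b; wlog ab : a b / (a <= b)%N => [hw|] e.
  by case: (leqP a b) => [/hw|/ltnW/hw h]; [exact | apply/esym/h].
apply/eqP; rewrite eqn_leq ab /= -subn_eq0 -K0 natrB // subr_eq0.
by apply/eqP/esym.
Qed.

(** * The exact degree of the resultant in one form *)

Section Degree.

Variables (K : closedFieldType) (m : nat) (d : 'I_m -> nat) (i0 : 'I_m).
Hypothesis charK0 : [pchar K] =i pred0.
Hypothesis d_gt0 : forall i, (0 < d i)%N.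

Local Notation D := (\max_i d i)%N.
Local Notation B := D.+2.

(** The factor k + 1 serves as a digit in base B: the weighted sum of the coordinates of a common
    zero becomes an expansion in base B, which determines the zero. *)
Definition lin_root (i : 'I_m) (k : nat) : K := (k.+1 * B ^ i)%:R.

(* For i <> i0 the form is a product of d i linear forms y_i - a y_(i0), so   *)
(* that these forms have \prod_(i != i0) (d i) common zeros with y_(i0) = 1,  *)
(* indexed by the box; the linear form below takes distinct values at them.   *)
Definition split_form (i : 'I_m) : {mpoly K[m]} :=
  if i == i0 then 'X_i0 ^+ d i0 else \prod_(k < d i) ('X_i - lin_root i k *: 'X_i0).

Definition separating_form : {mpoly K[m]} :=
  'X_i0 ^+ (d i0).-1 *
  (\sum_i (if i == i0 then (B ^ i0)%:R *: 'X_i0 else 'X_i)).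

(** The variable of K[t] is the parameter of the pencil. At the common zero indexed by g the form i0
    takes the value 1 - t [box_value g], so the resultant has a root at the inverse of each
    [box_value g]. *)
Definition pencil_form (i : 'I_m) : {mpoly {poly K}[m]} :=
  map_mpoly polyC (split_form i) -
  (if i == i0 then 'X *: map_mpoly polyC separating_form else 0).

Lemma split_form_homog i : split_form i \is (d i).-homog.
Proof.
rewrite /split_form; case: eqP => [->|_]; first by rewrite mpolyXn dhomogX /= mdeg_pure.
have h (k : 'I_(d i)) : 'X_i - lin_root i k *: 'X_i0 \is 1.-homog.
  by rewrite rpredB ?dhomogZ ?dhomogX /= ?mdeg1.
by have := dhomog_prodr (index_enum _) h; rewrite sum1_card card_ord.
Qed.

Lemma separating_form_homog : separating_form \is (d i0).-homog.
Proof.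
rewrite -(prednK (d_gt0 i0)) -addn1; apply: dhomogM.
  by rewrite mpolyXn dhomogX /= mdegMn mdeg1 mul1n.
by apply: rpred_sum => i _; case: ifP => _; rewrite ?dhomogZ ?dhomogX /= ?mdeg1.
Qed.

Lemma map_pencil_form t i :
  map_mpoly (horner_eval t) (pencil_form i) =
  split_form i - (if i == i0 then t *: separating_form else 0).
Proof.
apply/mpolyP => a; rewrite mcoeff_map_mpoly /pencil_form !mcoeffB mcoeff_map_mpoly.
rewrite /= /horner_eval hornerD hornerN hornerC; congr (_ - _).
case: ifP => _; last by rewrite !mcoeff0 horner0.
by rewrite !mcoeffZ mcoeff_map_mpoly hornerM hornerX hornerC.
Qed.

Lemma pencil_form_homog t i : map_mpoly (horner_eval t) (pencil_form i) \is (d i).-homog.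
Proof.
rewrite map_pencil_form rpredB ?split_form_homog //.
by case: eqP => [->|_]; rewrite ?dhomog0 // dhomogZ // separating_form_homog.
Qed.

Definition box_point (g : {ffun 'I_m -> 'I_D.+1}) (i : 'I_m) : K :=
  if i == i0 then 1 else lin_root i (g i).

Definition box_value (g : {ffun 'I_m -> 'I_D.+1}) : nat := (\sum_i (g i).+1 * B ^ i)%N.

Lemma box_value_inj : injective box_value.
Proof.
move=> g h /base_expansion_inj e; apply/ffunP => i; apply/val_inj.
have lt (f : {ffun 'I_m -> 'I_D.+1}) j : ((f j).+1 < B)%N by rewrite ltnS ltn_ord.
by have /eqP := e (lt g) (lt h) i; rewrite eqSS => /eqP.
Qed.

Lemma box_value_gt0 g : (0 < box_value g)%N.
Proof. by rewrite /box_value (bigD1 i0) //= ltn_addr // mulSn ltn_addr // expn_gt0. Qed.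

Lemma separating_form_box g : g \in box i0 -> separating_form.@[box_point g] = (box_value g)%:R.
Proof.
move=> /boxP[g0 _]; rewrite /separating_form mevalM rmorphXn /= mevalXU {1}/box_point eqxx.
rewrite expr1n mul1r raddf_sum /box_value natr_sum; apply: eq_bigr => i _ /=.
case: eqP => [->|/eqP ii0]; first by rewrite mevalZ mevalXU /box_point eqxx mulr1 g0 mul1n.
by rewrite mevalXU /box_point (negPf ii0).
Qed.

Lemma split_form_box g i : g \in box i0 -> i != i0 -> (split_form i).@[box_point g] = 0.
Proof.
move=> /boxP[_ gi] ii0; rewrite /split_form (negPf ii0) rmorph_prod.
rewrite (bigD1 (Ordinal (gi i ii0))) //= mevalB mevalZ !mevalXU /box_point eqxx (negPf ii0).
by rewrite mulr1 subrr mul0r.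
Qed.

Lemma pencil_resultant_root g : g \in box i0 ->
  (Defs.resultant d pencil_form).[(box_value g)%:R^-1] = 0.
Proof.
move=> gb; rewrite -/(horner_eval _ _) resultant_map.
apply: (resultant_eq0_common_zero i0 d_gt0 (y := box_point g)).
- exact: pencil_form_homog.
- move=> i; rewrite map_pencil_form mevalB.
  have [->|ii0] := eqVneq i i0; last by rewrite split_form_box // meval0 subr0.
  rewrite mevalZ separating_form_box // mulVf; last first.
    by move/pcharf0P: charK0 => ->; rewrite -lt0n box_value_gt0.
  rewrite /split_form eqxx rmorphXn /= mevalXU /box_point eqxx expr1n subrr //.
- by exists i0; rewrite /box_point eqxx oner_eq0.
Qed.

Lemma pencil_resultant_neq0 : (Defs.resultant d pencil_form).[0] != 0.
Proof.
rewrite -/(horner_eval _ _) resultant_map; apply/eqP.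
move/(resultant_eq0P i0 d_gt0 (pencil_form_homog 0)) => [y [[j yj] Gy]].
have {}Gy i : (split_form i).@[y] = 0.
  have := Gy i; rewrite map_pencil_form scale0r; case: ifP => _; by rewrite subr0.
have y0 : y i0 = 0.
  have := Gy i0; rewrite /split_form eqxx rmorphXn /= mevalXU => /eqP.
  by rewrite expf_eq0 => /andP[_ /eqP].
case/eqP: yj; have [->//|ji0] := eqVneq j i0.
have := Gy j; rewrite /split_form (negPf ji0) rmorph_prod /=.
under eq_bigr => k _ do rewrite mevalB mevalZ !mevalXU y0 mulr0 subr0.
by move/eqP; rewrite prodr_const expf_eq0 => /andP[_ /eqP].
Qed.

Lemma size_pencil_resultant e :
  generic_resultant d \is e.-homog for (weight (form_weight i0)) ->
  (size (Defs.resultant d pencil_form) <= e.+1)%N.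
Proof.
move=> hP; rewrite /Defs.resultant specializeE.
pose h (j : 'I_#|coef_index d|) := let c := enum_val j in
  (pencil_form (coef_form c))@_(coef_mon c).
have size_h j : (size (h j) <= (form_weight i0 j).+1)%N.
  rewrite /h /form_weight /= /pencil_form mcoeffB mcoeff_map_mpoly.
  case: eqP => _; last by rewrite mcoeff0 subr0 size_polyC_leq1.
  rewrite mcoeffZ mcoeff_map_mpoly (leq_trans (size_polyD _ _)) // geq_max.
  rewrite (leq_trans (size_polyC_leq1 _)) //= size_polyN mulrC mul_polyC.
  by rewrite (leq_trans (size_scale_leq _ _)) // size_polyX.
have := size_mmap_weight (intmul (1 : K)) size_h (P := generic_resultant d) (k := e).
rewrite (_ : mmap _ _ _ = coef_eval (fun c => (pencil_form (coef_form c))@_(coef_mon c))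
    (generic_resultant d)).
  by apply=> a aP; rewrite (dhomog_mf hP aP).
by apply: eq_mmap => // z /=; rewrite rmorph_int.
Qed.

(** Macaulay's determinant gives the upper bound. Conversely, the resultant of the pencil is nonzero
    at t = 0, has degree at most e in t, and has as many distinct roots as the box has elements. *)
Lemma generic_resultant_homog :
  generic_resultant d \is (\prod_(i | i != i0) d i).-homog for (weight (form_weight i0)).
Proof.
have [e he le] := generic_resultant_homog_leq i0 d_gt0 i0.
suff -> : (\prod_(i | i != i0) d i)%N = e by [].
apply/eqP; rewrite eqn_leq le andbT.
pose rs := [seq (box_value g)%:R^-1 : K | g <- enum (@box m d i0)].
have r0 : Defs.resultant d pencil_form != 0.
  by apply: contraNneq pencil_resultant_neq0 => ->; rewrite horner0.
have := max_poly_roots r0 (rs := rs).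
rewrite size_map -cardE card_box => h; rewrite -ltnS.
apply: leq_trans (size_pencil_resultant he); apply: h.
  by apply/allP => _ /mapP[g + ->]; rewrite mem_enum => gb; apply/eqP/pencil_resultant_root.
rewrite map_inj_uniq ?enum_uniq // => g h /invr_inj /(natr_inj_pchar0 charK0).
exact: box_value_inj.
Qed.

End Degree.

(** * Polars and contact of lines *)

Section InfiniteField.

Variable K : fieldType.
Hypothesis charK0 : [pchar K] =i pred0.

Lemma poly_eval_eq0 (p : {poly K}) : (forall t, p.[t] = 0) -> p = 0.
Proof.
move=> p0; apply/eqP; apply: contraT => nz.
have := max_poly_roots nz (rs := [seq k%:R : K | k <- iota 0 (size p)]).
rewrite size_map size_iota ltnn => -> //; first by apply/allP => t _; apply/eqP.
by rewrite map_inj_uniq ?iota_uniq //; apply: natr_inj_pchar0.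
Qed.

Lemma poly_eval_eq0_away (c p : {poly K}) :
  c != 0 -> (forall t, c.[t] != 0 -> p.[t] = 0) -> p = 0.
Proof.
move=> c0 p0; apply: (mulIf c0); rewrite mul0r; apply: poly_eval_eq0 => t.
by rewrite hornerM; have [->|/p0 ->] := eqVneq c.[t] 0; rewrite ?mulr0 ?mul0r.
Qed.

Lemma mpoly_eval_eq0 n (p : {mpoly K[n]}) : (forall y, p.@[y] = 0) -> p = 0.
Proof.
elim: n p => [|n IH] p p0.
  by rewrite [p]nvar0_mpolyC; have := p0 (fun=> 0); rewrite {1}[p]nvar0_mpolyC mevalC => ->.
rewrite -(isolateK ord0 p); suff -> : isolate ord0 p = 0 by rewrite rmorph0.
apply/polyP => k; rewrite coef0; apply: IH => y.
have : map_poly (meval y) (isolate ord0 p) = 0.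
  by apply: poly_eval_eq0 => b; rewrite -eval_insert p0.
by move/(congr1 (fun q : {poly K} => q`_k)); rewrite coef_map coef0.
Qed.

End InfiniteField.

Lemma meval_scale (R : comNzRingType) n (f : {mpoly R[n]}) d u (v : 'I_n -> R) :
  f \is d.-homog -> f.@[fun i => u * v i] = u ^+ d * f.@[v].
Proof.
move=> hf; rewrite !mevalE mulr_sumr big_seq [RHS]big_seq; apply: eq_bigr => a af.
rewrite mulrCA; congr (_ * _); rewrite -(dhomog_mf hf af) /= mdegE -prodrXr -big_split /=.
by apply: eq_bigr => i _; rewrite exprMn.
Qed.

Section LinePoly.

Variables (R : comNzRingType) (n : nat).
Implicit Types (f : {mpoly R[n]}) (x y : 'I_n -> R).

Definition line_poly f x y : {poly R} :=
  mmap (@polyC R) (fun i => (x i)%:P + (y i)%:P * 'X) f.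

Lemma horner_line_poly f x y t : (line_poly f x y).[t] = f.@[fun i => x i + t * y i].
Proof.
rewrite -/(horner_eval t _) /line_poly rmorph_mmap; apply: eq_mmap => [c|i] /=.
  by rewrite /horner_eval hornerC.
by rewrite /horner_eval hornerD hornerM hornerX !hornerC mulrC.
Qed.

Lemma line_poly0 f x y : (line_poly f x y)`_0 = f.@[x].
Proof.
by rewrite -horner_coef0 horner_line_poly; apply: meval_eq => i; rewrite mul0r addr0.
Qed.

Lemma size_line_poly f x y d : f \is d.-homog -> (size (line_poly f x y) <= d.+1)%N.
Proof.
move=> hf; pose h i := (x i)%:P + (y i)%:P * 'X.
have sh i : (size (h i) <= 2)%N.
  rewrite (leq_trans (size_polyD _ _)) // geq_max (leq_trans (size_polyC_leq1 _)) //=.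
  by rewrite mul_polyC (leq_trans (size_scale_leq _ _)) // size_polyX.
apply: (size_mmap_weight idfun sh (w := fun=> 1%N)) => a af.
rewrite -(dhomog_mf hf af) /= mdegE; apply: eq_leq.
by apply: eq_bigr => i _; rewrite muln1.
Qed.

(** The shape of f(x + t y) for a form f of degree D, stable under the products from which it is
    built. *)
Definition bihomog D (q : {poly {mpoly {mpoly R[n]}[n]}}) :=
  forall k, [/\ q`_k \is k.-homog, (D < k)%N -> q`_k = 0
    & forall a, (k <= D)%N -> (q`_k)@_a \is (D - k).-homog].

Lemma bihomogM D E p q : bihomog D p -> bihomog E q -> bihomog (D + E) (p * q).
Proof.
move=> hp hq k; rewrite coefM; split.
- apply: rpred_sum => i _; have [hi _ _] := hp i; have [hj _ _] := hq (k - i)%N.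
  by have := dhomogM hi hj; rewrite subnKC ?leq_ord.
- move=> Dk; rewrite big1 // => i _; have [_ pi _] := hp i; have [_ qi _] := hq (k - i)%N.
  have [/pi ->|iD] := ltnP D i; first by rewrite mul0r.
  by rewrite qi ?mulr0 //; have := leq_ord i; lia.
- move=> a kD; rewrite raddf_sum; apply: rpred_sum => i _ /=.
  have [_ pi hi] := hp i; have [_ qj hj] := hq (k - i)%N; have ik := leq_ord i.
  have [/pi ->|iD] := ltnP D i; first by rewrite mul0r mcoeff0 rpred0.
  have [/qj ->|jE] := ltnP E (k - i); first by rewrite mulr0 mcoeff0 rpred0.
  rewrite mcoeffM; apply: rpred_sum => b _.
  have -> : (D + E - k = (D - i) + (E - (k - i)))%N by lia.
  by apply: dhomogM; [apply: hi | apply: hj].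
Qed.

Lemma bihomogD D p q : bihomog D p -> bihomog D q -> bihomog D (p + q).
Proof.
move=> hp hq k; have [p1 p2 p3] := hp k; have [q1 q2 q3] := hq k; rewrite coefD; split.
- exact: rpredD.
- by move=> Dk; rewrite p2 // q2 // addr0.
- by move=> a kD; rewrite mcoeffD rpredD // ?p3 ?q3.
Qed.

Lemma bihomogC c : bihomog 0 (c%:MP%:MP%:P).
Proof.
move=> k; rewrite coefC; case: eqP => [->|/eqP k0]; last first.
  by split; rewrite ?rpred0 // => a; rewrite leqn0 (negPf k0).
split=> //; first by rewrite -[_%:MP]mulr1 mul_mpolyC dhomogZ // dhomog1.
move=> a _; rewrite mcoeffC; case: eqP => _; last by rewrite mulr0 rpred0.
by rewrite mulr1 -[_%:MP]mulr1 mul_mpolyC dhomogZ // dhomog1.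
Qed.

Lemma bihomog1 : bihomog 0 1.
Proof. by have := bihomogC 1; rewrite !mpolyC1 polyC1. Qed.

Lemma bihomog_var i : bihomog 1 (('X_i)%:MP%:P + ('X_i)%:P * 'X).
Proof.
move=> k; rewrite coefD coefC coefMX coefC; case: k => [|[|k]] /=; rewrite ?addr0 ?add0r.
- split=> //; first by rewrite -[_%:MP]mulr1 mul_mpolyC dhomogZ // dhomog1.
  move=> a _; rewrite mcoeffC; case: eqP => _; last by rewrite mulr0 rpred0.
  by rewrite mulr1 dhomogX /= mdeg1.
- split=> //; first by rewrite dhomogX /= mdeg1.
  move=> a _; rewrite mcoeffX; case: eqP => _; last by rewrite rpred0.
  exact: dhomog1.
- by split; rewrite ?rpred0.
Qed.

Lemma bihomog_expand f d : f \is d.-homog -> bihomog d (expand f).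
Proof.
move=> hf; rewrite /expand /mmap big_seq.
elim/big_rec: _ => [k|a q af hq].
  by split=> [|//|b _]; rewrite coef0 ?mcoeff0 ?rpred0.
apply: bihomogD => //; rewrite -[d]add0n; apply: bihomogM; first exact: bihomogC.
rewrite -(dhomog_mf hf af) /= mdegE /mmap1.
elim: (index_enum _) => [|i s IH]; first by rewrite !big_nil; apply: bihomog1.
rewrite !big_cons; apply: bihomogM => //.
elim: (a i) => [|k IHk]; first by rewrite expr0; apply: bihomog1.
by rewrite exprS -add1n; apply: bihomogM => //; apply: bihomog_var.
Qed.

Lemma expandE f : expand f =
  mmap (polyC \o (@mpolyC n {mpoly R[n]} \o @mpolyC n R))
       (fun i => ('X_i)%:MP%:P + ('X_i)%:P * 'X) f.
Proof. by []. Qed.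

Lemma eval_expand f x y :
  map_poly (meval y \o map_mpoly (meval x)) (expand f) = line_poly f x y.
Proof.
rewrite expandE rmorph_mmap; apply: eq_mmap => [c|i] /=.
  by rewrite map_polyC /= map_mpolyC mevalC /= mevalC.
rewrite rmorphD rmorphM /= map_polyX !map_polyC /= map_mpolyC map_mpolyX.
by rewrite mevalC /= !mevalXU.
Qed.

Lemma eval_polar f k x y :
  (map_mpoly (meval x) (polar f k)).@[y] = (line_poly f x y)`_k *+ k`!.
Proof. by rewrite -eval_expand coef_map /= /polar !rmorphMn. Qed.

Lemma polar_homog f d k x : f \is d.-homog -> map_mpoly (meval x) (polar f k) \is k.-homog.
Proof.
move=> /bihomog_expand/(_ k)[hk _ _]; apply/dhomogP => a.
rewrite mcoeff_msupp mcoeff_map_mpoly /polar mcoeffMn /= => nz; apply: (dhomog_mf hk).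
by rewrite mcoeff_msupp; apply: contraNneq nz => ->; rewrite mul0rn meval0.
Qed.

Lemma polar_coef_homog f d k a : f \is d.-homog -> (k <= d)%N ->
  (polar f k)@_a \is (d - k).-homog.
Proof.
move=> /bihomog_expand/(_ k)[_ _ hk] kd; rewrite /polar mcoeffMn.
by rewrite rpredMn // hk.
Qed.

Lemma polar_gt f d k : f \is d.-homog -> (d < k)%N -> polar f k = 0.
Proof. by move=> /bihomog_expand/(_ k)[_ hk _] /hk e; rewrite /polar e mul0rn. Qed.

Lemma polarB f g k : polar (f - g) k = polar f k - polar g k.
Proof. by rewrite /polar !expandE mmapB coefB mulrnBl. Qed.

Lemma polarZ c f k : polar (c *: f) k = c%:MP *: polar f k.
Proof.
by rewrite /polar !expandE mmapZ /= coefCM -mulrnAr mul_mpolyC.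
Qed.

End LinePoly.

Section Shift.

Variables (K : fieldType) (n : nat).
Hypothesis charK0 : [pchar K] =i pred0.
Implicit Types (f : {mpoly K[n]}) (x y : 'I_n -> K).

(** With c = 1 + al t one has f(x + t (y + al x)) = c^d f(x + (t / c) y), and t / c vanishes to
    order one at t = 0. *)
Lemma line_poly_shift f d r x y al : f \is d.-homog ->
  'X^r %| line_poly f x y -> 'X^r %| line_poly f x (fun i => y i + al * x i).
Proof.
move=> hf /dvdpP[g eg]; pose c : {poly K} := 1 + al *: 'X.
have cE t : c.[t] = 1 + al * t by rewrite hornerD hornerC hornerZ hornerX.
have c0 : c != 0.
  by apply/eqP => /(congr1 (horner^~ 0)) /eqP; rewrite cE mulr0 addr0 horner0 oner_eq0.
(* This is c^(d - r) g(t / c) with denominators cleared. The degree bound on f(x + t y) gives k + r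
   <= d for every k in the sum, so the subtractions are exact. *)
pose Q := \sum_(k < size g) g`_k *: ('X^k * c ^+ (d - r - k)).
suff -> : line_poly f x (fun i => y i + al * x i) = Q * 'X^r by apply: dvdp_mull.
apply/eqP; rewrite -subr_eq0; apply/eqP/(poly_eval_eq0_away charK0 c0) => t.
set u := c.[t]; move=> u0; rewrite hornerD hornerN hornerM hornerXn.
have -> : (line_poly f x (fun i => y i + al * x i)).[t] = u ^+ d * (line_poly f x y).[t / u].
  rewrite !horner_line_poly -(meval_scale _ _ hf); apply: meval_eq => i.
  rewrite [RHS]mulrDr mulrA [u * (t / u)]mulrC divfK // /u cE; ring.
rewrite eg hornerM hornerXn horner_coef /Q horner_sum mulr_suml mulr_suml mulr_sumr -sumrB.
rewrite big1 // => k _; apply/eqP; rewrite subr_eq0; apply/eqP.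
rewrite hornerZ hornerM hornerXn horner_exp -/u.
have le : (k + r <= d)%N.
  have gnz : g != 0 by rewrite -size_poly_gt0 (leq_ltn_trans _ (ltn_ord k)).
  have := size_line_poly x y hf; rewrite eg size_Mmonic ?monicXn // size_polyXn addnS /=.
  by move=> h; rewrite -ltnS; apply: leq_trans h; rewrite -addSn leq_add2r.
have -> : u ^+ d = u ^+ (d - r - k) * (u ^+ k * u ^+ r).
  by rewrite -!exprD; congr (_ ^+ _); lia.
by rewrite !expr_div_n; field; rewrite !expf_neq0.
Qed.

Lemma line_poly_self f d x r : f \is d.-homog -> f.@[x] = 0 -> 'X^r %| line_poly f x x.
Proof.
move=> hf fx; suff -> : line_poly f x x = 0 by apply: dvdp0.
apply: (poly_eval_eq0 charK0) => t; rewrite horner_line_poly.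
have -> : f.@[fun i => x i + t * x i] = f.@[fun i => (1 + t) * x i].
  by apply: meval_eq => i; rewrite mulrDl mul1r.
by rewrite (meval_scale _ _ hf) fx mulr0.
Qed.

Lemma dvdXnP r (g : {poly K}) : reflect (forall k, (k < r)%N -> g`_k = 0) ('X^r %| g).
Proof.
apply: (iffP idP) => [/dvdpP[h ->] k kr|g0]; first by rewrite coefMXn kr.
rewrite -(poly_take_drop r g) dvdp_addl ?dvdp_mull //.
suff -> : take_poly r g = 0 by [].
apply/polyP => k; rewrite coef_take_poly coef0; by case: ltnP => // /g0.
Qed.

End Shift.

Lemma cancel_unit_fraction (F : fieldType) (u b x y : F) :
  u != 0 -> b != 0 -> x * y / b = u * y * (x / (u * b)).
Proof. by move=> u0 b0; field; rewrite u0 b0. Qed.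

(** * Order of contact as divisibility by a power of t *)

Section Contact.

Variables (K : fieldType) (n : nat).
Implicit Types (f : {mpoly K[n.+1]}) (p q : 'rV[K]_n.+1).

(** If t^r divides g, then 1, t, ..., t^(r-1) are independent modulo g. Otherwise g = u t^s with
    u(0) != 0 and s < r, and the quotient is determined by s coefficients, too few for r independent
    elements. *)
Lemma contact_order_geP f p q r :
  contact_order_ge f p q r <-> 'X^r %| restrict_to_line f p q.
Proof.
set g := restrict_to_line f p q.
have b0 (b : {poly K}) : b.[0] != 0 -> tofrac b != 0.
  by rewrite tofrac_eq0; apply: contraNneq => ->; rewrite horner0.
split=> [[e [eloc eind]]|/dvdpP[h eg]].
  apply: contraT => ndvd.
  have g0 : g != 0 by apply: contraNneq ndvd => ->; apply: dvdp0.
  have [s [u]] := multiplicity_XsubC g 0; rewrite g0 /= subr0 => u0 egs.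
  have sr : (s < r)%N.
    by rewrite ltnNge; apply: contra ndvd => rs; rewrite egs dvdp_mull // dvdp_exp2l.
  have [ab abP] : exists ab : 'I_r -> {poly K} * {poly K}, forall i,
      (ab i).2.[0] != 0 /\ e i = tofrac (ab i).1 / tofrac (ab i).2.
    have H i : exists ab : {poly K} * {poly K}, ab.2.[0] != 0 /\ e i = tofrac ab.1 / tofrac ab.2.
      by have [a [b ab]] := eloc i; exists (a, b).
    exists (fun i => projT1 (constructive_indefinite_description _ (H i))) => i.
    by case: constructive_indefinite_description.
  pose b := \prod_i (ab i).2; pose A i := (ab i).1 * \prod_(j | j != i) (ab j).2.
  have bnz : b.[0] != 0.
    by rewrite horner_prod; apply/prodf_neq0 => i _; have [] := abP i.
  have eA i : e i = tofrac (A i) / tofrac b.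
    have [bi ->] := abP i; rewrite /A /b (bigD1 (P := xpredT) i) //= !rmorphM /= -mulf_div divff ?mulr1 //.
    rewrite tofrac_eq0; apply/prodf_neq0 => j _; rewrite -tofrac_eq0.
    by apply: b0; have [] := abP j.
  (* The s lowest coefficients of the numerators over a common denominator. There are more rows than
     columns, so a combination c makes the numerator divisible by t^s. *)
  pose N : 'M[K]_(r, s) := \matrix_(i, k) (A i)`_k.
  have /rowV0Pn[c /sub_kermxP cN c0] : kermx N != 0.
    by rewrite -mxrank_eq0 mxrank_ker -lt0n subn_gt0 (leq_ltn_trans (rank_leq_col _)).
  have /dvdpP[T eT] : 'X^s %| \sum_i c ord0 i *: A i.
    apply/dvdXnP => k ks; rewrite coef_sum.
    have /rowP/(_ (Ordinal ks)) := cN; rewrite !mxE => h; apply: etrans h.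
    by apply: eq_bigr => i _; rewrite coefZ mxE.
  have ub : (u * b).[0] != 0 by rewrite hornerM mulf_neq0.
  case/eqP: c0; apply/rowP => i; rewrite mxE; apply: (eind (fun i => c ord0 i)).
  exists (tofrac T / tofrac (u * b)); first by exists T, (u * b).
  transitivity (tofrac (\sum_i c ord0 i *: A i) / tofrac b).
    rewrite rmorph_sum mulr_suml; apply: eq_bigr => k _.
    by rewrite eA -mul_polyC (rmorphM _ (c ord0 k)%:P (A k)) mulrA.
  have unz : tofrac u != 0 by apply: b0; rewrite -rootE.
  have := b0 b bnz; rewrite -/g eT egs !rmorphM /=; move: unz.
  move: (tofrac u) (tofrac b) (tofrac T) (tofrac ('X^s : {poly K})) => u' b' T' x' u'0 b'0.
  exact: (cancel_unit_fraction T' x' u'0 b'0).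
exists (fun i => tofrac 'X^i); split=> [i|c [y [a [b [bnz ->]]]]].
  by exists 'X^i, 1; rewrite hornerC oner_eq0 rmorph1 divr1.
rewrite -/g => e i; pose S := \sum_(i < r) c i *: 'X^i.
have eS : S * b = g * a.
  apply/eqP; rewrite -(tofrac_eq (S * b)) !rmorphM /=; apply/eqP.
  have bz := b0 b bnz; apply: (mulIf (invr_neq0 bz)); rewrite mulfK // -mulrA -e.
  rewrite /S rmorph_sum; apply: eq_bigr => k _.
  by rewrite -mul_polyC rmorphM.
have Sdvd : 'X^r %| S.
  rewrite -(@Gauss_dvdpl _ _ b); last first.
    by rewrite coprimep_sym coprimep_expr // coprimepX /root bnz.
  by rewrite eS eg -mulrA mulrCA dvdp_mulIl.
have /polyP/(_ i) : S = 0.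
  apply/polyP => k; rewrite coef0; have [kr|rk] := ltnP k r.
    by move/dvdXnP: Sdvd; apply.
  rewrite coef_sum big1 // => l _; rewrite coefZ coefXn gtn_eqF ?mulr0 //.
  exact: leq_trans (ltn_ord l) rk.
rewrite coef0 coef_sum (bigD1 i) //= coefZ coefXn eqxx mulr1 big1 ?addr0 // => l li.
by rewrite coefZ coefXn eq_sym (inj_eq val_inj) (negPf li) mulr0.
Qed.

End Contact.

(** * Resultants with a linear form *)

Lemma meval_linear (R : comNzRingType) n (l : {mpoly R[n]}) (u v : 'I_n -> R) t :
  l \is 1.-homog -> l.@[fun i => u i + t * v i] = l.@[u] + t * l.@[v].
Proof.
move=> hl; rewrite [l]mpolyE !raddf_sum mulr_sumr -big_split /= big_seq [RHS]big_seq.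
apply: eq_bigr => a al; rewrite !mevalZ.
have /eqP/mdeg1P[i /eqP ->] := dhomog_mf hl al.
by rewrite !mevalXU; ring.
Qed.

Section Pencil.

Variables (K : closedFieldType) (m : nat) (d : 'I_m -> nat) (i0 : 'I_m).
Hypothesis charK0 : [pchar K] =i pred0.
Hypothesis d_gt0 : forall i, (0 < d i)%N.

Definition replace_form (R : comNzRingType) (G : 'I_m -> {mpoly R[m]}) (L : {mpoly R[m]}) i :=
  if i == i0 then L else G i.

Lemma map_replace_form (R S : comNzRingType) (phi : {rmorphism R -> S}) G L i :
  map_mpoly phi (replace_form G L i) =
  replace_form (fun i => map_mpoly phi (G i)) (map_mpoly phi L) i.
Proof. by rewrite /replace_form; case: eqP. Qed.

Lemma eq_resultant (R : comNzRingType) (G G' : 'I_m -> {mpoly R[m]}) :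
  G =1 G' -> Defs.resultant d G = Defs.resultant d G'.
Proof.
move=> GG'; rewrite /Defs.resultant !specializeE.
have e : coef_eval (fun c : coef_index d => (G (coef_form c))@_(coef_mon c)) =1
         coef_eval (fun c : coef_index d => (G' (coef_form c))@_(coef_mon c)).
  by apply: coef_ring_ext => c; rewrite /= !coef_evalX GG'.
exact: e.
Qed.

Local Notation e := (\prod_(i | i != i0) d i)%N.

(** Homogeneity of degree e in the coefficients of the form i0 bounds the degree in t and makes the
    value at L' the coefficient of t^e. *)
Lemma pencil_resultant (G : 'I_m -> {mpoly K[m]}) (L L' : {mpoly K[m]}) :
  exists r : {poly K}, [/\ (size r <= e.+1)%N,
    r`_e = Defs.resultant d (replace_form G L')
    & forall t, r.[t] = Defs.resultant d (replace_form G (L + t *: L'))].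
Proof.
pose Gs := replace_form (fun i => map_mpoly polyC (G i))
                        (map_mpoly polyC L + 'X *: map_mpoly polyC L').
have hP := generic_resultant_homog i0 charK0 d_gt0.
pose h (j : 'I_#|coef_index d|) := let c := enum_val j in (Gs (coef_form c))@_(coef_mon c).
have hE j : h j = if form_weight i0 j == 1%N
    then (L@_(coef_mon (enum_val j)))%:P + 'X * (L'@_(coef_mon (enum_val j)))%:P
    else ((G (coef_form (enum_val j)))@_(coef_mon (enum_val j)))%:P.
  rewrite /h /Gs /replace_form /form_weight; case: eqP => _ /=.
    by rewrite mcoeffD mcoeffZ !mcoeff_map_mpoly.
  by rewrite mcoeff_map_mpoly.
have size_h j : (size (h j) <= (form_weight i0 j).+1)%N.
  rewrite hE /form_weight; case: (_ == i0) => /=; last exact: size_polyC_leq1.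
  rewrite (leq_trans (size_polyD _ _)) // geq_max.
  rewrite (leq_trans (size_polyC_leq1 _)) //= mulrC mul_polyC.
  by rewrite (leq_trans (size_scale_leq _ _)) // size_polyX.
have wP a : a \in msupp (generic_resultant d) -> (weight (form_weight i0) a <= e)%N.
  by move=> aP; rewrite (dhomog_mf hP aP).
have rE : Defs.resultant d Gs = mmap (polyC \o intmul (1 : K)) h (generic_resultant d).
  by apply: eq_mmap => // z /=; rewrite rmorph_int.
exists (Defs.resultant d Gs); split.
- by rewrite rE; apply: size_mmap_weight size_h _ _ wP.
- rewrite rE (coef_mmap_weight (intmul (1 : K)) size_h wP) pihomog_dE //.
  apply: eq_mmap => // j; rewrite hE /form_weight /replace_form.
  case: (_ == i0) => /=; last by rewrite coefC.
  by rewrite coefD coefC coefXM coefC add0r.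
- move=> t; rewrite -/(horner_eval t _) resultant_map; apply: eq_resultant => i.
  rewrite map_replace_form /replace_form; case: eqP => _; last first.
    by apply/mpolyP => a; rewrite !mcoeff_map_mpoly /= /horner_eval hornerC.
  apply/mpolyP => a; rewrite mcoeff_map_mpoly !mcoeffD !mcoeffZ !mcoeff_map_mpoly /=.
  by rewrite /horner_eval hornerD hornerM hornerX !hornerC.
Qed.

(* On the pencil L + t L' the resultant is a polynomial in t of degree e, and *)
(* its only root is the t for which L + t L' vanishes at x.                   *)
Lemma resultant_linear_power (G : 'I_m -> {mpoly K[m]}) (x : 'I_m -> K) :
  d i0 = 1%N ->
  (forall L, L \is 1.-homog ->
     Defs.resultant d (replace_form G L) = 0 <-> L.@[x] = 0) ->
  forall L L', L \is 1.-homog -> L' \is 1.-homog ->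
  Defs.resultant d (replace_form G L) * L'.@[x] ^+ e =
  Defs.resultant d (replace_form G L') * L.@[x] ^+ e.
Proof.
move=> d1 Gx L L' hL hL'.
have e_gt0 : (0 < e)%N by rewrite prodn_gt0.
have [L'x|L'x] := eqVneq L'.@[x] 0.
  have /Gx r0 := L'x; rewrite r0 // L'x mul0r expr0n eqn0Ngt e_gt0 mulr0 //.
have [r [sr re rt]] := pencil_resultant G L L'.
have r'0 : Defs.resultant d (replace_form G L') != 0.
  by apply: contraNneq L'x => /Gx ->.
(* The coefficient of t^e is the resultant at L', which is nonzero, so the degree is exactly e. *)
have sre : (size r).-1 = e.
  apply/eqP; rewrite eqn_leq; have := r'0; rewrite -re => nz.
  have rnz : r != 0 by apply: contraNneq nz => ->; rewrite coef0.
  rewrite -ltnS prednK ?size_poly_gt0 // sr /= -ltnS prednK ?size_poly_gt0 //.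
  by rewrite ltnNge; apply: contra nz => le; rewrite nth_default.
have lr : lead_coef r = Defs.resultant d (replace_form G L') by rewrite lead_coefE sre.
pose t0 := - (L.@[x] / L'.@[x]).
have [rs ers] := closed_field_poly_normal r.
have lrnz : lead_coef r != 0 by rewrite lr.
have rs0 : all (pred1 t0) rs.
  apply/allP => z zrs /=; have rz : r.[z] = 0.
    by rewrite ers hornerZ; apply/eqP; rewrite mulf_eq0 -rootE root_prod_XsubC zrs orbT.
  move: rz; rewrite rt; move/Gx; rewrite rpredD ?dhomogZ // => /(_ isT).
  rewrite mevalD mevalZ => /eqP; rewrite addrC addr_eq0 => /eqP h.
  by rewrite /t0 -mulNr -h mulfK.
have srs : size rs = e.
  rewrite -sre {1}ers size_scale // size_prod_XsubC //.
have r0 : r.[0] = Defs.resultant d (replace_form G L') * (L.@[x] / L'.@[x]) ^+ e.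
  rewrite ers hornerZ lr; congr (_ * _); rewrite horner_prod big_seq.
  rewrite (eq_bigr (fun=> L.@[x] / L'.@[x])) => [|z zr]; last first.
    by rewrite hornerXsubC (eqP (allP rs0 z zr)) sub0r opprK.
  by rewrite -big_seq big_const_seq count_predT srs iter_mulr_1.
have -> : Defs.resultant d (replace_form G L) = r.[0] by rewrite rt scale0r addr0.
rewrite r0 expr_div_n -!mulrA; congr (_ * _).
by rewrite mulVf ?mulr1 // expf_neq0.
Qed.

End Pencil.

Section Multihomogeneous.

Variables (K : closedFieldType) (m : nat) (d : 'I_m -> nat).
Hypothesis charK0 : [pchar K] =i pred0.
Hypothesis d_gt0 : forall i, (0 < d i)%N.

Local Notation e i := (\prod_(j | j != i) d j)%N.

Lemma generic_resultant_fiber a i : a \in msupp (generic_resultant d) ->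
  (\sum_(j | coef_form (enum_val j) == i) a j)%N = e i.
Proof.
move=> aP; have hP := generic_resultant_homog i charK0 d_gt0.
rewrite -(dhomog_mf hP aP) /= /weight [LHS]big_mkcond; apply: eq_bigr => j _.
by rewrite /form_weight; case: eqP; rewrite ?muln1 ?muln0.
Qed.

Lemma resultant_scale (S : comNzRingType) (lam : 'I_m -> S) (G : 'I_m -> {mpoly S[m]}) :
  Defs.resultant d (fun i => lam i *: G i) = (\prod_i lam i ^+ e i) * Defs.resultant d G.
Proof.
rewrite /Defs.resultant /specialize /mmap mulr_sumr big_seq [RHS]big_seq.
apply: eq_bigr => a aP; rewrite mulrCA; congr (_ * _); rewrite /mmap1.
rewrite (eq_bigr (fun j => lam (coef_form (enum_val j)) ^+ a j *
   (G (coef_form (enum_val j)))@_(coef_mon (enum_val j)) ^+ a j)); last first.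
  by move=> j _; rewrite -exprMn -mcoeffZ.
rewrite big_split /=; congr (_ * _).
rewrite (partition_big (fun j => coef_form (enum_val j)) xpredT) //=.
apply: eq_bigr => i _; rewrite -(generic_resultant_fiber i aP) -prodrXr.
by apply: eq_bigr => j /eqP ->.
Qed.

(** Every monomial of the generic resultant contains exactly e i coefficients of the i-th form, each
    contributing degree w i. *)
Lemma resultant_coef_homog (R : comNzRingType) N (w : 'I_m -> nat)
    (G : 'I_m -> {mpoly {mpoly R[N]}[m]}) :
  (forall i a, (G i)@_a \is (w i).-homog) ->
  Defs.resultant d G \is (\sum_i w i * e i).-homog.
Proof.
move=> hG; rewrite /Defs.resultant /specialize /mmap big_seq; apply: rpred_sum => a aP.
rewrite -[_%:~R](rmorph_int (@mpolyC N R)) mul_mpolyC dhomogZ // /mmap1.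
have -> : (\sum_i w i * e i = \sum_j w (coef_form (enum_val j)) * a j)%N.
  rewrite [RHS](partition_big (fun j => coef_form (enum_val j)) xpredT) //=.
  apply: eq_bigr => i _; rewrite -(generic_resultant_fiber i aP) big_distrr.
  by apply: eq_bigr => j /eqP ->.
by apply: dhomog_prodr => j; apply: dhomogMn; apply: hG.
Qed.

End Multihomogeneous.

(** * Regular sequences of linear forms *)

Section EqMod.

Variables (R : comNzRingType) (n : nat) (f : {mpoly R[n]}).
Implicit Types p q : {mpoly R[n]}.

Lemma eq_mod_refl p : eq_mod f p p.
Proof. by exists 0; rewrite mul0r subrr. Qed.

Lemma eq_mod_sym p q : eq_mod f p q -> eq_mod f q p.
Proof. by move=> [h e]; exists (- h); rewrite mulNr -e opprB. Qed.

Lemma eq_mod_trans p q r : eq_mod f p q -> eq_mod f q r -> eq_mod f p r.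
Proof. by move=> [h e] [k e']; exists (h + k); rewrite mulrDl -e -e' addrA subrK. Qed.

Lemma eq_modD p q p' q' : eq_mod f p q -> eq_mod f p' q' -> eq_mod f (p + p') (q + q').
Proof. by move=> [h e] [k e']; exists (h + k); rewrite mulrDl -e -e'; ring. Qed.

Lemma eq_modM p q p' q' : eq_mod f p q -> eq_mod f p' q' -> eq_mod f (p * p') (q * q').
Proof.
move=> [h e] [k e']; exists (h * p' + q * k).
by rewrite mulrDl -[q * k * f]mulrA -e' mulrAC -e; ring.
Qed.

Lemma eq_mod_resultant m (d : 'I_m -> nat) (G G' : 'I_m -> {mpoly {mpoly R[n]}[m]}) :
  (forall i a, eq_mod f (G i)@_a (G' i)@_a) ->
  eq_mod f (Defs.resultant d G) (Defs.resultant d G').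
Proof.
move=> GG'; rewrite /Defs.resultant /specialize /mmap.
elim: (msupp _) => [|a s IH]; first by rewrite !big_nil; apply: eq_mod_refl.
rewrite !big_cons; apply: eq_modD => //; apply: eq_modM; first exact: eq_mod_refl.
rewrite /mmap1; elim: (index_enum _) => [|j t IHt]; first by rewrite !big_nil; apply: eq_mod_refl.
rewrite !big_cons; apply: eq_modM => //.
elim: (a j) => [|k IHk]; first by rewrite !expr0; apply: eq_mod_refl.
by rewrite !exprS; apply: eq_modM.
Qed.

End EqMod.

(** Two distinct variables form a regular sequence: each monomial of p, once multiplied by X_k^N,
    occurs in a multiple of X_j^N, and X_k^N does not contribute to the exponent of X_j. *)
Lemma divides_monomial (R : idomainType) n (j k : 'I_n) N (p q : {mpoly R[n]}) :
  j != k -> 'X_k ^+ N * p = 'X_j ^+ N * q -> exists r, p = 'X_j ^+ N * r.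
Proof.
move=> jk e; exists (\sum_(a <- msupp p) p@_a *: 'X_[a - U_(j) *+ N]).
rewrite {1}[p]mpolyE mulr_sumr big_seq [RHS]big_seq; apply: eq_bigr => a ap.
rewrite mpolyXn -scalerAr -mpolyXD addmC submK //.
apply/mnm_lepP => i; rewrite mulmnE mnm1E; case: eqP => [<-|_]; last by rewrite mul0n.
rewrite mul1n; have := ap; rewrite mcoeff_msupp -(mcoeffMX p (U_(k) *+ N)%MM) -mpolyXn.
rewrite mulrC e mulrC mpolyXn -mcoeff_msupp => /msuppM_le/allpairsP[[b c] /= [_]].
rewrite msuppX inE => /eqP -> /(congr1 (fun u : 'X_{1..n} => u j)).
rewrite !mnmDE !mulmnE !mnm1E eqxx [k == j]eq_sym (negPf jk) mul0n mul1n add0n => ->.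
exact: leq_addl.
Qed.

Section RegularSequence.

Variables (B : idomainType) (F : {poly B}) (x y : B) (N : nat).
Hypothesis F_monic : F \is monic.
Hypothesis x0 : x != 0.

Lemma small_multiple_eq0 (h r : {poly B}) : (size r < size F)%N -> r = h * F -> r = 0.
Proof.
move=> sr e; have [h0|h0] := eqVneq h 0; first by rewrite e h0 mul0r.
move: sr; rewrite e size_Mmonic // -ltnS prednK; last first.
  by rewrite addn_gt0 size_poly_gt0 h0.
by move: h0; rewrite -size_poly_gt0 ltnS; case: (size h) => // k _; rewrite addSn ltnNge leq_addl.
Qed.

Let divE (p : {poly B}) := Pdiv.RingMonic.rdivp_eq F_monic p.

Let size_rem (p : {poly B}) : (size (Pdiv.Ring.rmodp p F) < size F)%N.
Proof. by rewrite Pdiv.Ring.ltn_rmodp monic_neq0. Qed.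

(** Modulo the monic F every class has a unique remainder, and multiplication by a constant acts on
    remainders coefficient by coefficient. *)
Lemma monic_nonzerodivisor (p h : {poly B}) : x%:P ^+ N * p = h * F -> exists h', p = h' * F.
Proof.
move=> e; set r := Pdiv.Ring.rmodp p F; set q := Pdiv.Ring.rdivp p F.
suff r0 : r = 0 by exists q; rewrite {1}(divE p) -/r r0 addr0.
have /eqP : x%:P ^+ N * r = 0.
  apply: (@small_multiple_eq0 (h - x%:P ^+ N * q)).
    rewrite -polyC_exp mul_polyC (leq_ltn_trans (size_scale_leq _ _)) //.
    exact: size_rem.
  have -> : r = p - q * F by rewrite [in RHS](divE p) addrC addKr.
  by rewrite mulrBr e; ring.
by rewrite mulf_eq0 expf_eq0 polyC_eq0 (negPf x0) andbF /= => /eqP.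
Qed.

(** The relation holds exactly between the remainders, hence between their coefficients in B, where
    [reg] divides by x^N. *)
Lemma monic_regular (p q h : {poly B}) :
  (forall a b, y ^+ N * a = x ^+ N * b -> exists c, a = x ^+ N * c) ->
  y%:P ^+ N * p - x%:P ^+ N * q = h * F ->
  exists r h', p - x%:P ^+ N * r = h' * F.
Proof.
move=> reg e; set r := Pdiv.Ring.rmodp p F; set u := Pdiv.Ring.rdivp p F.
set s := Pdiv.Ring.rmodp q F; set v := Pdiv.Ring.rdivp q F.
have rs : y%:P ^+ N * r - x%:P ^+ N * s = 0.
  apply: (@small_multiple_eq0 (h - y%:P ^+ N * u + x%:P ^+ N * v)).
    rewrite -!polyC_exp !mul_polyC (leq_ltn_trans (size_polyD _ _)) // gtn_max size_polyN.
    by rewrite !(leq_ltn_trans (size_scale_leq _ _)) // size_rem.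
  have -> : r = p - u * F by rewrite [in RHS](divE p) addrC addKr.
  have -> : s = q - v * F by rewrite [in RHS](divE q) addrC addKr.
  by rewrite mulrDl mulrBl -e; ring.
have H k : exists c, r`_k = x ^+ N * c.
  apply: (reg _ s`_k); move/eqP: rs; rewrite subr_eq0 => /eqP/(congr1 (fun w : {poly B} => w`_k)).
  by rewrite -!polyC_exp !coefCM.
have [c cE] : exists c : nat -> B, forall k, r`_k = x ^+ N * c k.
  exists (fun k => projT1 (constructive_indefinite_description _ (H k))) => k.
  by case: constructive_indefinite_description.
exists (\poly_(k < size r) c k), u.
suff <- : r = x%:P ^+ N * \poly_(k < size r) c k.
  by rewrite {1}(divE p) -/r -/u addrK.
apply/polyP => k; rewrite -polyC_exp coefCM coef_poly; case: ltnP => [_|sr]; first exact: cE.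
by rewrite nth_default // mulr0.
Qed.

End RegularSequence.

Lemma regular_transport (S : comNzRingType) (B : idomainType)
    (G : {rmorphism S -> {poly B}}) (G' : {rmorphism {poly B} -> S})
    (f l1 l2 : S) (c c' x y : B) :
  cancel G G' -> cancel G' G -> c * c' = 1 -> c'%:P * G f \is monic ->
  G l1 = x%:P -> G l2 = y%:P -> x != 0 ->
  (forall N a b, y ^+ N * a = x ^+ N * b -> exists e, a = x ^+ N * e) ->
  (forall N p, (exists h, l1 ^+ N * p = h * f) -> exists h, p = h * f) /\
  (forall N p q, (exists h, l2 ^+ N * p - l1 ^+ N * q = h * f) ->
     exists r h, p - l1 ^+ N * r = h * f).
Proof.
move=> GK G'K cc' Fm Gl1 Gl2 x0 reg; set F := c'%:P * G f in Fm.
have GF : G f = c%:P * F by rewrite /F mulrA -polyCM cc' mul1r.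
have G'F h : G' (h * F) = G' (h * c'%:P) * f by rewrite /F mulrA rmorphM GK.
split=> [N p [h e]|N p q [h e]].
  have [|h' e'] := @monic_nonzerodivisor _ F x N Fm x0 (G p) (G h * c%:P).
    by rewrite -mulrA -GF -Gl1 -rmorphXn -!rmorphM e.
  by exists (G' (h' * c'%:P)); rewrite -G'F -e' GK.
have [|r [h' e']] := @monic_regular _ F x y N Fm (G p) (G q) (G h * c%:P) (reg N).
  by rewrite -mulrA -GF -Gl1 -Gl2 -!rmorphXn -!rmorphM -rmorphB e.
exists (G' r), (G' (h' * c'%:P)); rewrite -G'F -e' rmorphB rmorphM rmorphXn /= GK.
by rewrite -Gl1 GK.
Qed.

Section Gluing.

Variables (K : fieldType) (n d : nat) (f : {mpoly K[n.+1]}).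
Hypothesis charK0 : [pchar K] =i pred0.
Hypothesis n_gt1 : (1 < n)%N.
Hypothesis d_gt0 : (0 < d)%N.
Hypothesis f_homog : f \is d.-homog.
Hypothesis f_neq0 : f != 0.

Lemma nonvanishing_point : exists (i : 'I_n.+1) (q : 'I_n.+1 -> K), q i = 1 /\ f.@[q] != 0.
Proof.
have [q fq] : exists q, f.@[q] != 0.
  apply: NNPP => nq; case/eqP: f_neq0; apply: (mpoly_eval_eq0 charK0) => y.
  by apply/eqP; apply: contraT => fy; case: nq; exists y.
have [i qi] : exists i, q i != 0.
  apply: NNPP => nq; case/eqP: fq; have q0 i : q i = 0 * q i.
    by rewrite mul0r; apply/eqP; apply: contraT => qi; case: nq; exists i.
  by rewrite (meval_eq _ q0) (meval_scale _ _ f_homog) expr0n eqn0Ngt d_gt0 mul0r.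
exists i, (fun j => (q i)^-1 * q j); split; first by rewrite mulVf.
by rewrite (meval_scale _ _ f_homog) mulf_neq0 // expf_neq0 // invr_neq0.
Qed.

Lemma mmap_linear_homog (h : 'I_n.+1 -> {mpoly K[n.+1]}) k (p : {mpoly K[n.+1]}) :
  (forall i, h i \is 1.-homog) -> p \is k.-homog -> mmap (@mpolyC n.+1 K) h p \is k.-homog.
Proof.
move=> hh hp; rewrite /mmap big_seq; apply: rpred_sum => a ap.
rewrite mul_mpolyC dhomogZ // -(dhomog_mf hp ap) /= mdegE /mmap1.
apply: dhomog_prodr => i; rewrite -[X in X.-homog]mul1n; exact: dhomogMn.
Qed.

(* Two linear forms vanishing at a point off the hypersurface form a regular  *)
(* sequence modulo f: after a shear f is monic in the remaining variable.     *)
Lemma regular_linear_forms : exists l1 l2 : {mpoly K[n.+1]},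
  [/\ l1 \is 1.-homog, l2 \is 1.-homog,
    forall N p, (exists h, l1 ^+ N * p = h * f) -> exists h, p = h * f
    & forall N p q, eq_mod f (l2 ^+ N * p) (l1 ^+ N * q) ->
        exists r, eq_mod f p (l1 ^+ N * r)].
Proof.
have [i [q [qi fq]]] := nonvanishing_point.
(* For c = 1 this shear sends the i-th coordinate point to q, so that x_i^d gets the coefficient
   f(q) != 0 in the sheared f; -c gives the inverse shear. *)
pose sh (c : K) (k : 'I_n.+1) : {mpoly K[n.+1]} :=
  if k == i then 'X_i else 'X_k + (c * q k) *: 'X_i.
pose phi c : {rmorphism {mpoly K[n.+1]} -> {mpoly K[n.+1]}} := mmap (@mpolyC n.+1 K) (sh c).
have phiX c k : phi c 'X_k = sh c k by rewrite /phi /= mmapX mmap1U.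
have phiC c a : phi c a%:MP = a%:MP by rewrite /phi /= mmapC.
have phiK c : cancel (phi c) (phi (- c)).
  apply: (@eq_mpoly_rmorphism _ _ _ (phi (- c) \o phi c) idfun) => [a|k] /=.
    by rewrite !phiC.
  rewrite phiX /sh; case: eqP => [->|/eqP ki]; first by rewrite phiX /sh eqxx.
  rewrite rmorphD -mul_mpolyC rmorphM /= phiC !phiX /sh (negPf ki) eqxx mul_mpolyC.
  by rewrite -addrA -scalerDl mulNr addNr scale0r addr0.
have sh_homog c k : sh c k \is 1.-homog.
  by rewrite /sh; case: eqP => _; rewrite ?rpredD ?dhomogZ // dhomogX /= mdeg1.
have phif_homog : phi 1 f \is d.-homog by apply: mmap_linear_homog.
have [sF cF] := isolate_top i phif_homog.
have phif_q : (phi 1 f).@[fun k => (k == i)%:R] = f.@[q].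
  rewrite /phi /= rmorph_mmap; apply: eq_mmap => [a|k] /=; first exact: mevalC.
  rewrite /sh; case: eqP => [->|/eqP ki]; first by rewrite mevalXU eqxx.
  by rewrite mevalD mevalZ !mevalXU eqxx (negPf ki) add0r mul1r mulr1.
rewrite phif_q in cF.
pose k1 : 'I_n := Ordinal (ltnW n_gt1); pose k2 : 'I_n := Ordinal n_gt1.
(* These linear forms vanish at q, and the shear turns them into variables other than x_i; n > 1
   supplies two of them. *)
pose l k := phi (-1) 'X_(lift i k).
have l_homog k : l k \is 1.-homog by rewrite /l phiX.
pose G : {rmorphism {mpoly K[n.+1]} -> {poly {mpoly K[n]}}} := isolate i \o phi 1.
pose G' : {rmorphism {poly {mpoly K[n]}} -> {mpoly K[n.+1]}} := phi (-1) \o unisolate i.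
have GK : cancel G G' by move=> p; rewrite /G /G' /= isolateK phiK.
have phiK' : cancel (phi (-1)) (phi 1) by have := phiK (-1); rewrite opprK.
have G'K : cancel G' G by move=> p; rewrite /G /G' /= phiK' unisolateK.
have Gl k : G (l k) = ('X_k)%:P by rewrite /G /l /= phiK' isolate_lift.
have Fm : (f.@[q]^-1)%:MP%:P * G f \is monic.
  rewrite monicE mul_polyC; apply/eqP; set F := G f.
  have cFd : ((f.@[q]^-1)%:MP *: F)`_d = 1 by rewrite coefZ cF -mpolyCM mulVf ?mpolyC1.
  have sFd : (size ((f.@[q]^-1)%:MP *: F) <= d.+1)%N.
    by rewrite (leq_trans (size_scale_leq _ _)).
  rewrite lead_coefE -[RHS]cFd; congr (_`_ _); apply/eqP; rewrite eqn_leq.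
  have dlt : (d < size ((f.@[q]^-1)%:MP *: F))%N.
    by rewrite ltnNge; apply/negP => /leq_sizeP/(_ d (leqnn d)) /eqP; rewrite cFd oner_eq0.
  by move: dlt sFd; case: (size _) => // s; rewrite /= !ltnS => -> ->.
have x0 : 'X_k1 != 0 :> {mpoly K[n]} by rewrite -msupp_eq0 msuppX.
have [||H1 H2] := @regular_transport _ _ G G' f (l k1) (l k2) (f.@[q])%:MP (f.@[q]^-1)%:MP
  'X_k1 'X_k2 GK G'K _ Fm (Gl k1) (Gl k2) x0 _.
- by rewrite -mpolyCM mulfV // mpolyC1.
- by move=> N a b; apply: divides_monomial.
by exists (l k1), (l k2); split.
Qed.

End Gluing.

(** * The flex polynomial *)

Section FlexDegrees.

Variable n : nat.

Lemma flex_degrees_gt0 (i : 'I_n.+1) : (0 < flex_degrees i)%N.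
Proof. by rewrite /flex_degrees; case: ifP. Qed.

Lemma prod_flex_degrees : (\prod_(i < n.+1) flex_degrees i = n`!)%N.
Proof.
rewrite big_ord_recr /= /flex_degrees /= ltnn muln1 fact_prod big_add1 big_mkord.
by apply: eq_bigr => i _; rewrite /= ltn_ord.
Qed.

Lemma flex_degrees_cofactor (i : 'I_n.+1) :
  (flex_degrees i * \prod_(j | j != i) flex_degrees j = n`!)%N.
Proof. by rewrite -prod_flex_degrees [RHS](bigD1 i). Qed.

Lemma flex_degrees_max : flex_degrees (ord_max : 'I_n.+1) = 1%N.
Proof. by rewrite /flex_degrees ltnn. Qed.

Lemma prod_flex_degrees_max :
  (\prod_(j < n.+1 | j != ord_max) flex_degrees j = n`!)%N.
Proof. by have := flex_degrees_cofactor ord_max; rewrite flex_degrees_max mul1n. Qed.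

End FlexDegrees.

Section Tangents.

Variables (K : closedFieldType) (n d : nat).
Hypothesis charK0 : [pchar K] =i pred0.
Variables (f : {mpoly K[n.+1]}) (x : 'I_n.+1 -> K).
Hypothesis f_homog : f \is d.-homog.
Hypothesis fx0 : f.@[x] = 0.
Hypothesis x_neq0 : exists j, x j != 0.

Definition flex_forms_at L :=
  replace_form ord_max (fun i : 'I_n.+1 => map_mpoly (meval x) (polar f i.+1)) L.

Definition flex_direction y :=
  (forall c, exists j, y j != c * x j) /\ 'X^(n.+1) %| line_poly f x y.

Lemma flex_forms_at_homog L : L \is 1.-homog ->
  forall i, flex_forms_at L i \is (@flex_degrees n i).-homog.
Proof.
move=> hL i; rewrite /flex_forms_at /replace_form; case: eqP => [->|/eqP ni].
  by rewrite flex_degrees_max.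
have -> : flex_degrees i = i.+1; last exact: polar_homog f_homog.
by rewrite /flex_degrees ifT // ltn_neqAle -ltnS ltn_ord andbT; move: ni; rewrite -val_eqE.
Qed.

Lemma flex_forms_at_eq0 L y :
  (forall i, (flex_forms_at L i).@[y] = 0) <-> L.@[y] = 0 /\ 'X^(n.+1) %| line_poly f x y.
Proof.
split=> [F0|[Ly] /dvdXnP F0 i]; last first.
  rewrite /flex_forms_at /replace_form; case: eqP => // /eqP ni.
  rewrite eval_polar F0 ?mul0rn // ltnS ltn_neqAle -ltnS ltn_ord andbT.
  by move: ni; rewrite -val_eqE.
split; first by have := F0 ord_max; rewrite /flex_forms_at /replace_form eqxx.
(* The coefficient of t^0 is f(x) = 0; in the others the factorial is invertible in characteristic
   zero. *)
apply/dvdXnP => -[_|k]; first by rewrite line_poly0.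
rewrite ltnS => kn; have := F0 (Ordinal (ltnW kn : (k < n.+1)%N)).
rewrite /flex_forms_at /replace_form -val_eqE /= ltn_eqF // eval_polar.
move/eqP; rewrite -mulr_natr mulf_eq0 => /orP[/eqP //|].
have fE : (k.+1`!)%:R != 0 :> K.
  rewrite -[0]/(0%:R); apply/eqP => /(natr_inj_pchar0 charK0)/eqP.
  by rewrite eqn0Ngt fact_gt0.
by rewrite (negPf fE).
Qed.

Lemma flex_resultant_at_eq0 L : L \is 1.-homog ->
  Defs.resultant (@flex_degrees n) (flex_forms_at L) = 0 <->
  exists y, [/\ exists j, y j != 0, L.@[y] = 0 & 'X^(n.+1) %| line_poly f x y].
Proof.
move=> hL; have hG := flex_forms_at_homog hL.
apply: (iff_trans (resultant_eq0P ord_max (@flex_degrees_gt0 n) hG)).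
by split=> [[y [y0 /flex_forms_at_eq0[]]]|[y [y0 Ly ty]]];
  exists y; split=> //; apply/flex_forms_at_eq0.
Qed.

(** Here y = x is a common zero, since f(x + t x) = (1 + t)^d f(x) = 0. *)
Lemma flex_resultant_at_center L : L \is 1.-homog -> L.@[x] = 0 ->
  Defs.resultant (@flex_degrees n) (flex_forms_at L) = 0.
Proof.
move=> hL Lx; apply/flex_resultant_at_eq0 => //; exists x; split=> //.
exact: (line_poly_self charK0 _ f_homog fx0).
Qed.

(* A flex direction y can be moved along the line by a multiple of x to reach *)
(* the hyperplane L = 0.                                                      *)
Lemma flex_resultant_at_flex L : L \is 1.-homog -> L.@[x] != 0 ->
  Defs.resultant (@flex_degrees n) (flex_forms_at L) = 0 <-> exists y, flex_direction y.
Proof.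
move=> hL Lx; split=> [/(flex_resultant_at_eq0 hL)[y [[j yj] Ly ty]]|[y [yx ty]]].
  exists y; split=> // c; apply: NNPP => nj.
  have yE i : y i = 0 + c * x i.
    by rewrite add0r; apply/eqP; apply: contraT => yi; case: nj; exists i.
  move: Ly; rewrite (meval_eq _ yE) (meval_linear (fun=> 0) x c hL).
  have -> : L.@[fun=> 0] = 0.
    have e0 i : (fun=> 0 : K) i = 0 * x i by rewrite mul0r.
    by rewrite (meval_eq _ e0) (meval_scale _ _ hL) expr1 mul0r.
  move/eqP; rewrite add0r mulf_eq0 (negPf Lx) orbF => /eqP c0.
  by move: yj; rewrite yE c0 mul0r addr0 eqxx.
apply/flex_resultant_at_eq0 => //; pose al := - (L.@[y] / L.@[x]).
exists (fun i => y i + al * x i); split.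
- have [j yj] := yx (- al); exists j; apply: contraNneq yj => /eqP.
  by rewrite addr_eq0 -mulNr.
- by rewrite (meval_linear y x al hL) /al mulNr divfK // subrr.
- exact: (line_poly_shift charK0 _ f_homog ty).
Qed.

(** If x has a flex direction, both resultants vanish. Otherwise the resultant vanishes exactly when
    the linear form does at x, and [resultant_linear_power] applies. *)
Lemma flex_resultant_at_exchange L L' : L \is 1.-homog -> L' \is 1.-homog ->
  Defs.resultant (@flex_degrees n) (flex_forms_at L) * L'.@[x] ^+ n`! =
  Defs.resultant (@flex_degrees n) (flex_forms_at L') * L.@[x] ^+ n`!.
Proof.
move=> hL hL'; rewrite -prod_flex_degrees_max.
have [fl|nfl] := classic (exists y, flex_direction y); last first.
  apply: (resultant_linear_power charK0 (@flex_degrees_gt0 n) (flex_degrees_max n)) => // M hM.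
  split=> [M0|]; last exact: flex_resultant_at_center.
  apply/eqP; apply: contraT => Mx; case: nfl.
  exact/(flex_resultant_at_flex hM Mx).
suff R0 M : M \is 1.-homog -> Defs.resultant (@flex_degrees n) (flex_forms_at M) = 0.
  by rewrite !R0 // !mul0r.
move=> hM; have [Mx|Mx] := eqVneq M.@[x] 0; first exact: flex_resultant_at_center.
exact/(flex_resultant_at_flex hM Mx).
Qed.

End Tangents.

Lemma map_mpoly_combination (R S : comNzRingType) (phi : {rmorphism R -> S}) m
    (a b : R) (p q : {mpoly R[m]}) :
  map_mpoly phi (a *: p - b *: q) = phi a *: map_mpoly phi p - phi b *: map_mpoly phi q.
Proof.
apply/mpolyP => c; rewrite mcoeff_map_mpoly !mcoeffB !mcoeffZ !mcoeff_map_mpoly.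
by rewrite /= rmorphB !rmorphM.
Qed.

Lemma mcoeff_combination (R : comNzRingType) m (a b : R) (p q : {mpoly R[m]}) c :
  (a *: p - b *: q)@_c - (a *: p)@_c = - q@_c * b.
Proof. by rewrite mcoeffB !mcoeffZ; ring. Qed.

Lemma exchange_at (K : comNzRingType) n (A A' l l' : {mpoly K[n]}) (x : 'I_n -> K) a a' N :
  A.@[x] = a -> A'.@[x] = a' -> a * l'.@[x] ^+ N = a' * l.@[x] ^+ N ->
  (A * l' ^+ N - A' * l ^+ N).@[x] = 0.
Proof. by move=> <- <- e; rewrite mevalB !mevalM !rmorphXn /= e subrr. Qed.

Section FlexResultant.

Variables (K : closedFieldType) (n d : nat).
Hypothesis charK0 : [pchar K] =i pred0.
Implicit Types f g h l : {mpoly K[n.+1]}.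

Local Notation R := {mpoly K[n.+1]}.
Local Notation deg := (@flex_degrees n).

Lemma map_in_y (x : 'I_n.+1 -> K) l : map_mpoly (meval x) (in_y l) = l.
Proof. by apply/mpolyP => a; rewrite !mcoeff_map_mpoly /= mevalC. Qed.

Lemma flex_formsE f l :
  flex_forms f l =1 replace_form ord_max (fun i : 'I_n.+1 => polar f i.+1) (in_y l).
Proof.
move=> i; rewrite /flex_forms /replace_form; case: eqP => [->|/eqP ni]; first by rewrite ltnn.
by rewrite ifT // ltn_neqAle -ltnS ltn_ord andbT; move: ni; rewrite -val_eqE.
Qed.

(** Modulo f these are the flex forms with the n polars multiplied by h. *)
Definition wronskian_forms f h l : 'I_n.+1 -> {mpoly R[n.+1]} :=
  replace_form ord_max (fun i : 'I_n.+1 => h *: polar f i.+1 - f *: polar h i.+1) (in_y l).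

Lemma wronskian_forms_at f h l x :
  (fun i => map_mpoly (meval x) (wronskian_forms f h l i)) =1
  flex_forms_at (h.@[x] *: f - f.@[x] *: h) x l.
Proof.
move=> i; rewrite /wronskian_forms /flex_forms_at map_replace_form map_in_y /replace_form.
case: eqP => // _; rewrite polarB !polarZ !(map_mpoly_combination (meval x)).
by congr (_ *: _ - _ *: _); rewrite /= mevalC.
Qed.

(* At any x these are the flex forms of h(x) f - f(x) h, which vanishes at x  *)
(* whether or not f does: the exchange relation, known only on a hypersurface,*)
(* becomes an identity of polynomials.                                        *)
Lemma wronskian_exchange f h l l' :
  f \is d.-homog -> h \is d.-homog -> l \is 1.-homog -> l' \is 1.-homog ->
  Defs.resultant deg (wronskian_forms f h l) * l' ^+ n`! =
  Defs.resultant deg (wronskian_forms f h l') * l ^+ n`!.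
Proof.
move=> hf hh hl hl'; apply: subr0_eq; apply: (mpoly_eval_eq0 charK0) => x.
have RE m : (Defs.resultant deg (wronskian_forms f h m)).@[x] =
    Defs.resultant deg (flex_forms_at (h.@[x] *: f - f.@[x] *: h) x m).
  apply: etrans (resultant_map (meval x) deg _) _.
  exact: (eq_resultant deg (wronskian_forms_at f h m x)).
apply: (exchange_at (RE l) (RE l')).
have [x0|nx] := classic (exists j, x j != 0).
  apply: (@flex_resultant_at_exchange _ _ d) => //.
    by rewrite rpredB // dhomogZ.
  by rewrite mevalB !mevalZ mulrC subrr.
have l0 g : g \is 1.-homog -> g.@[x] = 0.
  move=> hg; have xE i : x i = 0 * x i.
    by rewrite mul0r; apply/eqP; apply: contraT => xi; case: nx; exists i.
  by rewrite (meval_eq _ xE) (meval_scale _ _ hg) expr1 mul0r.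
by rewrite (l0 l hl) (l0 l' hl') expr0n eqn0Ngt fact_gt0 !mulr0.
Qed.

(** E is the total degree of the resultant in the n polars, each of which contributes its factor h
    modulo f. *)
Lemma wronskian_forms_mod : exists E, forall f h l,
  eq_mod f (Defs.resultant deg (wronskian_forms f h l)) (h ^+ E * flex_resultant f l).
Proof.
pose e (i : 'I_n.+1) := (\prod_(j | j != i) deg j)%N.
exists (\sum_i if i == ord_max then 0 else e i)%N => f h l.
pose lam i := if i == ord_max :> 'I_n.+1 then 1 else h.
have -> : h ^+ (\sum_i if i == ord_max then 0 else e i)%N = \prod_i lam i ^+ e i.
  by rewrite -prodrXr; apply: eq_bigr => i _; rewrite /lam; case: eqP; rewrite ?expr1n.
rewrite /flex_resultant -(resultant_scale charK0 (@flex_degrees_gt0 n)).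
apply: eq_mod_resultant => i a; rewrite flex_formsE /wronskian_forms /replace_form /lam.
case: eqP => _; first by rewrite scale1r; apply: eq_mod_refl.
by exists (- (polar h i.+1)@_a); apply: mcoeff_combination.
Qed.

(** The identity of [wronskian_exchange] for h = l1^d reads, modulo f, as the exchange relation
    multiplied by h^E, a power of l1 that can be cancelled. *)
Lemma flex_resultant_exchange f l1 :
  f \is d.-homog -> l1 \is 1.-homog ->
  (forall N p, (exists h, l1 ^+ N * p = h * f) -> exists h, p = h * f) ->
  forall l l', l \is 1.-homog -> l' \is 1.-homog ->
  eq_mod f (flex_resultant f l * l' ^+ n`!) (flex_resultant f l' * l ^+ n`!).
Proof.
move=> hf hl1 reg l l' hl hl'; have [E EP] := wronskian_forms_mod.
apply: (reg (d * E)%N); have hh : l1 ^+ d \is d.-homog.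
  by rewrite -[X in X.-homog]mul1n; apply: dhomogMn.
have e := wronskian_exchange hf hh hl hl'.
have H m m' : eq_mod f (Defs.resultant deg (wronskian_forms f (l1 ^+ d) m) * m' ^+ n`!)
    (l1 ^+ (d * E) * (flex_resultant f m * m' ^+ n`!)).
  rewrite mulrA exprM; apply: eq_modM; [exact: EP | exact: eq_mod_refl].
have Hl' := H l' l; rewrite -e in Hl'.
have [g' g'e] := eq_mod_trans (eq_mod_sym (H l l')) Hl'.
by exists g'; rewrite mulrBr.
Qed.

(** The test d <= k is there because [k - d] is truncated at 0: h * f has no part of degree below
    d. *)
Lemma pihomog_mul f h k : f \is d.-homog ->
  pihomog mdeg k (h * f) = (if (d <= k)%N then pihomog mdeg (k - d) h else 0) * f.
Proof.
move=> hf; elim/mpolyind: h => [|c a h _ _ IH].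
  by rewrite mul0r !pihomog0; case: ifP; rewrite mul0r.
rewrite mulrDl pihomogD IH; case: ifP => dk; last first.
  have hXf : c *: 'X_[a] * f \is (mdeg a + d).-homog.
    by apply: dhomogM hf; rewrite dhomogZ // dhomogX.
  rewrite mul0r addr0 (pihomog_ne0 _ hXf) //.
  by apply/negP => /eqP kE; rewrite -kE leq_addl in dk.
rewrite pihomogD mulrDl; congr (_ + _).
have hX : c *: 'X_[a] \is (mdeg a).-homog by rewrite dhomogZ // dhomogX.
have hXf := dhomogM hX hf.
have [ak|ak] := eqVneq (mdeg a) (k - d)%N.
  by rewrite !pihomog_dE // -?ak //; rewrite ak subnK // in hXf.
rewrite (pihomog_ne0 ak hX) mul0r (pihomog_ne0 _ hXf) //.
by apply: contraNneq ak => <-; rewrite addnK.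
Qed.

End FlexResultant.

Section FlexPolynomial.

Variables (K : closedFieldType) (n d : nat).
Hypothesis charK0 : [pchar K] =i pred0.
Implicit Types f l : {mpoly K[n.+1]}.

Local Notation deg := (@flex_degrees n).
Local Notation e i := (\prod_(j | j != i) deg j)%N.

(** The degree in x of the i-th flex form: d - k for the polar of index k = i + 1, and 0 for
    l(y). *)
Let w (i : 'I_n.+1) := if (i < n)%N then (d - i.+1)%N else 0%N.

(** The resultant has degree n! / k in the k-th polar, and (d - k) n! / k + n! = d n! / k; sum over
    k. Subtracting the degree n! of l^(n!) then leaves the required degree, as n n! + n! = (n +
    1)!. *)
Lemma flex_weight_sum : (n <= d)%N ->
  (\sum_i w i * e i + n * n`! = d * \sum_(1 <= k < n.+1) n`! %/ k)%N.
Proof.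
move=> nd; have w0 : w ord_max = 0%N by rewrite /w ltnn.
pose u (i : 'I_n) := widen_ord (leqnSn n) i.
have -> : (\sum_i w i * e i = \sum_(i < n) w (u i) * e (u i))%N.
  by rewrite big_ord_recr w0; apply: addn0.
have -> : (n * n`! = \sum_(i < n) n`!)%N by rewrite sum_nat_const card_ord.
rewrite big_add1 big_mkord big_distrr -big_split.
apply: eq_bigr => i _; have := flex_degrees_cofactor (widen_ord (leqnSn n) i).
rewrite /w /flex_degrees [nat_of_ord (widen_ord _ _)]/= ltn_ord; set c := (X in (_ * X)%N) => cE.
have H : ((d - i.+1) * c + i.+1 * c = d * c)%N.
  by rewrite -mulnDl subnK // (leq_trans (ltn_ord i)).
by rewrite -cE mulKn //; exact: H.
Qed.

Lemma flex_resultant_homog f l : (n <= d)%N -> f \is d.-homog ->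
  flex_resultant f l \is (\sum_i w i * e i)%N.-homog.
Proof.
move=> nd hf; apply: (resultant_coef_homog charK0 (@flex_degrees_gt0 n)) => i a.
rewrite /flex_forms /w; case: ifP => [ni|_].
  exact: polar_coef_homog hf (leq_trans ni nd).
by rewrite mcoeff_map_mpoly /= -[_%:MP]mulr1 mul_mpolyC dhomogZ // dhomog1.
Qed.

(** The form of index d is the polar of order d + 1, which is zero, and the resultant has positive
    degree in it. *)
Lemma flex_resultant_small f l : (d < n)%N -> f \is d.-homog -> flex_resultant f l = 0.
Proof.
move=> dn hf; pose lam (i : 'I_n.+1) : {mpoly K[n.+1]} := if d == i then 0 else 1.
pose i0 : 'I_n.+1 := Ordinal (ltn_trans dn (ltnSn n)).
have -> : flex_resultant f l = Defs.resultant deg (fun i => lam i *: flex_forms f l i).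
  apply: eq_resultant => i; rewrite /lam; case: eqP => [di|_]; last by rewrite scale1r.
  by rewrite scale0r /flex_forms -di dn (polar_gt hf).
rewrite (resultant_scale charK0 (@flex_degrees_gt0 n)) (bigD1 i0) //= /lam eqxx.
have e0 : (0 < e i0)%N by rewrite prodn_gt0 // => i; apply: flex_degrees_gt0.
by rewrite expr0n eqn0Ngt e0 !mul0r.
Qed.

(** The flex resultant is homogeneous of some degree E and l, f are forms, so the congruence may be
    replaced by its part of degree E; that of l^(n!) r involves only the part of r of degree E - n!.
    If d < n, the resultant is zero and rho = 0 serves. *)
Lemma flex_polynomial_homog f l r : f \is d.-homog -> l \is 1.-homog ->
  eq_mod f (flex_resultant f l) (l ^+ n`! * r) ->
  exists2 rho, homog_of_degree (flex_degree n d) rho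
    & eq_mod f (flex_resultant f l) (l ^+ n`! * rho).
Proof.
move=> hf hl [h hE]; have [dn|nd] := ltnP d n.
  exists 0; first by move=> a; rewrite msupp0.
  by rewrite (flex_resultant_small _ dn hf) mulr0; apply: eq_mod_refl.
have hA := flex_resultant_homog l nd hf; set E := (\sum_i _)%N in hA.
have hlN : l ^+ n`! \is (n`!).-homog by rewrite -[X in X.-homog]mul1n; apply: dhomogMn.
(* For E < n! the part of degree E of l^(n!) r is zero. *)
exists (if (n`! <= E)%N then pihomog mdeg (E - n`!) r else 0).
  case: ifP => [NE|_] a; last by rewrite msupp0.
  move=> /(dhomog_mf (pihomogP _ _ _)) /= ->; rewrite /flex_degree -flex_weight_sum // -/E.
  rewrite factS; lia.
exists (if (d <= E)%N then pihomog mdeg (E - d) h else 0).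
rewrite -(pihomog_mul _ _ hf) -hE pihomogB (pihomog_dE hA) mulrC.
by rewrite [l ^+ _ * r]mulrC (pihomog_mul _ _ hlN).
Qed.

End FlexPolynomial.

Lemma row_free_pairP (K : fieldType) n (p q : 'rV[K]_n.+1) : p != 0 ->
  row_free (col_mx p q) <-> (forall c, exists j, q ord0 j != c * p ord0 j).
Proof.
move=> p0; split=> [fr c|nm].
  apply: NNPP => nj; have qE : q = c *: p.
    apply/rowP => j; rewrite !mxE; apply/eqP; apply: contraT => qj; case: nj.
    by exists j.
  have : row_mx (- c)%:M 1%:M *m col_mx p q = 0.
    by rewrite mul_row_col !mul_scalar_mx scale1r qE scaleNr addNr.
  rewrite -(mul0mx _ (col_mx p q)) => /(row_free_inj fr)/eqP.
  rewrite row_mx_eq0 => /andP[_ /eqP/matrixP/(_ ord0 ord0)].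
  by rewrite !mxE eqxx => /eqP; rewrite oner_eq0.
rewrite -kermx_eq0; apply/rowV0P => v /sub_kermxP.
rewrite -(hsubmxK v) mul_row_col [lsubmx v]mx11_scalar [rsubmx v]mx11_scalar.
rewrite !mul_scalar_mx; set a := lsubmx v _ _; set b := rsubmx v _ _ => ab0.
have abE j : a * p ord0 j + b * q ord0 j = 0 by move/rowP/(_ j): ab0; rewrite !mxE.
have b0 : b = 0.
  apply/eqP; apply: contraT => bnz; have [j] := nm (- a / b).
  case/eqP; apply: (mulfI bnz); rewrite mulrA mulrCA mulfV // mulr1 mulNr.
  by apply/eqP; rewrite -addr_eq0 addrC abE.
suff a0 : a = 0 by rewrite a0 b0 !raddf0 row_mx0.
apply/eqP; apply: contraT => anz; case/eqP: p0; apply/rowP => j; rewrite mxE.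
by apply/eqP; move/eqP: (abE j); rewrite b0 mul0r addr0 mulf_eq0 (negPf anz).
Qed.

(** * The flex locus as the zeros of the flex polynomial on V *)

Section FlexCriterion.

Variables (K : closedFieldType) (n d : nat).
Hypothesis charK0 : [pchar K] =i pred0.
Variables (f : {mpoly K[n.+1]}).
Hypothesis f_homog : f \is d.-homog.

Lemma is_flexP (p : 'rV[K]_n.+1) : p != 0 ->
  is_flex f p <-> on_zeros f p /\ exists y, flex_direction f (p ord0) y.
Proof.
move=> p0; split=> -[fp0 [q qP]]; split=> //.
  exists (q ord0); case: qP => /(row_free_pairP _ p0) qp /contact_order_geP; split=> //.
have qE j : (\row_j q j) ord0 j = q j by rewrite mxE.
case: qP => qp tq; exists (\row_j q j); split.
  by apply/(row_free_pairP _ p0) => c; have [j qj] := qp c; exists j; rewrite qE.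
apply/contact_order_geP; suff -> : restrict_to_line f p (\row_j q j) = line_poly f (p ord0) q by [].
by apply: eq_mmap => // i; rewrite qE.
Qed.

Lemma flex_resultant_at l x :
  (flex_resultant f l).@[x] = Defs.resultant (@flex_degrees n) (flex_forms_at f x l).
Proof.
apply: etrans (resultant_map (meval x) _ _) _; apply: eq_resultant => i.
by rewrite flex_formsE map_replace_form map_in_y.
Qed.

(** Some coordinate X_i is nonzero at p. At p on V the congruence for l = X_i becomes R(X_i)(p) =
    (p_i)^(n!) rho(p), and its left side vanishes exactly when p has a flex direction. *)
Lemma flex_condition_flex rho (p : 'rV[K]_n.+1) : p != 0 -> flex_condition f rho ->
  is_flex f p <-> on_zeros f p /\ on_zeros rho p.
Proof.
move=> p0 rhoP; apply: (iff_trans (is_flexP p0)).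
have [i pi] : exists i, p ord0 i != 0.
  apply: NNPP => np; case/eqP: p0; apply/rowP => i; rewrite mxE; apply/eqP.
  by apply: contraT => pi; case: np; exists i.
have hX : ('X_i : {mpoly K[n.+1]}) \is 1.-homog by rewrite dhomogX /= mdeg1.
have Xp : ('X_i : {mpoly K[n.+1]}).@[p ord0] != 0 by rewrite mevalXU.
split=> -[fp0 H]; split=> //; have [h hE] := rhoP _ hX.
all: have := congr1 (meval (p ord0)) hE; rewrite !rmorphB !rmorphM rmorphXn /= fp0 mulr0.
all: move/subr0_eq; rewrite flex_resultant_at.
  move/(flex_resultant_at_flex charK0 f_homog fp0 hX Xp): H => -> /esym/eqP.
  by rewrite mulf_eq0 expf_eq0 (negPf Xp) andbF => /eqP.
rewrite H mulr0 => /(flex_resultant_at_flex charK0 f_homog fp0 hX Xp); exact.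
Qed.

End FlexCriterion.

Theorem theorem1p1 (K : closedFieldType) (charK0 : [pchar K] =i pred0)
    (n d : nat) (n_gt1 : (1 < n)%N) (d_gt0 : (0 < d)%N)
    (f : {mpoly K[n.+1]}) (f_homog : f \is d.-homog)
    (f_sqfree : mpoly_squarefree f) :
  exists rho : {mpoly K[n.+1]},
    [/\ homog_of_degree (flex_degree n d) rho,
        forall p : 'rV[K]_n.+1, p != 0 ->
          (is_flex f p <-> on_zeros f p /\ on_zeros rho p),
        flex_condition f rho
      & forall rho' : {mpoly K[n.+1]},
          flex_condition f rho' -> eq_mod f rho' rho].
Proof.
have [l1 [l2 [hl1 hl2 nonzerodiv regular]]] :=
  regular_linear_forms charK0 n_gt1 d_gt0 f_homog f_sqfree.1.
have exch := flex_resultant_exchange charK0 f_homog hl1 nonzerodiv.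
(* In the exchange relation l2^(n!) R(l1) = l1^(n!) R(l2) modulo f, regularity of l1, l2 divides
   R(l1) by l1^(n!). *)
have [r0 r0P] : exists r, eq_mod f (flex_resultant f l1) (l1 ^+ n`! * r).
  apply: (regular _ _ (flex_resultant f l2)).
  rewrite [l2 ^+ _ * _]mulrC [l1 ^+ _ * _]mulrC; exact: exch.
have [rho rho_homog rhoP] := flex_polynomial_homog charK0 f_homog hl1 r0P.
(* Modulo f, l1^(n!) R(l) = l^(n!) R(l1) = l^(n!) l1^(n!) rho, and l1^(n!) can be cancelled. *)
have rho_cond : flex_condition f rho.
  move=> l hl; apply: (nonzerodiv n`!).
  have [h hE] := eq_mod_trans (exch l l1 hl hl1) (eq_modM rhoP (eq_mod_refl f (l ^+ n`!))).
  by exists h; rewrite -hE; ring.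
exists rho; split=> // [p p0|rho' rho'P].
  exact: (flex_condition_flex charK0 f_homog p0 rho_cond).
(* Uniqueness: l1^(n!) rho' and l1^(n!) rho are both congruent to R(l1). *)
apply: (nonzerodiv n`!); have [h hE] := eq_mod_trans (eq_mod_sym (rho'P _ hl1)) rhoP.
by exists h; rewrite -hE; ring.
Qed.
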